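(* Let $D_{n_0}^{\mathbf n,\mathbf p}(\mu)$ be a generalized Fock-Bargmann-Hartogs domain. The automorphism group $\mathrm{Aut}(D_{n_0}^{\mathbf n,\mathbf p}(\mu))$ is generated by the following mappings: $$\varphi_A:(z,w_{(1)},\dots,w_{(l)})\longmapsto(zA,w_{(1)},\dots,w_{(l)}),$$ $$\varphi_D:(z,w_{(1)},\dots,w_{(l)})\longmapsto(z,\,w_{(\sigma(1))}\Gamma_1,\dots,w_{(\sigma(l))}\Gamma_l),$$ $$\varphi_a:(z,w_{(1)},\dots,w_{(l)})\longmapsto\Big(z+a,\;w_{(1)}\big(e^{-2\mu\langle z,a\rangle-\mu\|a\|^2}\big)^{\frac1{2p_1}},\dots,w_{(l)}\big(e^{-2\mu\langle z,a\rangle-\mu\|a\|^2}\big)^{\frac1{2p_l}}\Big),$$ where $A$ ranges over $\mathcal U(n_0)$, $a$ ranges over $\mathbb C^{n_0}$, $\sigma$ ranges over the permutations in $S_l$ with $n_{\sigma(j)}=n_j$ and $p_{\sigma(j)}=p_j$ for $1\le j\le l$, and $\Gamma_j$ ranges over $\mathcal U(n_j)$ $(1\le j\le l)$.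
   Context: For a positive integer $n_0$, $\mathbf n=(n_1,\dots,n_l)$ with positive integer entries, $\mathbf p=(p_1,\dots,p_l)$ with positive real entries, and $\mu>0$, the generalized Fock-Bargmann-Hartogs domain is $$D_{n_0}^{\mathbf n,\mathbf p}(\mu)=\Big\{(z,w_{(1)},\dots,w_{(l)})\in\mathbb C^{n_0}\times\mathbb C^{n_1}\times\cdots\times\mathbb C^{n_l}:\ \sum_{j=1}^l\|w_{(j)}\|^{2p_j}<e^{-\mu\|z\|^2}\Big\},$$ where $\|\cdot\|$ is the standard Hermitian norm. Standing assumption: $p_i\ne1$ for $2\le i\le l$ ($p_1$ may or may not equal $1$). Vectors are row vectors; $\langle z,a\rangle=\sum_i z_i\overline{a_i}$; $(e^{u})^{1/(2p)}$ means $e^{u/(2p)}$; $\mathcal U(k)$ is the group of $k\times k$ unitary matrices; $S_l$ is the symmetric group on $\{1,\dots,l\}$; $\mathrm{Aut}(D)$ is the group of biholomorphic self-maps of $D$. *)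

(* Defs.v *)
From HB Require Import structures.
From mathcomp Require Import all_boot all_order all_algebra all_fingroup.
From mathcomp Require Import spectral complex.
From mathcomp Require Import all_classical all_reals all_analysis.

Set Implicit Arguments.
Unset Strict Implicit.
Unset Printing Implicit Defensive.

Import Order.TTheory GRing.Theory Num.Theory.
Import numFieldNormedType.Exports.

Local Open Scope classical_set_scope.
Local Open Scope ring_scope.
Local Open Scope complex_scope.

(* The norm of the library on 'rV[R[i]]_k is the sup norm, and it takes its
   values in R[i]; it is used here for the topology only. *)
Definition hnorm (R : realType) (k : nat) (z : 'rV[R[i]]_k) : R :=
  Num.sqrt (complex.Re (dotmx z z)).

Definition cexp (R : realType) (u : R[i]) : R[i] :=
  (expR (complex.Re u))%:C * (cos (complex.Im u) +i* sin (complex.Im u)).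

(* C^{n_0} x (C^{n_1} x ... x C^{n_l}); the second factor is stored as one row
   vector, whose j-th block w_(j) is submxrow w j. *)
Definition fbh_space (R : realType) (l n0 : nat) (n : 'I_l -> nat) : Type :=
  ('rV[R[i]]_n0 * 'rV[R[i]]_(\sum_(j < l) n j))%type.

Definition fbh_domain (R : realType) (l n0 : nat) (n : 'I_l -> nat)
    (p : 'I_l -> R) (mu : R) : set (fbh_space R n0 n) :=
  [set x | \sum_(j < l) hnorm (submxrow x.2 j) `^ (2 * p j)
             < expR (- mu * hnorm x.1 ^+ 2)].

(* Self-maps of a set D are represented by total functions whose values outside
   of D are irrelevant. *)

(* Over the field R[i], [differentiable] asks for a continuous C-linear
   differential; this is holomorphy on D when D is open. *)
Definition holomorphic_on (R : realType) (V W : normedModType R[i])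
    (D : set V) (f : V -> W) : Prop :=
  forall x, D x -> differentiable f x.

Definition inverse_on (T : Type) (D : set T) (f g : T -> T) : Prop :=
  [/\ forall x, D x -> D (f x), forall x, D x -> D (g x),
      forall x, D x -> g (f x) = x & forall x, D x -> f (g x) = x].

Definition holo_aut (R : realType) (V : normedModType R[i]) (D : set V) :
    set (V -> V) :=
  [set f | exists g, [/\ inverse_on D f g,
                         holomorphic_on D f & holomorphic_on D g]].

(* The subgroup generated by G. As maps are only meant on D, so is the inverse,
   and the subgroup is saturated for equality on D. *)
Inductive generated_subgroup (T : Type) (D : set T) (G : set (T -> T)) :
    set (T -> T) :=
| generated_base f : G f -> generated_subgroup D G f
| generated_id : generated_subgroup D G id
| generated_comp f g :
    generated_subgroup D G f -> generated_subgroup D G g ->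
    generated_subgroup D G (f \o g)
| generated_inv f g :
    generated_subgroup D G f -> inverse_on D f g -> generated_subgroup D G g
| generated_eq f g :
    generated_subgroup D G f -> (forall x, D x -> f x = g x) ->
    generated_subgroup D G g.

Section Generators.
Context (R : realType) (l n0 : nat) (n : 'I_l -> nat) (p : 'I_l -> R) (mu : R).

Definition phiA (A : 'M[R[i]]_n0) (x : fbh_space R n0 n) : fbh_space R n0 n :=
  (x.1 *m A, x.2).

Definition phiD (s : 'S_l) (ns : forall j, n (s j) = n j)
    (Gam : forall j, 'M[R[i]]_(n j)) (x : fbh_space R n0 n) : fbh_space R n0 n :=
  (x.1, \mxrow_(j < l) (castmx (erefl 1%N, ns j) (submxrow x.2 (s j)) *m Gam j)).

(* (e^u)^(1/(2p_j)) is read as e^(u/(2p_j)). *)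
Definition phia (a : 'rV[R[i]]_n0) (x : fbh_space R n0 n) : fbh_space R n0 n :=
  (x.1 + a,
   \mxrow_(j < l)
     (cexp ((- 2 * mu%:C * dotmx x.1 a - (mu * hnorm a ^+ 2)%:C)
              / (2 * p j)%:C)
        *: submxrow x.2 j)).

Variant fbh_generator : set (fbh_space R n0 n -> fbh_space R n0 n) :=
| gen_phiA A : A \is unitarymx -> fbh_generator (phiA A)
| gen_phiD (s : 'S_l) (ns : forall j, n (s j) = n j)
    (Gam : forall j, 'M[R[i]]_(n j)) :
    (forall j, p (s j) = p j) -> (forall j, Gam j \is unitarymx) ->
    fbh_generator (phiD ns Gam)
| gen_phia a : fbh_generator (phia a).

End Generators.

(* Main.v *)
(* Let f be an automorphism. As the section w = 0 is a union of complex lines on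
   which w o f is bounded, Liouville's theorem shows that f preserves it. A strong
   maximum principle for sum_j |W_j|^(2 p_j) * exp (kappa |Z|^2), with W and Z
   holomorphic, along the discs t |-> f (z, t w), applied to the quotient of the
   w-component by t, shows that f (z, w) = (F z, C z w) on the domain, with C z
   linear. After composition with some phi_a one has F 0 = 0. Along a complex line
   through 0 the maximum principle on large discs gives |F z| <= |z|, hence
   |F z| = |z| by symmetry, and then its equality case makes F linear and C
   constant. Thus F is unitary, and C preserves sum_j |w_j|^(2 p_j). Comparing
   the degrees 2 p_j and using the equality case of Clarkson's inequality
   (p_j <> 1), the images of two different blocks have no block in common, so
   that C permutes the blocks up to unitary maps. *)
Require Import Defs.
From HB Require Import structures.
From mathcomp Require Import all_boot all_order all_algebra all_fingroup.
From mathcomp Require Import spectral complex.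
From mathcomp Require Import all_classical all_reals all_analysis.
From mathcomp Require Import ring lra.
Import Order.TTheory GRing.Theory Num.Theory.
Import numFieldNormedType.Exports.
Local Open Scope ring_scope.
Set Implicit Arguments.
Unset Strict Implicit.
Unset Printing Implicit Defensive.

(** * Goursat's theorem on a box *)

Section Goursat.
Context {R : realType}.
Implicit Types (P Q : R -> R -> R).

(** The domain contains the complex lines of w = 0, so the uniqueness theorem for bounded domains
    does not apply, and for small p_j the defining sum is neither convex nor smooth. All rigidity
    therefore comes from maximum principles for sum_j |W_j|^(2 p_j) * exp (k |Z|^2), valid for every
    p_j > 0. They rest on one fact: a holomorphic function whose real part has a local maximum is
    locally constant. Goursat's theorem yields it without power series or Cauchy's formula. The
    constant k depends on the disc. On a fiber it is mu, and the function is the one that defines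
    the domain. On a line through 0 with unit direction z, Z is F (t z) / t; as |F (t z)| = r |Z| on
    |t| = r, the constant is mu r^2. Since r is unlimited, this exponent outgrows every constant,
    which forces |Z| <= 1. The condition on the exponents keeps blocks from mixing: two blocks with
    exponent 1 would form a single Hermitian space with a larger unitary group, whereas for an
    exponent other than 1 the defect in Clarkson's inequality has a strict sign. *)

Lemma nested_segments (a b : nat -> R) :
  (forall n, a n <= a n.+1) -> (forall n, b n.+1 <= b n) ->
  (forall n, a n <= b n) -> exists x, forall n, a n <= x <= b n.
Proof.
move=> ha hb hab.
have mono_a : {homo a : m n / (m <= n)%N >-> m <= n}.
  by apply/nondecreasing_seqP.
have mono_b m n : (m <= n)%N -> b n <= b m.
  move=> mn; have : {homo (fun k => - b k) : m n / (m <= n)%N >-> m <= n}.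
    by apply/nondecreasing_seqP => k; rewrite lerN2.
  by move=> /(_ _ _ mn); rewrite lerN2.
have ub m n : a m <= b n.
  apply: (le_trans (mono_a _ _ (leq_maxl m n))).
  apply: (le_trans (hab _)); exact: mono_b (leq_maxr _ _).
exists (sup (range a)) => n; apply/andP; split.
  apply: ub_le_sup; last by exists n.
  by exists (b 0%N) => _ [m _ <-].
apply: ge_sup; first by exists (a 0%N), 0%N.
by move=> _ [m _ <-].
Qed.

(** If [P] failed on a box it would fail on one of its quarters, and so on; the nested boxes shrink
    to a point, where the local hypothesis is contradicted. This argument replaces compactness in
    Goursat's theorem and in the existence of maxima, and connectedness in its one-dimensional
    form. *)
Lemma box_bisection (P : R -> R -> R -> R -> Prop) :
  (forall a b c d : R, a <= b -> c <= d ->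
     P a ((a + b) / 2) c ((c + d) / 2) -> P ((a + b) / 2) b c ((c + d) / 2) ->
     P a ((a + b) / 2) ((c + d) / 2) d -> P ((a + b) / 2) b ((c + d) / 2) d ->
     P a b c d) ->
  forall a b c d : R, a <= b -> c <= d ->
  (forall x y : R, a <= x <= b -> c <= y <= d -> exists2 e : R, 0 < e &
     forall a' b' c' d' : R, a' <= x <= b' -> c' <= y <= d' ->
       b' - a' < e -> d' - c' < e -> P a' b' c' d') ->
  P a b c d.
Proof.
move=> hsub a b c d ab cd hloc; apply: contrapT => nP.
pose T := (R * R * R * R)%type.
pose ok (q : T) := [/\ q.1.1.1 <= q.1.1.2, q.1.2 <= q.2 &
  ~ P q.1.1.1 q.1.1.2 q.1.2 q.2].
pose half (q q' : T) := [/\ ok q', q.1.1.1 <= q'.1.1.1, q'.1.1.2 <= q.1.1.2,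
   q.1.2 <= q'.1.2 & q'.2 <= q.2] /\
   (q'.1.1.2 - q'.1.1.1 = (q.1.1.2 - q.1.1.1) / 2 /\
    q'.2 - q'.1.2 = (q.2 - q.1.2) / 2).
have /choice[step hstep] : forall q : T, exists q', ok q -> half q q'.
  move=> [[[x y] z] t]; case: (pselect (ok (x, y, z, t))) => [[/= xy zt nPq]|nq];
    last by exists (x, y, z, t).
  have := hsub _ _ _ _ xy zt; set m := (x + y) / 2; set k := (z + t) / 2 => H.
  have [xm my zk kt] : [/\ x <= m, m <= y, z <= k & k <= t].
    by rewrite /m /k; split; lra.
  case: (pselect (P x m z k)) => [P1|P1]; last first.
    by exists (x, m, z, k) => _; do !split => //=; rewrite /m /k; lra.
  case: (pselect (P m y z k)) => [P2|P2]; last first.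
    by exists (m, y, z, k) => _; do !split => //=; rewrite /m /k; lra.
  case: (pselect (P x m k t)) => [P3|P3]; last first.
    by exists (x, m, k, t) => _; do !split => //=; rewrite /m /k; lra.
  case: (pselect (P m y k t)) => [P4|P4]; last first.
    by exists (m, y, k, t) => _; do !split => //=; rewrite /m /k; lra.
  by exfalso; apply/nPq/H.
pose q n := iter n step (a, b, c, d).
have okq n : ok (q n).
  elim: n => [|n IH]; first by rewrite /ok; split.
  by have [[? _ _ _ _] _] := hstep _ IH.
have hq n := hstep _ (okq n).
have [x hx] : exists x, forall n, (q n).1.1.1 <= x <= (q n).1.1.2.
  by apply: nested_segments => n; have [[[? ? ?] ? ? ? ?] ?] := hq n => //;
    have [] := okq n.
have [y hy] : exists y, forall n, (q n).1.2 <= y <= (q n).2.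
  by apply: nested_segments => n; have [[[? ? ?] ? ? ? ?] ?] := hq n => //;
    have [] := okq n.
have w1 n : (q n).1.1.2 - (q n).1.1.1 = (b - a) / 2 ^+ n.
  elim: n => [|n IH]; first by rewrite expr0 divr1.
  by have [_ [-> _]] := hq n; rewrite IH exprSr invfM mulrA.
have w2 n : (q n).2 - (q n).1.2 = (d - c) / 2 ^+ n.
  elim: n => [|n IH]; first by rewrite expr0 divr1.
  by have [_ [_ ->]] := hq n; rewrite IH exprSr invfM mulrA.
have [e e0 he] := hloc x y (hx 0%N) (hy 0%N).
pose M := Num.max (b - a) (d - c).
have [n hn] : exists n : nat, M / 2 ^+ n < e.
  have M0 : 0 <= M by rewrite /M le_max subr_ge0 ab.
  exists (Num.truncn (M / e)).+1.
  rewrite ltr_pdivrMr ?exprn_gt0// mulrC -ltr_pdivrMr//.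
  apply: (lt_trans (truncnS_gt _)).
  by rewrite -natrX ltr_nat ltn_expl.
have [_ _] := okq n; apply; apply: he => //.
  apply: le_lt_trans hn; rewrite w1 ler_pM2r ?invr_gt0 ?exprn_gt0//.
  by rewrite /M le_max lexx.
apply: le_lt_trans hn; rewrite w2 ler_pM2r ?invr_gt0 ?exprn_gt0//.
by rewrite /M le_max lexx orbT.
Qed.

Lemma segment_bisection (P : R -> R -> Prop) :
  (forall a b : R, a <= b -> P a ((a + b) / 2) -> P ((a + b) / 2) b -> P a b) ->
  forall a b : R, a <= b ->
  (forall x : R, a <= x <= b -> exists2 e : R, 0 < e &
     forall a' b' : R, a' <= x <= b' -> b' - a' < e -> P a' b') ->
  P a b.
Proof.
move=> hsub a b ab hloc.
apply: (@box_bisection (fun a b _ _ => P a b) _ a b 0 0) => //.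
  by move=> x y _ _ xy _ h1 h2 _ _; apply: hsub.
by move=> x y /hloc[e e0 he] _; exists e => // a' b' _ _ ? _ ? _; apply: he.
Qed.

Lemma continuous_primitive (f : R -> R) (a b : R) : continuous f -> a < b ->
  exists F : R -> R, forall x, a < x < b -> is_derive x 1 F (f x).
Proof.
move=> cf ab; exists (fun x => \int[lebesgue_measure]_(t in `[a, x]) f t).
move=> x /andP[ax xb].
have fi : lebesgue_measure.-integrable `[a, b] (EFin \o f).
  apply: continuous_compact_integrable; first exact: segment_compact.
  by apply: continuous_subspaceT.
have [dF F'] := continuous_FTC1_closed xb fi ax (cf x).
by apply: (DeriveDef dF); rewrite -F' derive1E.
Qed.

Lemma seg_dist (a b x u : R) : a <= x -> x <= b -> a <= u -> u <= b -> `|u - x| <= b - a.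
Proof. by move=> *; rewrite ler_norml; apply/andP; split; lra. Qed.

Lemma increment_MVT (f df : R -> R) (a b : R) : a <= b ->
  (forall x, a <= x <= b -> is_derive x 1 f (df x)) ->
  exists2 c, a <= c <= b & f b - f a = df c * (b - a).
Proof.
move=> ab dfE; have [| |c] := @MVT_segment R f df a b ab.
- by move=> x; rewrite in_itv/= => /andP[? ?]; apply: dfE; rewrite !ltW.
- apply: derivable_within_continuous => x; rewrite in_itv/= => xab.
  exact: (@ex_derive _ _ _ _ _ _ _ (dfE x xab)).
- by rewrite in_itv/=; exists c.
Qed.

(* The boundary integral [Q dx + P dy] (the imaginary part of the integral of
   [P + iQ]) vanishes on every box. Integrals are increments of primitives. *)
Lemma goursat P Q (A B : R -> R -> R) (a b c d : R) : a <= b -> c <= d ->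
  (forall x y : R, a <= x <= b -> c <= y <= d -> is_derive x 1 (A^~ y) (Q x y)) ->
  (forall x y : R, a <= x <= b -> c <= y <= d -> is_derive y 1 (B x) (P x y)) ->
  (forall x y : R, a <= x <= b -> c <= y <= d -> exists al be : R,
    forall e : R, 0 < e -> exists2 r : R, 0 < r &
      forall h k : R, `|h| < r -> `|k| < r ->
      `|P (x + h) (y + k) - P x y - (al * h - be * k)| <= e * (`|h| + `|k|) /\
      `|Q (x + h) (y + k) - Q x y - (be * h + al * k)| <= e * (`|h| + `|k|)) ->
  B b d - B b c - (B a d - B a c) = A b d - A a d - (A b c - A a c).
Proof.
move=> ab cd dA dB CR.
pose Phi a b c d : R := B b d - B b c - (B a d - B a c) - (A b d - A a d - (A b c - A a c)).
suff Phi0 e : 0 < e -> `|Phi a b c d| <= e * ((b - a) + (d - c)) ^+ 2.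
  apply/eqP; rewrite -subr_eq0 -normr_le0 leNgt; apply/negP => Phi_gt0.
  pose M := ((b - a) + (d - c)) ^+ 2 + 1.
  have M0 : 0 < M by rewrite ltr_wpDl// sqr_ge0.
  have := Phi0 (`|Phi a b c d| / M); rewrite divr_gt0// => /(_ isT).
  rewrite mulrAC ler_pdivlMr// ler_pM2l// /M.
  by rewrite -subr_ge0 opprD addNKr oppr_ge0 leNgt ltr01.
move=> e0.
apply: (@box_bisection (fun a' b' c' d' => a <= a' -> b' <= b -> c <= c' -> d' <= d ->
  `|Phi a' b' c' d'| <= e * ((b' - a') + (d' - c')) ^+ 2)) => //.
  move=> x y z t xy zt; set m := (x + y) / 2; set k := (z + t) / 2.
  have [xm my zk kt] : [/\ x <= m, m <= y, z <= k & k <= t].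
    by rewrite /m /k; split; lra.
  move=> H1 H2 H3 H4 ax yb cz td.
  have {}H1 := H1 ax (le_trans my yb) cz (le_trans kt td).
  have {}H2 := H2 (le_trans ax xm) yb cz (le_trans kt td).
  have {}H3 := H3 ax (le_trans my yb) (le_trans cz zk) td.
  have {}H4 := H4 (le_trans ax xm) yb (le_trans cz zk) td.
  have -> : Phi x y z t = Phi x m z k + Phi m y z k + (Phi x m k t + Phi m y k t).
    by rewrite /Phi; ring.
  apply: (le_trans (ler_normD _ _)).
  (* A quarter has half the sum of side lengths, so the four quadratic bounds add up to exactly the
     bound of the whole box. *)
  have -> : e * (y - x + (t - z)) ^+ 2 =
    e * (m - x + (k - z)) ^+ 2 + e * (y - m + (k - z)) ^+ 2 +
    (e * (m - x + (t - k)) ^+ 2 + e * (y - m + (t - k)) ^+ 2).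
    by rewrite /m /k; field.
  by apply: lerD; apply: (le_trans (ler_normD _ _)); apply: lerD.
move=> x y xab ycd; have [al [be CRxy]] := CR x y xab ycd.
have e40 : 0 < e / 4 by rewrite divr_gt0.
have [r r0 hr] := CRxy _ e40.
exists r => // x1 x2 y1 y2 /andP[x1x xx2] /andP[y1y yy2] hx hy ax1 x2b cy1 y2d.
pose s := (x2 - x1) + (y2 - y1).
have est u v : x1 <= u <= x2 -> y1 <= v <= y2 ->
    `|P u v - P x y - (al * (u - x) - be * (v - y))| <= e / 4 * s /\
    `|Q u v - Q x y - (be * (u - x) + al * (v - y))| <= e / 4 * s.
  move=> /andP[u1 u2] /andP[v1 v2].
  have hu : `|u - x| <= x2 - x1 by exact: (seg_dist x1x xx2 u1 u2).
  have hv : `|v - y| <= y2 - y1 by exact: (seg_dist y1y yy2 v1 v2).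
  have := hr (u - x) (v - y) (le_lt_trans hu hx) (le_lt_trans hv hy).
  rewrite ![_ + (_ - _)]addrC !subrK => -[h1 h2].
  have hs : e / 4 * (`|u - x| + `|v - y|) <= e / 4 * s by rewrite ler_pM2l// lerD.
  by split; [exact: le_trans h1 hs|exact: le_trans h2 hs].
have x12 : x1 <= x2 := le_trans x1x xx2.
have y12 : y1 <= y2 := le_trans y1y yy2.
have ax2 : a <= x2 := le_trans ax1 x12.
have x1b : x1 <= b := le_trans x12 x2b.
have cy2 : c <= y2 := le_trans cy1 y12.
have y1d : y1 <= d := le_trans y12 y2d.
(* The mean value theorem is applied to the difference of the primitives on two opposite sides, so
   that only increments of [Q] (below, of [P]) across the box remain. *)
have [c' cx Ec] : exists2 c', x1 <= c' <= x2 &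
    A x2 y2 - A x1 y2 - (A x2 y1 - A x1 y1) = (Q c' y2 - Q c' y1) * (x2 - x1).
  have [|c' cI E] := @increment_MVT (fun u => A u y2 - A u y1)
      (fun u => Q u y2 - Q u y1) _ _ x12; last by exists c' => //; rewrite -E; ring.
  move=> u /andP[u1 u2]; have uab : a <= u <= b.
    by rewrite (le_trans ax1 u1) (le_trans u2 x2b).
  by apply: (is_deriveB (dA _ _ uab _) (dA _ _ uab _)); apply/andP.
have [d' dy Ed] : exists2 d', y1 <= d' <= y2 &
    B x2 y2 - B x2 y1 - (B x1 y2 - B x1 y1) = (P x2 d' - P x1 d') * (y2 - y1).
  have [|v vI E] := @increment_MVT (fun v => B x2 v - B x1 v)
      (fun v => P x2 v - P x1 v) _ _ y12; last by exists v => //; rewrite -E; ring.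
  move=> v /andP[v1 v2]; have vcd : c <= v <= d.
    by rewrite (le_trans cy1 v1) (le_trans v2 y2d).
  by apply: (is_deriveB (dB _ _ _ vcd) (dB _ _ _ vcd)); apply/andP.
rewrite /Phi Ec Ed.
have x1I : x1 <= x1 <= x2 by rewrite lexx.
have x2I : x1 <= x2 <= x2 by rewrite lexx andbT.
have y1I : y1 <= y1 <= y2 by rewrite lexx.
have y2I : y1 <= y2 <= y2 by rewrite lexx andbT.
have [_ +] := est _ _ cx y2I; have [_ +] := est _ _ cx y1I.
have [+ _] := est _ _ x2I dy; have [+ _] := est _ _ x1I dy.
set q1 := Q c' y1; set q2 := Q c' y2; set p1 := P x1 d'; set p2 := P x2 d'.
move=> h1 h2 h3 h4.
have w1 : 0 <= x2 - x1 by rewrite subr_ge0.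
have w2 : 0 <= y2 - y1 by rewrite subr_ge0.
have half : e / 4 * s + e / 4 * s = e / 2 * s by field.
have b1 : `|p2 - p1 - al * (x2 - x1)| <= e / 2 * s.
  have := le_trans (ler_normB _ _) (lerD h2 h1); rewrite half.
  by apply: le_trans; rewrite le_eqVlt; apply/orP; left; apply/eqP; congr `|_|; ring.
have b2 : `|q2 - q1 - al * (y2 - y1)| <= e / 2 * s.
  have := le_trans (ler_normB _ _) (lerD h4 h3); rewrite half.
  by apply: le_trans; rewrite le_eqVlt; apply/orP; left; apply/eqP; congr `|_|; ring.
(* By the Cauchy-Riemann equations both increments have the same slope [al], so the main terms
   cancel and only the errors [b1] and [b2] are left. *)
have -> : (p2 - p1) * (y2 - y1) - (q2 - q1) * (x2 - x1) =
  (p2 - p1 - al * (x2 - x1)) * (y2 - y1) - (q2 - q1 - al * (y2 - y1)) * (x2 - x1).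
  by ring.
apply: (le_trans (ler_normB _ _)); rewrite !normrM (ger0_norm w1) (ger0_norm w2).
apply: (le_trans (lerD (ler_wpM2r w2 b1) (ler_wpM2r w1 b2))).
have -> : e / 2 * s * (y2 - y1) + e / 2 * s * (x2 - x1) = e * s ^+ 2 / 2.
  by rewrite /s; field.
by rewrite ler_pdivrMr// ler_peMr ?ler1n// mulr_ge0 ?(ltW e0)// sqr_ge0.
Qed.

End Goursat.

(** * Complex analysis in one variable *)

(* The library has this structure only on the alias [R[i]^o]. *)
HB.instance Definition _ (R : realType) :=
  NormedModule.copy R[i] (complex_complex__canonical__Num_NumField R)^o.

Local Open Scope complex_scope.
Local Open Scope classical_set_scope.
Local Notation normc := Normc.normc.
Local Notation Re := (@complex.Re _).
Local Notation Im := (@complex.Im _).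

Section ComplexTopology.
Context {R : realType}.
Implicit Types (z t : R[i]) (u : R[i] -> R[i]).

Lemma normrc z : `|z| = (normc z)%:C.
Proof. by case: z. Qed.

Lemma normc_ge0 z : 0 <= normc z.
Proof. by case: z => x y; apply: sqrtr_ge0. Qed.

Lemma normc_gt0 z : (0 < normc z) = (z != 0).
Proof. by rewrite -normr_gt0 normrc (ltcR 0). Qed.

Lemma normc_real (x : R) : normc x%:C = `|x|.
Proof. by rewrite /= expr0n addr0 sqrtr_sqr. Qed.

Lemma normcB_sym z t : normc (z - t) = normc (t - z).
Proof. by rewrite -normcN opprB. Qed.

Lemma normc_Re z : `|Re z| <= normc z.
Proof. by have := normc_ge_Re z; rewrite normrc lecR. Qed.

Lemma normc_Im z : `|Im z| <= normc z.
Proof.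
by have := normc_Re (z * 'i); rewrite ReiNIm normrN Normc.normcM /=
  expr0n expr1n add0r sqrtr1 mulr1.
Qed.

Lemma normc_le_ReIm z : normc z <= `|Re z| + `|Im z|.
Proof.
rewrite {1}[z]complexE; apply: (le_trans (le_normcD _ _)).
by rewrite Normc.normcM normc_real normc_real /= expr0n expr1n add0r sqrtr1 mul1r.
Qed.

Lemma complex_gt0 (e : R[i]) : 0 < e -> 0 < Re e /\ e = (Re e)%:C.
Proof. by case: e => a b; rewrite ltcE /= => /andP[/eqP -> ->]. Qed.

Lemma nbhs_complexP t (A : set R[i]) :
  nbhs t A <-> exists2 e : R, 0 < e & forall z, normc (z - t) < e -> A z.
Proof.
split.
  move=> /nbhs_ballP[e /= /complex_gt0[e0 ee] H]; exists (Re e) => // z zt.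
  by apply: H; rewrite -ball_normE /= distrC normrc ee ltcR.
move=> [e e0 H]; apply/nbhs_ballP; exists e%:C; first by rewrite /= (ltcR 0).
by move=> z; rewrite -ball_normE /= distrC normrc ltcR => /H.
Qed.

Lemma dnbhs_complexP t (A : set R[i]) :
  dnbhs t A <-> exists2 e : R, 0 < e & forall z, 0 < normc (z - t) < e -> A z.
Proof.
split.
  move=> /nbhs_complexP[e e0 H]; exists e => // z /andP[z0 ze]; apply: H => //.
  by move: z0; rewrite normc_gt0 subr_eq0.
move=> [e e0 H]; apply/nbhs_complexP; exists e => // z ze /eqP zt; apply: H.
by rewrite ze normc_gt0 subr_eq0 andbT; apply/eqP.
Qed.

(** Here and in [ccont] and [cdiff] the radii and errors are real, which keeps all estimates in an
    ordered field; [nbhs_complexP] and [cdiffP] relate them to the topology and to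
    [differentiable]. *)
Definition cnear t (A : R[i] -> Prop) :=
  exists2 r : R, 0 < r & forall z, normc (z - t) < r -> A z.

Lemma cnear_sub t (A B : R[i] -> Prop) :
  (forall z, A z -> B z) -> cnear t A -> cnear t B.
Proof. by move=> AB [r r0 H]; exists r => // z /H /AB. Qed.

Lemma cnearI t (A B : R[i] -> Prop) :
  cnear t A -> cnear t B -> cnear t (fun z => A z /\ B z).
Proof.
move=> [r r0 H] [r' r'0 H']; exists (Num.min r r'); first by rewrite lt_min r0.
by move=> z; rewrite lt_min => /andP[/H ? /H' ?].
Qed.

Lemma cnear_self t (A : R[i] -> Prop) : cnear t A -> A t.
Proof. by move=> [r r0]; apply; rewrite subrr Normc.normc0. Qed.

Definition ccont u t := forall e : R, 0 < e -> cnear t (fun z => normc (u z - u t) < e).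

Definition cdiff u t := exists d : R[i], forall e : R, 0 < e -> exists2 r : R, 0 < r &
    forall h, normc h < r -> normc (u (t + h) - u t - d * h) <= e * normc h.

Lemma cnear_comp u t (A : R[i] -> Prop) :
  ccont u t -> cnear (u t) A -> cnear t (fun z => A (u z)).
Proof. by move=> cu [e /cu[r r0 Hr] H]; exists r => // z /Hr /H. Qed.

Lemma is_derive_complexP u t (d : R[i]) : is_derive t 1 u d <->
  forall e : R, 0 < e -> exists2 r : R, 0 < r &
    forall h, normc h < r -> normc (u (t + h) - u t - d * h) <= e * normc h.
Proof.
have E (h : R[i]) : h != 0 -> normc (h^-1 *: ((u \o shift t) (h *: 1) - u t) - d) =
    normc (u (t + h) - u t - d * h) / normc h.
  move=> h0; rewrite -Normc.normcV -Normc.normcM /= [h *: 1]mulr1.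
  congr normc; rewrite mulrBl mulfK// [_ + t]addrC; congr (_ - _).
  exact: mulrC.
split=> [[du ud] e e0|H].
  move: du; rewrite /derivable => /cvg_ex[l hl].
  have dl : d = l by rewrite -ud; apply: (@cvg_lim R[i]).
  move: hl; rewrite -dl => hl.
  have /dnbhs_complexP[r r0 Hr] :
      dnbhs (0 : R[i]) (fun h => normc (h^-1 *: ((u \o shift t) (h *: 1) - u t) - d) < e).
    have Hn : nbhs d [set z | normc (z - d) < e] by apply/nbhs_complexP; exists e.
    exact: (hl _ Hn).
  exists r => // h hr; have [->|h0] := eqVneq h 0.
    by rewrite addr0 mulr0 !subrr Normc.normc0 mulr0.
  have := Hr h; rewrite subr0 hr normc_gt0 h0 => /(_ isT).
  by rewrite E// ltr_pdivrMr ?normc_gt0// => /ltW.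
have cl : (fun h => h^-1 *: ((u \o shift t) (h *: 1) - u t)) @ dnbhs (0 : R[i]) --> d.
  move=> A /nbhs_complexP[e e0 HA].
  have e20 : 0 < e / 2 by rewrite divr_gt0.
  have [r r0 Hr] := H _ e20.
  apply/dnbhs_complexP; exists r => // h; rewrite subr0 => /andP[h0 hr]; apply: HA.
  rewrite E -?normc_gt0// ltr_pdivrMr//; apply: (le_lt_trans (Hr h hr)).
  by rewrite ltr_pM2r// ltr_pdivrMr// ltr_pMr// ltr1n.
by apply: DeriveDef; [apply/cvg_ex; exists d|apply: (@cvg_lim R[i])].
Qed.

Lemma cdiffP u t : differentiable u t <-> cdiff u t.
Proof.
split.
  move=> /derivable1_diffP dut; exists ('D_1 u t).
  by apply/is_derive_complexP; exact: derivableP.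
move=> [d /is_derive_complexP [dut _]]; exact/derivable1_diffP.
Qed.

Lemma cdiff_cont u t : cdiff u t -> ccont u t.
Proof.
move=> [d H] e e0; have [r r0 Hr] := H _ ltr01.
have d0 : 0 < 1 + normc d by rewrite ltr_pwDl// normc_ge0.
exists (Num.min r (e / (1 + normc d))); first by rewrite lt_min r0 divr_gt0.
move=> z; rewrite lt_min => /andP[zr]; rewrite ltr_pdivlMr// => ze.
have := Hr _ zr; rewrite [t + _]addrC subrK => Hz; apply: le_lt_trans ze.
rewrite -[u z - u t](subrK (d * (z - t))); apply: (le_trans (le_normcD _ _)).
by rewrite Normc.normcM [leRHS]mulrDr mulr1 [normc d * _]mulrC lerD2r -[leRHS]mul1r.
Qed.

Lemma cdiff_cst (c : R[i]) t : cdiff (fun=> c) t.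
Proof.
exists 0 => e e0; exists 1 => // h _.
by rewrite subrr mul0r subrr Normc.normc0 mulr_ge0 ?normc_ge0// ltW.
Qed.

Lemma cdiff_id t : cdiff (fun z => z) t.
Proof.
exists 1 => e e0; exists 1 => // h _.
have -> : t + h - t - 1 * h = 0 by ring.
by rewrite Normc.normc0 mulr_ge0 ?normc_ge0// ltW.
Qed.

Lemma cdiffD u v t : cdiff u t -> cdiff v t -> cdiff (fun z => u z + v z) t.
Proof.
by move=> /cdiffP du /cdiffP dv; apply/cdiffP; exact: (@differentiableD R[i] R[i] R[i] u v t).
Qed.

Lemma cdiffM u v t : cdiff u t -> cdiff v t -> cdiff (fun z => u z * v z) t.
Proof.
by move=> /cdiffP du /cdiffP dv; apply/cdiffP; exact: (@differentiableM R[i] R[i] u v t).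
Qed.

Lemma cdiffV u t : cdiff u t -> u t != 0 -> cdiff (fun z => (u z)^-1) t.
Proof.
by move=> /cdiffP du u0; apply/cdiffP; exact: (@differentiableV R[i] R[i] u t).
Qed.

Lemma cdiff_comp u v t : cdiff u t -> cdiff v (u t) -> cdiff (fun z => v (u z)) t.
Proof.
move=> /cdiffP du /cdiffP dv; apply/cdiffP.
exact: (@differentiable_comp _ R[i] R[i] R[i] u v t du dv).
Qed.

Lemma ccont_comp u v t : ccont u t -> ccont v (u t) -> ccont (fun z => v (u z)) t.
Proof. by move=> cu cv e /cv; exact: cnear_comp. Qed.

Lemma ccontD u v t : ccont u t -> ccont v t -> ccont (fun z => u z + v z) t.
Proof.
move=> cu cv e e0; have e20 : 0 < e / 2 by rewrite divr_gt0.
apply: cnear_sub (cnearI (cu _ e20) (cv _ e20)) => z [h1 h2].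
rewrite opprD addrACA; apply: (le_lt_trans (le_normcD _ _)).
by rewrite [ltRHS]splitr ltrD.
Qed.

Lemma ccontM u v t : ccont u t -> ccont v t -> ccont (fun z => u z * v z) t.
Proof.
move=> cu cv e e0; pose M := normc (u t) + normc (v t) + 1.
have M0 : 0 < M by rewrite ltr_wpDl// addr_ge0 ?normc_ge0.
pose d := Num.min 1 (e / (2 * M)).
have d0 : 0 < d by rewrite lt_min ltr01 divr_gt0// mulr_gt0.
apply: cnear_sub (cnearI (cu _ d0) (cv _ d0)) => z [h1 h2].
have d1 : d <= 1 by rewrite ge_min lexx.
have dM : 2 * (d * M) <= e.
  by rewrite mulrCA -ler_pdivlMr ?mulr_gt0// ge_min lexx orbT.
have -> : u z * v z - u t * v t = (u z - u t) * v t + (u t * (v z - v t) + (u z - u t) * (v z - v t)).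
  by ring.
apply: (le_lt_trans (le_normcD _ _)).
apply: (le_lt_trans (lerD (lexx _) (le_normcD _ _))); rewrite !Normc.normcM.
have := normc_ge0 (u t); have := normc_ge0 (v t); have := normc_ge0 (u z - u t).
have := normc_ge0 (v z - v t); move: h1 h2 dM; rewrite /M.
set a := normc (u z - u t); set b := normc (v z - v t); set x := normc (u t); set y := normc (v t).
move=> ad bd dM b0 a0 y0 x0.
have p1 : a * y <= d * y by rewrite ler_wpM2r// ltW.
have p2 : x * b <= x * d by rewrite ler_wpM2l// ltW.
have p3 : a * b <= d * 1 by apply: ler_pM => //; [exact: ltW|exact: ltW (lt_le_trans bd d1)].
rewrite mulr1 [x * d]mulrC in p2 p3 *.
have p4 : 0 <= d * x by rewrite mulr_ge0// ltW.
have p5 : 0 <= d * y by rewrite mulr_ge0// ltW.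
by apply: lt_le_trans dM; lra.
Qed.

End ComplexTopology.

Lemma cdiff_eq_near (R : realType) (F G : R[i] -> R[i]) t (r : R) : 0 < r ->
  (forall s, normc (s - t) < r -> F s = G s) -> cdiff G t -> cdiff F t.
Proof.
move=> r0 FG [d H]; exists d => e e0; have [q q0 Hq] := H e e0.
exists (Num.min q r); first by rewrite lt_min q0 r0.
move=> h; rewrite lt_min => /andP[hq hr].
rewrite !FG; first exact: Hq.
- by rewrite subrr Normc.normc0.
- by rewrite addrC addKr.
Qed.

Section ComplexExponential.
Context {R : realType}.
Implicit Types (z t s : R[i]) (u : R[i] -> R[i]).

Lemma is_derive_expand (f : R -> R) (x d : R) : is_derive x 1 f d ->
  forall e : R, 0 < e -> exists2 r : R, 0 < r &
    forall h, `|h| < r -> `|f (x + h) - f x - d * h| <= e * `|h|.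
Proof.
move=> [+ fd] e e0 => /cvg_ex[l hl].
have dl : d = l by rewrite -fd; apply: (@cvg_lim R).
move: hl; rewrite -dl => /cvgr_dist_lt/(_ _ e0)/nbhs_ballP[r /= r0 Hr].
exists r => // h hr; have [->|h0] := eqVneq h 0.
  by rewrite addr0 mulr0 !subrr normr0 mulr0.
have := Hr h; rewrite -ball_normE /= sub0r normrN => /(_ hr h0).
rewrite [h *: 1]mulr1 distrC => H.
have -> : f (x + h) - f x - d * h = (h^-1 *: (f (h + x) - f x) - d) * h.
  by rewrite [x + h]addrC mulrBl [_ *: _]mulrC divfK.
by rewrite normrM ler_pM2r ?normr_gt0// ltW.
Qed.

Lemma cexpD s t : cexp (s + t) = cexp s * cexp t.
Proof.
case: s t => a b [c d]; rewrite /cexp /= expRD cosD sinD.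
by apply/eqP; rewrite eq_complex /=; apply/andP; split; apply/eqP; ring.
Qed.

Lemma cexp0 : cexp (0 : R[i]) = 1.
Proof.
by rewrite /cexp /= expR0 cos0 sin0; apply/eqP; rewrite eq_complex /=; apply/andP; split; apply/eqP; ring.
Qed.

Lemma normc_cexp s : normc (cexp s) = expR (Re s).
Proof.
rewrite /cexp Normc.normcM normc_real ger0_norm ?expR_ge0//=.
by rewrite cos2Dsin2 sqrtr1 mulr1.
Qed.

Lemma cexp_expand0 (e : R) : 0 < e -> exists2 r : R, 0 < r &
  forall h : R[i], normc h < r -> normc (cexp h - 1 - h) <= e * normc h.
Proof.
(* The four error terms [T1], [T2], [T3], [T4] contribute 3, 1, 3 and 2 ninths of [e * normc h]. *)
move=> e0; have e90 : 0 < e / 9 by rewrite divr_gt0.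
have dE : is_derive (0 : R) 1 expR 1 by have := is_derive_expR (0 : R); rewrite expR0.
have dC : is_derive (0 : R) 1 cos 0 by have := is_derive_cos (0 : R); rewrite sin0 oppr0.
have dS : is_derive (0 : R) 1 sin 1 by have := is_derive_sin (0 : R); rewrite cos0.
have [r1 r10 h1] := is_derive_expand dE ltr01.
have [r2 r20 h2] := is_derive_expand dE e90.
have [r3 r30 h3] := is_derive_expand dC e90.
have [r4 r40 h4] := is_derive_expand dS e90.
exists (Num.min (Num.min r1 r2) (Num.min (Num.min r3 r4) (Num.min (e / 9) 1))).
  by rewrite !lt_min r10 r20 r30 r40 e90 ltr01.
move=> h; rewrite !lt_min => /andP[/andP[hr1 hr2] /andP[/andP[hr3 hr4] /andP[hr5 hr6]]].
have xh := normc_Re h; have yh := normc_Im h.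
apply: (le_trans (normc_le_ReIm _)).
have -> : Re (cexp h - 1 - h) = expR (Re h) * (cos (Im h) - 1) + (expR (Re h) - 1 - Re h).
  by case: h {hr1 hr2 hr3 hr4 hr5 hr6 xh yh} => a b /=; ring.
have -> : Im (cexp h - 1 - h) = expR (Re h) * (sin (Im h) - Im h) + (expR (Re h) - 1) * Im h.
  by case: h {hr1 hr2 hr3 hr4 hr5 hr6 xh yh} => a b /=; ring.
move: xh yh; set x := Re h; set y := Im h; set n := normc h => xh yh.
have := h1 x (le_lt_trans xh hr1); have := h2 x (le_lt_trans xh hr2).
have := h3 y (le_lt_trans yh hr3); have := h4 y (le_lt_trans yh hr4).
rewrite !add0r sin0 subr0 mul1r cos0 mul0r subr0 expR0 mul1r mul1r => s1 c1 e1 e2.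
have n0 : 0 <= n by apply: normc_ge0.
have e3 : `|expR x - 1| <= 2 * `|x|.
  rewrite -[expR x - 1](subrK x); apply: (le_trans (ler_normD _ _)).
  by rewrite mulr_natl mulr2n lerD2r.
have e4 : expR x <= 3.
  have : expR x - 1 <= 2 * `|x| by apply: le_trans e3; apply: ler_norm.
  by move: (le_trans xh (ltW hr6)) => ? ?; lra.
have ex0 := expR_ge0 x.
have T1 : `|expR x * (cos y - 1)| <= 3 * (e / 9 * n).
  rewrite normrM (ger0_norm ex0); apply: ler_pM => //.
  by apply: (le_trans c1); rewrite ler_pM2l.
have T2 : `|expR x - 1 - x| <= e / 9 * n by apply: (le_trans e1); rewrite ler_pM2l.
have T3 : `|expR x * (sin y - y)| <= 3 * (e / 9 * n).
  rewrite normrM (ger0_norm ex0); apply: ler_pM => //.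
  by apply: (le_trans s1); rewrite ler_pM2l.
have T4 : `|(expR x - 1) * y| <= 2 * (e / 9 * n).
  rewrite normrM mulrA; apply: ler_pM => //; apply: (le_trans e3).
  by rewrite ler_pM2l//; apply: (le_trans xh); apply: ltW.
have -> : e * n = (3 * (e / 9 * n) + e / 9 * n) + (3 * (e / 9 * n) + 2 * (e / 9 * n)) by field.
by apply: lerD; apply: (le_trans (ler_normD _ _)); apply: lerD.
Qed.

Lemma cdiff_cexp s : cdiff (@cexp R) s.
Proof.
exists (cexp s) => e e0.
have n0 : 0 < normc (cexp s) by rewrite normc_cexp expR_gt0.
have [r r0 hr] := @cexp_expand0 (e / normc (cexp s)) (divr_gt0 e0 n0).
exists r => // h /hr; rewrite cexpD => H.
have -> : cexp s * cexp h - cexp s - cexp s * h = cexp s * (cexp h - 1 - h) by ring.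
by rewrite Normc.normcM mulrC -ler_pdivlMr// mulrAC.
Qed.

Lemma cexp_onto z : z != 0 -> exists y : R, z = cexp (ln (normc z) +i* y).
Proof.
case: z => a b z0; rewrite /cexp /= lnK ?posrE; last by have := z0; rewrite -normc_gt0.
set n := Num.sqrt _; have n0 : 0 < n by have := z0; rewrite -normc_gt0.
have nE : n ^+ 2 = a ^+ 2 + b ^+ 2 by rewrite sqr_sqrtr// addr_ge0 ?sqr_ge0.
have an : -1 <= a / n <= 1.
  have : `|a / n| <= 1; last by rewrite ler_norml.
  rewrite normrM normfV (gtr0_norm n0) ler_pdivrMr// mul1r.
  by have := normc_Re (a +i* b).
have sE : sin (acos (a / n)) = `|b| / n.
  rewrite sin_acos//.
  have -> : 1 - (a / n) ^+ 2 = (`|b| / n) ^+ 2.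
    rewrite !exprMn real_normK ?num_real// -[b ^+ 2](addKr (a ^+ 2)) -nE exprVn.
    by field; rewrite gt_eqF.
  by rewrite sqrtr_sqr ger0_norm// divr_ge0 ?(ltW n0).
have [b0|b0] := leP 0 b; [exists (acos (a / n))|exists (- acos (a / n))].
  rewrite acosK// sE ger0_norm//; apply/eqP; rewrite eq_complex /=.
  by apply/andP; split; apply/eqP; field; rewrite gt_eqF.
rewrite cosN sinN acosK// sE ltr0_norm//; apply/eqP; rewrite eq_complex /=.
by apply/andP; split; apply/eqP; field; rewrite gt_eqF.
Qed.

End ComplexExponential.

(** * Maximum principle for the real part of a holomorphic function *)

Section HarmonicMax.
Context {R : realType}.
Implicit Types (z t s : R[i]) (u : R[i] -> R[i]).

Lemma ReB z t : Re (z - t) = Re z - Re t.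
Proof. by case: z t => [? ?] [? ?]. Qed.

Lemma ImB z t : Im (z - t) = Im z - Im t.
Proof. by case: z t => [? ?] [? ?]. Qed.

Lemma complexD (a b c d : R) : (a +i* b) + (c +i* d) = (a + c) +i* (b + d).
Proof. by []. Qed.

Lemma continuous_realP (f : R -> R) :
  (forall x e : R, 0 < e -> exists2 r : R, 0 < r &
    forall h, `|h| < r -> `|f (x + h) - f x| < e) -> continuous f.
Proof.
move=> H x; apply/cvgrPdist_lt => e e0; have [r r0 Hr] := H x e e0.
apply/nbhs_ballP; exists r => // y; rewrite /ball /= distrC => yx.
by have := Hr _ yx; rewrite [x + _]addrC subrK distrC.
Qed.

Lemma expand_continuous (g : R[i] -> R[i]) s : cdiff g s ->
  forall e : R, 0 < e -> exists2 r : R, 0 < r &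
    forall h, normc h < r -> normc (g (s + h) - g s) < e.
Proof.
move=> /cdiff_cont H e /H[r r0 Hr].
by exists r => // h hr; apply: Hr; rewrite addrAC subrr add0r.
Qed.

Lemma normc_ReIm_le (a b : R) : normc (a +i* b) <= `|a| + `|b|.
Proof. exact: (normc_le_ReIm (a +i* b)). Qed.

Lemma cauchy_riemann (g : R[i] -> R[i]) (x y : R) : cdiff g (x +i* y) ->
  exists al be : R, forall e : R, 0 < e -> exists2 r : R, 0 < r &
    forall h k, `|h| < r -> `|k| < r ->
    `|Re (g ((x + h) +i* (y + k))) - Re (g (x +i* y)) - (al * h - be * k)| <= e * (`|h| + `|k|) /\
    `|Im (g ((x + h) +i* (y + k))) - Im (g (x +i* y)) - (be * h + al * k)| <= e * (`|h| + `|k|).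
Proof.
move=> [d H].
exists (Re d), (Im d) => e e0; have [r r0 Hr] := H e e0.
exists (r / 2) => [|h k hr kr]; first by rewrite divr_gt0.
have hk : normc (h +i* k) < r.
  by apply: (le_lt_trans (normc_ReIm_le _ _)); lra.
have {}Hr : normc (g ((x + h) +i* (y + k)) - g (x +i* y) - d * (h +i* k)) <= e * (`|h| + `|k|).
  by apply: (le_trans (Hr _ hk)); rewrite ler_pM2l// normc_ReIm_le.
split.
  have -> : Re (g ((x + h) +i* (y + k))) - Re (g (x +i* y)) - (Re d * h - Im d * k) =
    Re (g ((x + h) +i* (y + k)) - g (x +i* y) - d * (h +i* k)).
    by case: d (g _) (g _) {Hr H} => [? ?] [? ?] [? ?].
  exact: le_trans (normc_Re _) Hr.
have -> : Im (g ((x + h) +i* (y + k))) - Im (g (x +i* y)) - (Im d * h + Re d * k) =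
  Im (g ((x + h) +i* (y + k)) - g (x +i* y) - d * (h +i* k)).
  by case: d (g _) (g _) {Hr H} => [? ?] [? ?] [? ?] /=; ring.
exact: le_trans (normc_Im _) Hr.
Qed.

(* Over a circle [Re u] has the mean value [Re (u t0)]: Goursat's theorem for
   [u (t0 + exp (x + iy))] on a box of height [2 pi] shows that the mean does not
   depend on the radius. *)
Lemma harmonic_max_disc u t0 (rho : R) : 0 < rho -> ccont u t0 ->
  (forall t, 0 < normc (t - t0) < rho -> cdiff u t) ->
  (forall t, normc (t - t0) < rho -> Re (u t) <= Re (u t0)) ->
  forall t, normc (t - t0) < rho -> Re (u t) = Re (u t0).
Proof.
move=> rho0 cu du umax t trho.
have [->//|tt0] := eqVneq t t0.
have tt0' : t - t0 != 0 by rewrite subr_eq0.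
have [th Et] := cexp_onto tt0'; set b := ln (normc (t - t0)) in Et.
have b_rho : b < ln rho by rewrite ltr_ln ?posrE ?normc_gt0.
pose L := (b + ln rho) / 2.
have bL : b < L by rewrite /L; lra.
have Lrho : L < ln rho by rewrite /L; lra.
pose g s := u (t0 + cexp s).
have dist s : normc (t0 + cexp s - t0) = expR (Re s) by rewrite addrAC subrr add0r normc_cexp.
have in_disc s : Re s < ln rho -> normc (t0 + cexp s - t0) < rho.
  by move=> sl; rewrite dist -[ltRHS]lnK ?posrE// ltr_expR.
have dg s : Re s < ln rho -> cdiff g s.
  move=> sl; apply: cdiff_comp.
    by apply: cdiffD; [exact: cdiff_cst|exact: cdiff_cexp].
  by apply/du; rewrite in_disc// dist expR_gt0.
pose P x y : R := Re (g (x +i* y)).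
(* The composite [g] is controlled only for [Re s < ln rho]. Cutting off at [L], which lies beyond
   the side [x = b], makes [Q^~ y] continuous on the whole line without changing it on the boxes. *)
pose Q x y : R := Im (g (Num.min x L +i* y)).
have cP x : x < ln rho -> continuous (P x).
  move=> xl; apply: continuous_realP => y e e0.
  have [r r0 Hr] := expand_continuous (dg (x +i* y) xl) e0.
  exists r => // h hr; apply: le_lt_trans (Hr (0 +i* h) _).
    by apply: le_trans (normc_Re _); rewrite /P complexD addr0 ReB.
  by apply: le_lt_trans (normc_ReIm_le _ _) _; rewrite normr0 add0r.
have cQ y : continuous (Q^~ y).
  apply: continuous_realP => x e e0.
  have ml : Re (Num.min x L +i* y) < ln rho by rewrite /= gt_min Lrho orbT.
  have [r r0 Hr] := expand_continuous (dg _ ml) e0.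
  exists r => // h hr; pose h' := Num.min (x + h) L - Num.min x L.
  apply: le_lt_trans (Hr (h' +i* 0) _).
    apply: le_trans (normc_Im _); rewrite /Q.
    by rewrite complexD addr0 [_ + h']addrC subrK ImB.
  apply: le_lt_trans (normc_ReIm_le _ _) _; rewrite normr0 addr0.
  apply: le_lt_trans hr; rewrite /h' /Num.min.
  by case: ltP => ?; case: ltP => ?; rewrite ?subrr ?normr0 ?normr_ge0//; rewrite ler_norml; have := ler_norm h; have := ler_norm (- h); rewrite normrN => ? ?; apply/andP; split; lra.
(* The primitive is chosen as a function of the integrand, so that the equal integrands [Q^~ c] and
   [Q^~ d] receive the same primitive. *)
have /choice[prim primP] : forall f : R -> R, exists F : R * R -> R -> R, forall a b : R,
    continuous f -> a < b -> forall x, a < x < b -> is_derive x 1 (F (a, b)) (f x).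
  move=> f; suff /choice[F HF] : forall q : R * R, exists F, continuous f -> q.1 < q.2 ->
      forall x, q.1 < x < q.2 -> is_derive x 1 F (f x).
    by exists F => x y; exact: HF (x, y).
  move=> q; case: (pselect (continuous f /\ q.1 < q.2)) => [[cf q12]|nq].
    by have [F HF] := continuous_primitive cf q12; exists F.
  by exists f => cf q12; case: nq.
(* One full turn, centered at the argument of [t - t0] so that [t] corresponds to an interior point
   of the side. *)
pose c := th - pi; pose d := th + pi.
have pi0 : 0 < pi :> R := pi_gt0 R.
have cd : c <= d by rewrite /c /d; lra.
pose B x := prim (P x) (c - 1, d + 1).
have dB x y : x < ln rho -> c <= y <= d -> is_derive y 1 (B x) (P x y).
  move=> xl /andP[cy yd]; apply: primP; [exact: cP|lra|].
  by apply/andP; split; lra.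
(* The horizontal sides cancel because [cexp] has period [2 pi i]; the vertical ones are the
   integrals over two circles around [t0]. *)
have J a : a <= b -> B b d - B b c = B a d - B a c.
  move=> ab; pose A x y := prim (Q^~ y) (a - 1, L) x.
  have Qcd : Q^~ c = Q^~ d.
    apply/funext => x; rewrite /Q /g /cexp /= /c /d.
    by rewrite cosDpi sinDpi cosB sinB cospi sinpi; congr (Im (u (t0 + _ * (_ +i* _)))); ring.
  apply/eqP; rewrite -subr_eq0; apply/eqP.
  transitivity (A b d - A a d - (A b c - A a c)); last by rewrite /A Qcd subrr.
  apply: (@goursat R P Q A B a b c d ab cd).
  - move=> x y /andP[ax xb] _.
    by apply: (primP (Q^~ y)); [exact: cQ|lra|apply/andP; split; lra].
  - by move=> x y /andP[ax xb] ycd; apply: dB => //; lra.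
  move=> x y /andP[ax xb] _.
  have xl : x < ln rho by lra.
  have [al [be CR]] := cauchy_riemann (dg (x +i* y) xl).
  exists al, be => e e0; have [r r0 Hr] := CR e e0.
  exists (Num.min r (L - x)); first by rewrite lt_min r0 subr_gt0; lra.
  move=> h k; rewrite lt_min => /andP[hr hL]; rewrite lt_min => /andP[kr _].
  have h_le := ler_norm h.
  have m1 : Num.min (x + h) L = x + h by apply: min_idPl; lra.
  have m2 : Num.min x L = x by apply: min_idPl; lra.
  by rewrite /P /Q m1 m2; apply: Hr.
(* As [a] tends to minus infinity the circle shrinks to [t0], where [u] is continuous. *)
have Jlim e : 0 < e -> `|B b d - B b c - Re (u t0) * (d - c)| <= e * (d - c).
  move=> e0; have [r r0 Hr] := cu e e0.
  pose a := Num.min b (ln r - 1).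
  have ab : a <= b by rewrite /a ge_min lexx.
  have ar : expR a < r.
    by rewrite -[ltRHS]lnK ?posrE// ltr_expR /a gt_min; apply/orP; right; lra.
  rewrite (J a ab); have al : a < ln rho by lra.
  have [y _ ->] := increment_MVT cd (fun y => dB a y al).
  rewrite -mulrBl normrM [X in _ * X]ger0_norm ?subr_ge0//.
  rewrite ler_wpM2r ?subr_ge0//; apply: ltW.
  have := Hr (t0 + cexp (a +i* y)); rewrite dist => /(_ ar); apply: le_lt_trans.
  by apply: le_trans (normc_Re _); rewrite ReB.
have JE : B b d - B b c = Re (u t0) * (d - c).
  apply/eqP; rewrite -subr_eq0 -normr_le0 leNgt; apply/negP => n0.
  have dc0 : 0 < d - c by rewrite /c /d; lra.
  have := Jlim (`|B b d - B b c - Re (u t0) * (d - c)| / (2 * (d - c))).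
  rewrite divr_gt0 ?mulr_gt0// => /(_ isT).
  set N := `|_| in n0 *; have -> : N / (2 * (d - c)) * (d - c) = N / 2 by field; rewrite gt_eqF.
  by move=> ?; lra.
(* Its derivative [Re (u t0) - P b y] is nonnegative and its values at [c] and [d] agree by [JE].
   Hence [D] is constant and the derivative vanishes at [th]. *)
pose D y := Re (u t0) * y - B b y.
have dD y : c <= y <= d -> is_derive y 1 D (Re (u t0) - P b y).
  move=> ycd; have dBy := dB b y b_rho ycd.
  have dl : is_derive y 1 (fun y : R => Re (u t0) * y) (Re (u t0)).
    have := @is_deriveZ R R R id (Re (u t0)) y 1 1 (is_derive_id _ _).
    by rewrite [_ *: 1]mulr1.
  exact: (is_deriveB dl dBy).
have D0 y : c <= y <= d -> 0 <= Re (u t0) - P b y.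
  by move=> _; rewrite subr_ge0; apply: umax; apply: in_disc.
have Dmono y1 y2 : c <= y1 -> y1 <= y2 -> y2 <= d -> D y1 <= D y2.
  move=> cy1 y12 y2d; have [z|z zI] := @increment_MVT _ D (fun y => Re (u t0) - P b y) y1 y2 y12.
    by move=> /andP[z1 z2]; apply: dD; rewrite (le_trans cy1 z1) (le_trans z2 y2d).
  move/eqP; rewrite subr_eq => /eqP ->; rewrite lerDr mulr_ge0 ?subr_ge0//.
  case/andP: zI => z1 z2; rewrite -subr_ge0; apply: D0.
  by rewrite (le_trans cy1 z1) (le_trans z2 y2d).
have DcE : D d = D c.
  by apply/eqP; rewrite -subr_eq0 /D opprD addrACA -mulrBr -JE opprK; apply/eqP; ring.
have thI : c <= th <= d by rewrite /c /d; apply/andP; split; lra.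
have Dconst y : c <= y <= d -> D y = D c.
  move=> /andP[cy yd]; apply/eqP; rewrite eq_le (Dmono c y)// andbT -DcE.
  exact: Dmono.
have -> : u t = g (b +i* th) by rewrite /g -Et addrC subrK.
apply/eqP; rewrite -/(P b th) eq_sym -subr_eq0; apply: contraT => ne0.
have lt0 : 0 < Re (u t0) - P b th by rewrite lt_def ne0 D0.
have [r r0 Hr] := is_derive_expand (dD th thI) (divr_gt0 lt0 (ltr0Sn R 1)).
pose h := Num.min (r / 2) pi.
have h0 : 0 < h by rewrite lt_min pi0 divr_gt0.
have hr : `|h| < r by rewrite gtr0_norm// /h gt_min; apply/orP; left; lra.
have hpi : h <= pi by rewrite ge_min lexx orbT.
have := Hr h hr; rewrite !Dconst//; last by apply/andP; rewrite /c /d; split; lra.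
rewrite subrr sub0r normrN normrM (gtr0_norm h0) (gtr0_norm lt0) ler_pM2r//.
by set N := _ - _ in lt0 *; move=> ?; lra.
Qed.

End HarmonicMax.

Section PuncturedHolomorphy.
Context {R : realType}.
Implicit Types (z t s : R[i]) (u v : R[i] -> R[i]).

(* Allowing a puncture, quotients such as [(u t - u 0) / t] need no separate
   proof that they are holomorphic at [0]. *)
Definition pholo u t0 := ccont u t0 /\
  exists2 r : R, 0 < r & forall t, 0 < normc (t - t0) < r -> cdiff u t.

Lemma cdiff_pholo u t0 : cnear t0 (cdiff u) -> pholo u t0.
Proof.
move=> du; split; first exact: cdiff_cont (cnear_self du).
by case: du => r r0 H; exists r => // t /andP[_ ?]; exact: H.
Qed.

Lemma pholo_cst c t0 : pholo (fun=> c) t0.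
Proof. by apply: cdiff_pholo; exists 1 => // t _; exact: cdiff_cst. Qed.

Lemma pholoD u v t0 : pholo u t0 -> pholo v t0 -> pholo (fun t => u t + v t) t0.
Proof.
move=> [cu [r r0 du]] [cv [r' r'0 dv]]; split; first exact: ccontD.
exists (Num.min r r'); first by rewrite lt_min r0.
move=> t; rewrite lt_min => /andP[t0' /andP[tr tr']].
by apply: cdiffD; [apply: du|apply: dv]; rewrite t0'.
Qed.

Lemma pholoM u v t0 : pholo u t0 -> pholo v t0 -> pholo (fun t => u t * v t) t0.
Proof.
move=> [cu [r r0 du]] [cv [r' r'0 dv]]; split; first exact: ccontM.
exists (Num.min r r'); first by rewrite lt_min r0.
move=> t; rewrite lt_min => /andP[t0' /andP[tr tr']].
by apply: cdiffM; [apply: du|apply: dv]; rewrite t0'.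
Qed.

Lemma pholo_sum (I : Type) (r : seq I) (P : pred I) (u : I -> R[i] -> R[i]) t0 :
  (forall i, P i -> pholo (u i) t0) ->
  pholo (fun t => \sum_(i <- r | P i) u i t) t0.
Proof.
move=> H; elim: r => [|i r IH].
  have -> : (fun t => \sum_(i <- [::] | P i) u i t) = fun=> 0.
    by apply/funext => t; rewrite big_nil.
  exact: pholo_cst.
have -> : (fun t => \sum_(j <- i :: r | P j) u j t) =
    fun t => if P i then u i t + \sum_(j <- r | P j) u j t else \sum_(j <- r | P j) u j t.
  by apply/funext => t; rewrite big_cons.
by case: (boolP (P i)) => [Pi|_]; [exact: (pholoD (H i Pi) IH)|exact: IH].
Qed.

Lemma pholo_comp u v t0 : pholo u t0 -> cnear (u t0) (cdiff v) ->
  pholo (fun t => v (u t)) t0.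
Proof.
move=> [cu [r r0 du]] dv; split.
  exact: ccont_comp cu (cdiff_cont (cnear_self dv)).
have [r' r'0 dv'] := cnear_comp cu dv.
exists (Num.min r r'); first by rewrite lt_min r0.
move=> t; rewrite lt_min => /andP[t0' /andP[tr tr']].
by apply: cdiff_comp; [apply: du; rewrite t0'|exact: dv'].
Qed.

Lemma pholo_Re_max u t0 : pholo u t0 ->
  cnear t0 (fun t => Re (u t) <= Re (u t0)) ->
  cnear t0 (fun t => Re (u t) = Re (u t0)).
Proof.
move=> [cu [r1 r10 h1]] [r2 r20 h2].
exists (Num.min r1 r2); first by rewrite lt_min r10.
apply: harmonic_max_disc => //; first by rewrite lt_min r10.
  by move=> t; rewrite lt_min => /andP[t0' /andP[? _]]; apply: h1; rewrite t0'.
by move=> t; rewrite lt_min => /andP[_ ?]; exact: h2.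
Qed.

(* Once [Re u] is constant, [(u - u t0) ^ 2] has real part [- Im ^ 2 <= 0]. *)
Lemma pholo_max u t0 : pholo u t0 ->
  cnear t0 (fun t => Re (u t) <= Re (u t0)) ->
  cnear t0 (fun t => u t = u t0).
Proof.
move=> hu /(pholo_Re_max hu) re.
pose v t := (u t + - u t0) * (u t + - u t0).
have hv : pholo v t0 by apply: pholoM; apply: pholoD => //; exact: pholo_cst.
have vE t : Re (u t) = Re (u t0) -> Re (v t) = - (Im (u t - u t0)) ^+ 2.
  rewrite /v -[u t + _]/(u t - u t0) => E.
  have : Re (u t - u t0) = 0 by rewrite ReB E subrr.
  by case: (u t - u t0) => a b /= ->; rewrite mul0r sub0r expr2.
have v0 : Re (v t0) = 0 by rewrite /v subrr mul0r.
have vmax : cnear t0 (fun t => Re (v t) <= Re (v t0)).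
  by apply: cnear_sub re => t /vE ->; rewrite v0 oppr_le0 sqr_ge0.
apply: cnear_sub (cnearI re (pholo_Re_max hv vmax)) => t [ret].
rewrite vE// v0 => /eqP; rewrite oppr_eq0 sqrf_eq0 ImB subr_eq0 => /eqP imt.
by apply/eqP; rewrite eq_complex ret imt !eqxx.
Qed.

End PuncturedHolomorphy.

Section RealValued.
Context {R : realType}.
Implicit Types (z t s : R[i]) (f g : R[i] -> R).

Definition rcont f t := forall e : R, 0 < e -> cnear t (fun z => `|f z - f t| < e).

Lemma rcontE f t : rcont f t <-> ccont (fun z => (f z)%:C) t.
Proof.
have E (a b : R) : normc (a%:C - b%:C) = `|a - b|.
  by rewrite -rmorphB normc_real.
split=> H e /H [r r0 Hr]; exists r => // z /Hr; by rewrite E.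
Qed.

Lemma rcont_cst (c : R) t : rcont (fun=> c) t.
Proof. by move=> e e0; exists 1 => // z _; rewrite subrr normr0. Qed.

Lemma rcontD f g t : rcont f t -> rcont g t -> rcont (fun z => f z + g z) t.
Proof.
move=> /rcontE cf /rcontE cg; apply/rcontE.
have := ccontD cf cg; congr ccont; apply/funext => z; by rewrite rmorphD.
Qed.

Lemma rcontM f g t : rcont f t -> rcont g t -> rcont (fun z => f z * g z) t.
Proof.
move=> /rcontE cf /rcontE cg; apply/rcontE.
have := ccontM cf cg; congr ccont; apply/funext => z; by rewrite rmorphM.
Qed.

Lemma rcont_sum (I : Type) (r : seq I) (P : pred I) (f : I -> R[i] -> R) t :
  (forall i, rcont (f i) t) -> rcont (fun z => \sum_(i <- r | P i) f i z) t.
Proof.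
move=> H; elim: r => [|i r IH].
  have -> : (fun z => \sum_(i <- [::] | P i) f i z) = fun=> 0.
    by apply/funext => z; rewrite big_nil.
  exact: rcont_cst.
have -> : (fun z => \sum_(j <- i :: r | P j) f j z) =
    fun z => if P i then f i z + \sum_(j <- r | P j) f j z else \sum_(j <- r | P j) f j z.
  by apply/funext => z; rewrite big_cons.
by case: (P i); [exact: (rcontD (H i) IH)|exact: IH].
Qed.

Lemma rcont_comp f (h : R -> R) t :
  rcont f t -> {for f t, continuous h} -> rcont (fun z => h (f z)) t.
Proof.
move=> cf /cvgrPdist_lt H e e0; have /nbhs_ballP[r /= r0 Hr] := H e e0.
apply: cnear_sub (cf r r0) => z zr; rewrite distrC; apply: Hr.
by rewrite /ball /= distrC.
Qed.

Lemma ccont_rcomp u t f : ccont u t -> rcont f (u t) -> rcont (fun z => f (u z)) t.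
Proof. by move=> cu cf e /cf; exact: cnear_comp. Qed.

Lemma rcont_Re t : rcont (@complex.Re R) t.
Proof.
by move=> e e0; exists e => // z; apply: le_lt_trans; rewrite -ReB normc_Re.
Qed.

Lemma rcont_Im t : rcont (@complex.Im R) t.
Proof.
by move=> e e0; exists e => // z; apply: le_lt_trans; rewrite -ImB normc_Im.
Qed.

Lemma rcont_normc t : rcont (@Normc.normc R) t.
Proof.
move=> e e0; exists e => // z; apply: le_lt_trans.
have h1 := le_normcD (z - t) t; rewrite subrK in h1.
have h2 := le_normcD (t - z) z; rewrite subrK normcB_sym in h2.
by rewrite ler_norml; apply/andP; split; lra.
Qed.

Lemma ccont_pair f g t : rcont f t -> rcont g t -> ccont (fun z => f z +i* g z) t.
Proof.
move=> cf cg e e0; have e20 : 0 < e / 2 by rewrite divr_gt0.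
apply: cnear_sub (cnearI (cf _ e20) (cg _ e20)) => z [h1 h2].
apply: (le_lt_trans (normc_le_ReIm _)); rewrite ReB ImB /=.
by rewrite [ltRHS]splitr ltrD.
Qed.

End RealValued.

Section ComplexLog.
Context {R : realType}.
Implicit Types (z t s : R[i]).

(** On the half-plane [0 < Re z] this is the principal logarithm; it is applied to functions that
    take the value 1 at the point considered. *)
Definition clog z : R[i] := ln (normc z) +i* atan (Im z / Re z).

Lemma cexp_clog z : 0 < Re z -> cexp (clog z) = z.
Proof.
case: z => a b /= a0; have z0 : a +i* b != 0.
  by rewrite eq_complex /= negb_and gt_eqF.
have n0 : 0 < normc (a +i* b) by rewrite normc_gt0.
have nE : normc (a +i* b) = a * Num.sqrt (1 + (b / a) ^+ 2).
  have E : a ^+ 2 + b ^+ 2 = a ^+ 2 * (1 + (b / a) ^+ 2) by field; rewrite gt_eqF.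
  by rewrite /= E sqrtrM ?sqr_ge0// sqrtr_sqr gtr0_norm.
have s0 : 0 < Num.sqrt (1 + (b / a) ^+ 2) by rewrite sqrtr_gt0 ltr_wpDr// sqr_ge0.
have c0 : cos (atan (b / a)) != 0 by rewrite cos_atan invr_eq0 gt_eqF.
have sE : sin (atan (b / a)) = b / a * cos (atan (b / a)).
  have T : sin (atan (b / a)) / cos (atan (b / a)) = b / a := atanK (b / a).
  by rewrite -[LHS](divfK c0) T.
have lE : expR (ln (normc (a +i* b))) = a * Num.sqrt (1 + (b / a) ^+ 2).
  by rewrite lnK ?posrE.
rewrite /clog /cexp [complex.Re _]/= [complex.Im _]/= lE sE cos_atan.
apply/eqP; rewrite eq_complex /=; apply/andP.
by split; apply/eqP; field; rewrite ?gt_eqF.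
Qed.

Lemma ccont_clog z : 0 < Re z -> ccont clog z.
Proof.
move=> z0; apply: ccont_pair.
  apply: (rcont_comp (rcont_normc z)); apply: continuous_ln.
  by apply: lt_le_trans z0 _; apply: le_trans (ler_norm _) (normc_Re _).
apply: (rcont_comp (h := atan)); last exact: continuous_atan.
apply: rcontM; first exact: rcont_Im.
apply: (rcont_comp (h := GRing.inv)); first exact: rcont_Re.
by apply: inv_continuous; rewrite gt_eqF.
Qed.

Lemma cdiff_clog z : 0 < Re z -> cdiff clog z.
Proof.
move=> z0; have zn : z != 0 by apply: contraTneq z0 => ->; rewrite ltxx.
have nz : 0 < normc z by rewrite normc_gt0.
exists z^-1 => e e0.
(* For the increment [d] of [clog], the expansion of [cexp] gives
   [normc (h / z - d) <= e1 * normc d]. The bound 1/2 yields [normc d <= 2 * normc (h / z)], and the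
   second bound then yields the error [e * normc h]. *)
pose e1 := Num.min (1 / 2) (e * normc z / 2).
have e10 : 0 < e1 by rewrite lt_min !divr_gt0// mulr_gt0.
have [r r0 Hr] := cexp_expand0 e10.
have rez : cnear z (fun s => 0 < Re s).
  exists (Re z) => // s; have := normc_Re (s - z); rewrite ReB ler_norml => /andP[+ _].
  by move=> h1 h2; lra.
have [r' r'0 Hr'] := cnearI rez (ccont_clog z0 r0).
exists r' => // h hr; have := Hr' (z + h); rewrite addrAC subrr add0r => /(_ hr)[h0].
set d := clog (z + h) - clog z => dr.
have dE : cexp d = 1 + z^-1 * h.
  have : cexp d * cexp (clog z) = z + h by rewrite -cexpD subrK cexp_clog.
  rewrite cexp_clog// => /(canRL (mulfK zn)) ->.
  by rewrite mulrDl mulfV// [h * _]mulrC.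
have := Hr d dr; rewrite dE [1 + _]addrC addrK normcB_sym => H1.
have H2 : normc d <= 2 * normc (z^-1 * h).
  have : normc d <= normc (d - z^-1 * h) + normc (z^-1 * h).
    by have := le_normcD (d - z^-1 * h) (z^-1 * h); rewrite subrK.
  have : e1 * normc d <= 1 / 2 * normc d by rewrite ler_wpM2r ?normc_ge0// ge_min lexx.
  by move=> *; lra.
apply: (le_trans H1); apply: (le_trans (ler_wpM2l (ltW e10) H2)).
rewrite Normc.normcM Normc.normcV.
have : e1 <= e * normc z / 2 by rewrite ge_min lexx orbT.
move=> /(ler_wpM2r (normc_ge0 h)) H3.
have -> : e1 * (2 * ((normc z)^-1 * normc h)) = e1 * normc h * (2 / normc z) by ring.
have -> : e * normc h = e * normc z / 2 * normc h * (2 / normc z) by field; rewrite gt_eqF.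
by rewrite ler_wpM2r// divr_ge0// ltW.
Qed.

Lemma Re_clog z : Re (clog z) = ln (normc z).
Proof. by []. Qed.

Lemma clog1 : clog 1 = 0.
Proof. by rewrite /clog Normc.normc1 ln1 /= mul0r atan0. Qed.

End ComplexLog.

(** * A strong maximum principle *)

(* A locked copy: unification is slow when it can unfold [hnorm]. *)
HB.lock Definition vnorm (R : realType) (k : nat) (z : 'rV[R[i]]_k) : R := hnorm z.

Lemma Re_sum (R : realType) (I : finType) (F : I -> R[i]) :
  Re (\sum_k F k) = \sum_k Re (F k).
Proof. by apply: (big_morph Re) => // -[? ?] [? ?]. Qed.

Section HermitianNorm.
Context {R : realType} {n : nat}.
Implicit Types (x y : 'rV[R[i]]_n) (a : R[i]).

Lemma hnormE x : hnorm x = vnorm x.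
Proof. by rewrite vnorm.unlock. Qed.

Lemma dotmx_sum x y : dotmx x y = \sum_k x 0 k * conjc (y 0 k).
Proof. by rewrite dotmxE mxE; apply: eq_bigr => k _; rewrite !mxE. Qed.

Lemma mul_conjc a : a * conjc a = (normc a ^+ 2)%:C.
Proof.
rewrite -sqr_normc; case: a => u v; rewrite normrc -rmorphXn //.
Qed.

Lemma dotmx_real x : dotmx x x = (\sum_k normc (x 0 k) ^+ 2)%:C.
Proof. by rewrite dotmx_sum rmorph_sum; apply: eq_bigr => k _; rewrite mul_conjc. Qed.

Lemma vnorm_sqr x : vnorm x ^+ 2 = \sum_k normc (x 0 k) ^+ 2.
Proof. by rewrite vnorm.unlock /hnorm dotmx_real sqr_sqrtr// sumr_ge0// => k _; rewrite sqr_ge0. Qed.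

Lemma vnorm_ge0 x : 0 <= vnorm x.
Proof. by rewrite vnorm.unlock sqrtr_ge0. Qed.

Lemma dotmx_vnorm x : dotmx x x = (vnorm x ^+ 2)%:C.
Proof. by rewrite vnorm_sqr dotmx_real. Qed.

Lemma vnorm0 : vnorm (0 : 'rV[R[i]]_n) = 0.
Proof.
by rewrite vnorm.unlock /hnorm dotmx_real big1 ?sqrtr0// => k _; rewrite mxE Normc.normc0 expr0n.
Qed.

Lemma vnorm_coord x k : normc (x 0 k) <= vnorm x.
Proof.
rewrite -(@ler_pXn2r _ 2)// ?nnegrE ?normc_ge0 ?vnorm_ge0//.
rewrite vnorm_sqr (bigD1 k)//= lerDl sumr_ge0// => j _; exact: sqr_ge0.
Qed.

Lemma vnorm_eq0 x : (vnorm x == 0) = (x == 0).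
Proof.
apply/eqP/eqP => [h0|->]; last exact: vnorm0.
apply/rowP => k; rewrite mxE; apply/eqP; rewrite -[_ == 0]negbK -normc_gt0 -leNgt.
by rewrite -h0 vnorm_coord.
Qed.

Lemma vnorm_gt0 x : (0 < vnorm x) = (x != 0).
Proof. by rewrite lt_def vnorm_eq0 vnorm_ge0 andbT. Qed.

Lemma vnormZ a x : vnorm (a *: x) = normc a * vnorm x.
Proof.
have E : \sum_k normc ((a *: x) 0 k) ^+ 2 = normc a ^+ 2 * \sum_k normc (x 0 k) ^+ 2.
  by rewrite mulr_sumr; apply: eq_bigr => k _; rewrite mxE Normc.normcM exprMn.
move: (vnorm_sqr (a *: x)) (vnorm_sqr x) (vnorm_ge0 (a *: x)) (vnorm_ge0 x) (normc_ge0 a).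
rewrite E; move: (vnorm _) (vnorm x) (normc a) (\sum_k _) => u v c S Eu Ev u0 v0 c0.
by apply/eqP; rewrite -(@eqrXn2 _ 2)// ?mulr_ge0// Eu exprMn Ev.
Qed.

Lemma vnorm_sqrD x y :
  vnorm (x + y) ^+ 2 = vnorm x ^+ 2 + 2 * Re (dotmx x y) + vnorm y ^+ 2.
Proof.
suff E : \sum_k normc ((x + y) 0 k) ^+ 2 = \sum_k normc (x 0 k) ^+ 2 +
    2 * Re (dotmx x y) + \sum_k normc (y 0 k) ^+ 2.
  exact: etrans (vnorm_sqr (x + y)) (etrans E (esym (f_equal2 (fun a b : R => a + 2 * Re (dotmx x y) + b)
    (vnorm_sqr x) (vnorm_sqr y)))).
rewrite dotmx_sum Re_sum mulr_sumr -!big_split /=; apply: eq_bigr => k _.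
rewrite mxE; case: (x 0 k) (y 0 k) => a b [c d] /=.
by rewrite !sqr_sqrtr ?addr_ge0 ?sqr_ge0//; ring.
Qed.

Lemma cauchy_schwarz x y : normc (dotmx x y) <= vnorm x * vnorm y.
Proof.
have H : `|dotmx x y| ^+ 2 <= dotmx x x * dotmx y y.
  by have [] := CauchySchwarz (@dotmx R[i] n) x y.
move: H; rewrite (dotmx_vnorm x) (dotmx_vnorm y) normrc -rmorphXn -rmorphM lecR.
move: (vnorm_ge0 x) (vnorm_ge0 y) (normc_ge0 (dotmx x y)).
move: (vnorm x) (vnorm y) (normc _) => u v c u0 v0 c0.
by rewrite -exprMn ler_pXn2r// nnegrE mulr_ge0.
Qed.

Lemma vnorm_triangle x y : vnorm (x + y) <= vnorm x + vnorm y.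
Proof.
have := le_trans (le_trans (ler_norm _) (normc_Re _)) (cauchy_schwarz x y).
move: (vnorm_sqrD x y) (vnorm_ge0 x) (vnorm_ge0 y) (vnorm_ge0 (x + y)).
move: (vnorm _) (vnorm x) (vnorm y) (Re _) => s u v c E u0 v0 s0 H.
rewrite -(@ler_pXn2r _ 2)// ?nnegrE ?addr_ge0// E.
by rewrite sqrrD lerD2r lerD2l -[leRHS]mulr_natl ler_wpM2l.
Qed.

Lemma vnormN x : vnorm (- x) = vnorm x.
Proof. by rewrite -scaleN1r vnormZ normcN Normc.normc1 mul1r. Qed.

Lemma vnorm_rcont (v : R[i] -> 'rV[R[i]]_n) t :
  (forall k, ccont (fun z => v z 0 k) t) -> rcont (fun z => vnorm (v z)) t.
Proof.
move=> cv.
have -> : (fun z => vnorm (v z)) = fun z => Num.sqrt (\sum_k normc (v z 0 k) ^+ 2).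
  by apply/funext => z; rewrite -vnorm_sqr sqrtr_sqr ger0_norm ?vnorm_ge0.
apply: (rcont_comp (h := Num.sqrt)); last exact: sqrt_continuous.
apply: rcont_sum => k; apply: rcontM; exact: (ccont_rcomp (cv k) (rcont_normc _)).
Qed.

Lemma dotmx_pholo (v : R[i] -> 'rV[R[i]]_n) y t :
  (forall k, pholo (fun z => v z 0 k) t) -> pholo (fun z => dotmx (v z) y) t.
Proof.
move=> hv; have -> : (fun z => dotmx (v z) y) = fun z => \sum_k v z 0 k * conjc (y 0 k).
  by apply/funext => z; rewrite dotmx_sum.
by apply: pholo_sum => k _; apply: pholoM => //; exact: pholo_cst.
Qed.

End HermitianNorm.

Section LocalMaximum.
Context {R : realType}.
Implicit Types (t : R[i]).

Lemma cnear_forall (I : finType) t (A : I -> R[i] -> Prop) :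
  (forall i, cnear t (A i)) -> cnear t (fun z => forall i, A i z).
Proof.
move=> H; suff : forall s : seq I, cnear t (fun z => forall i, i \in s -> A i z).
  move=> /(_ (enum I)); apply: cnear_sub => z Hz i; apply: Hz.
  by rewrite mem_enum.
elim=> [|i s IH]; first by exists 1.
apply: cnear_sub (cnearI (H i) IH) => z [Ai As] j.
by rewrite inE => /orP[/eqP ->|/As].
Qed.

Lemma eq_of_sum_le (I : finType) (F G : I -> R) :
  (forall i, G i <= F i) -> \sum_i F i <= \sum_i G i -> forall i, F i = G i.
Proof.
move=> GF FG i; apply/eqP; rewrite eq_le GF andbT leNgt; apply/negP => lt.
suff : \sum_j G j < \sum_j F j by rewrite ltNge FG.
by rewrite (bigD1 i)//= [ltRHS](bigD1 i)//= ltr_leD// ler_sum.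
Qed.

Lemma powR_inj (a b q : R) : 0 < q -> 0 <= a -> 0 <= b -> a `^ q = b `^ q -> a = b.
Proof.
move=> q0 a0 b0 E.
have := congr1 (fun x => x `^ q^-1) E.
by rewrite -!powRrM mulfV ?gt_eqF// !powRr1.
Qed.

Lemma powR_expR (a b q : R) : 0 < a -> 0 < b -> (a * b) `^ q = b `^ q * expR (q * ln a).
Proof.
move=> a0 b0; rewrite powRM ?ltW// mulrC; congr (_ * _).
by rewrite /powR gt_eqF.
Qed.

Lemma complex_ReD (z s : R[i]) : Re (z + s) = Re z + Re s.
Proof. by case: z s => [? ?] [? ?]. Qed.

Lemma ReZ (c : R) (z : R[i]) : Re (c%:C * z) = c * Re z.
Proof. by case: z => ? ? /=; rewrite mul0r subr0. Qed.

Lemma complex_Re1 : Re (1 : R[i]) = 1.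
Proof. by []. Qed.

Context {l m : nat} {n : 'I_l -> nat} {p : 'I_l -> R}.
Hypothesis hp : forall j, 0 < p j.
Variables (W : forall j, R[i] -> 'rV[R[i]]_(n j)) (Z : R[i] -> 'rV[R[i]]_m).
Variables (k : R) (t0 : R[i]).
Hypothesis k0 : 0 < k.

(** Each [W j] is projected on its own value at [t0]: by Cauchy-Schwarz, [vnorm (W j t)] is at least
    [vnorm (W j t0) * normc (h j t)] with [h j] holomorphic and equal to 1 at [t0]. With
    [1 + x <= expR x] this bounds the quotient by the value at [t0] from below by
    [1 + Re U + k |Z - Z t0|^2], where [U] is holomorphic and [U t0 = 0]. The maximum makes
    [Re U <= 0], so [U] is constant and every inequality is an equality. *)
Lemma psh_local_max :
  (forall j i, pholo (fun t => W j t 0 i) t0) ->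
  (forall i, pholo (fun t => Z t 0 i) t0) ->
  0 < \sum_j vnorm (W j t0) `^ (2 * p j) ->
  cnear t0 (fun t =>
    (\sum_j vnorm (W j t) `^ (2 * p j)) * expR (k * vnorm (Z t) ^+ 2) <=
    (\sum_j vnorm (W j t0) `^ (2 * p j)) * expR (k * vnorm (Z t0) ^+ 2)) ->
  cnear t0 (fun t => (forall j, W j t = W j t0) /\ Z t = Z t0).
Proof.
move=> hW hZ; set S := \sum_j _ => S0 hv.
pose a j := vnorm (W j t0) `^ (2 * p j) / S.
have a_ge0 j : 0 <= a j by rewrite divr_ge0 ?powR_ge0 ?ltW.
have a_sum : \sum_j a j = 1 by rewrite -mulr_suml divff ?gt_eqF.
have p20 j : 0 < 2 * p j by rewrite mulr_gt0.
have a_eq0 j : W j t0 = 0 -> a j = 0.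
  by move=> W0; rewrite /a W0 vnorm0 powR0 ?mul0r// (gt_eqF (p20 j)).
clearbody S.
(* Where [W j t0 = 0] the weight [a j] is 0; the value 1 keeps the logarithm harmless there. *)
pose h j t := if W j t0 == 0 then 1
  else dotmx (W j t) (W j t0) * ((vnorm (W j t0) ^+ 2)^-1)%:C.
have h_t0 j : h j t0 = 1.
  rewrite /h; case: eqP => // /eqP W0.
  rewrite dotmx_vnorm -rmorphM mulfV// expf_eq0 vnorm_eq0; exact: W0.
have h_pholo j : pholo (h j) t0.
  rewrite /h; case: eqP => _; first exact: pholo_cst.
  by apply: pholoM; [exact: dotmx_pholo|exact: pholo_cst].
have h_pos : cnear t0 (fun t => forall j, 0 < Re (h j t)).
  apply: cnear_forall => j; have [ch _] := h_pholo j.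
  apply: cnear_sub (ch 1 ltr01) => t; rewrite h_t0 => /(le_lt_trans (normc_Re _)).
  by rewrite ReB complex_Re1 ltr_norml => /andP[+ _] => ?; lra.
have h_log j : pholo (fun t => clog (h j t)) t0.
  apply: (pholo_comp (h_pholo j)); rewrite h_t0.
  exists 1 => // z; move=> /(le_lt_trans (normc_Re _)).
  by rewrite ReB complex_Re1 ltr_norml => /andP[+ _] => ?; apply: cdiff_clog; lra.
pose e t := dotmx (Z t) (Z t0) + - dotmx (Z t0) (Z t0).
have e_pholo : pholo e t0.
  by apply: pholoD; [exact: dotmx_pholo|exact: pholo_cst].
have eE t : dotmx (Z t - Z t0) (Z t0) = e t.
  rewrite /e !dotmx_sum -sumrN -big_split /=; apply: eq_bigr => i _.
  by rewrite !mxE mulrDl mulNr.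
pose U t := \sum_j (a j * (2 * p j))%:C * clog (h j t) + (2 * k)%:C * e t.
have U_pholo : pholo U t0.
  apply: pholoD; last by apply: pholoM => //; exact: pholo_cst.
  by apply: pholo_sum => j _; apply: pholoM => //; exact: pholo_cst.
have U_t0 : U t0 = 0.
  rewrite /U /e subrr mulr0 addr0 big1// => j _.
  by rewrite h_t0 clog1 mulr0.
pose x j t : R := 2 * p j * ln (normc (h j t)).
have ReU t : Re (U t) = \sum_j a j * x j t + 2 * k * Re (e t).
  rewrite /U complex_ReD ReZ; congr (_ + _).
  rewrite Re_sum; apply: eq_bigr => j _; rewrite ReZ Re_clog /x; ring.
(* After division by the value at [t0], with [|Z|^2] expanded around [Z t0], the maximum is the
   third clause. The fourth follows from it by averaging [1 + y <= expR y] with the weights [a j],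
   whose sum is 1. *)
have key : cnear t0 (fun t => (forall j, 0 < Re (h j t)) /\ exists q : 'I_l -> R,
   [/\ forall j, q j = vnorm (W j t) `^ (2 * p j) / S,
       forall j, a j * expR (x j t) <= q j,
       (\sum_j q j) * expR (k * vnorm (Z t - Z t0) ^+ 2 + 2 * k * Re (e t)) <= 1 &
       1 + Re (U t) + k * vnorm (Z t - Z t0) ^+ 2 <= 1]).
  apply: cnear_sub (cnearI h_pos hv) => t [hpos vt]; split => //.
  pose q j := vnorm (W j t) `^ (2 * p j) / S; exists q.
  have q_ge j : a j * expR (x j t) <= q j.
    have [W0|W0] := eqVneq (W j t0) 0.
      by rewrite (a_eq0 j W0) mul0r divr_ge0 ?powR_ge0// ltW.
    have hW0 : 0 < vnorm (W j t0) by rewrite vnorm_gt0.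
    have hj0 : 0 < normc (h j t).
      exact: lt_le_trans (hpos j) (le_trans (ler_norm _) (normc_Re _)).
    rewrite /a /q mulrAC ler_pM2r ?invr_gt0//.
    rewrite -powR_expR//; apply: ge0_ler_powR; rewrite ?nnegrE ?vnorm_ge0 ?(ltW (p20 j))//.
      by rewrite mulr_ge0// ltW.
    have := cauchy_schwarz (W j t) (W j t0).
    rewrite /h (negPf W0) Normc.normcM normc_real ger0_norm ?invr_ge0 ?sqr_ge0//.
    move: hW0; move: (vnorm (W j t0)) (vnorm (W j t)) (normc _) => b b' c b0 H.
    have -> : c / b ^+ 2 * b = c / b by field; rewrite gt_eqF.
    by rewrite ler_pdivrMr.
  have vt1 : (\sum_j q j) * expR (k * vnorm (Z t - Z t0) ^+ 2 + 2 * k * Re (e t)) <= 1.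
    rewrite -mulr_suml -eE.
    have : vnorm (Z t) ^+ 2 = vnorm (Z t - Z t0) ^+ 2 +
        2 * Re (dotmx (Z t - Z t0) (Z t0)) + vnorm (Z t0) ^+ 2.
      by rewrite -vnorm_sqrD subrK.
    move: vt; move: (vnorm (Z t) ^+ 2) (vnorm (Z t0) ^+ 2) (vnorm (Z t - _) ^+ 2) (Re _).
    move: (\sum_j _) => S1 A B C D + E.
    rewrite E mulrAC ler_pdivrMr// mul1r => vt.
    have K : expR (k * C + 2 * k * D) * expR (k * B) = expR (k * (C + 2 * D + B)).
      by rewrite -expRD; congr expR; ring.
    by move: vt; rewrite -K mulrA ler_pM2r ?expR_gt0.
  split=> //; apply: le_trans vt1; rewrite ReU mulr_suml.
  have avg (z : R) : \sum_j a j * (1 + (x j t + z)) = 1 + \sum_j a j * x j t + z.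
    transitivity (\sum_j a j + \sum_j a j * x j t + (\sum_j a j) * z).
      by rewrite mulr_suml -!big_split; apply: eq_bigr => j _ /=; ring.
    by rewrite a_sum mul1r.
  set y := k * _ + _.
  have -> : 1 + (\sum_j a j * x j t + 2 * k * Re (e t)) + k * vnorm (Z t - Z t0) ^+ 2 =
      \sum_j a j * (1 + (x j t + y)) by rewrite avg /y; ring.
  apply: ler_sum => j _; apply: le_trans (ler_wpM2r (expR_ge0 y) (q_ge j)).
  by rewrite -[leRHS]mulrA -expRD ler_wpM2l// expR_ge1Dx.
have U0 : cnear t0 (fun t => U t = U t0).
  apply: (pholo_max U_pholo); apply: cnear_sub key => t [_ [q [_ _ _]]].
  rewrite U_t0 /= => H.
  have : 0 <= k * vnorm (Z t - Z t0) ^+ 2 by rewrite mulr_ge0 ?sqr_ge0 ?ltW.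
  by move: H; move: (k * _) (Re (U t)) => ? ? ? ?; lra.
(* Now [Re U = 0], so [k |Z - Z t0|^2 <= 0]. The numbers [q j] have sum at most 1 and dominate
   [a j * (1 + x j t)], whose sum is 1, so they agree; the strict case of [1 + x <= expR x] then
   gives [x j t = 0]. *)
have step : cnear t0 (fun t => [/\ Z t = Z t0, forall j, 0 < Re (h j t),
    forall j, vnorm (W j t) = vnorm (W j t0) & forall j, W j t0 != 0 -> x j t = 0]).
  apply: cnear_sub (cnearI key U0) => t [[hpos [q [qE q_ge vt1 vt2]]] Ut].
  have ReU0 : Re (U t) = 0 by rewrite Ut U_t0.
  have ZE : Z t = Z t0.
    apply/eqP; rewrite -subr_eq0 -vnorm_eq0 -sqrf_eq0; apply/eqP.
    have kZ : k * vnorm (Z t - Z t0) ^+ 2 <= 0.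
      by move: vt2; rewrite ReU0; move: (k * _) => ? ?; lra.
    by apply/eqP; rewrite eq_le -(pmulr_rle0 _ k0) kZ sqr_ge0.
  have e0 : e t = 0 by rewrite /e ZE subrr.
  have q1 : \sum_j q j <= 1.
    move: vt1; rewrite e0 ZE subrr vnorm0 expr0n /= !mulr0 addr0 expR0 mulr1 //.
  have ax : \sum_j a j * x j t = 0.
    by have := ReU t; rewrite ReU0 e0 /= mulr0 addr0.
  have ge2 j : a j * (1 + x j t) <= a j * expR (x j t) := ler_wpM2l (a_ge0 j) (expR_ge1Dx _).
  have sum1 : \sum_j a j * (1 + x j t) = 1.
    under eq_bigr do rewrite mulrDr mulr1.
    by rewrite big_split /= a_sum ax addr0.
  have E1 : forall j, q j = a j * (1 + x j t).
    by apply: eq_of_sum_le; [move=> j; apply: le_trans (ge2 j) (q_ge j)|rewrite sum1].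
  have x0 j : W j t0 != 0 -> x j t = 0.
    move=> W0; have aj : 0 < a j := divr_gt0 (powR_gt0 _ (etrans (vnorm_gt0 _) W0)) S0.
    apply/eqP; apply: contraT => /expR_gt1Dx H.
    have := q_ge j; rewrite (E1 j) (ler_pM2l aj) leNgt H; exact: id.
  split; [exact: ZE|exact: hpos|move=> j|exact: x0].
  apply: (powR_inj (p20 j) (vnorm_ge0 _) (vnorm_ge0 _)).
  have qa : q j = a j.
    rewrite (E1 j); have [W0|/x0 ->] := eqVneq (W j t0) 0.
      by rewrite (a_eq0 j W0) mul0r.
    by rewrite addr0 mulr1.
  move: qa; rewrite (qE j) /a; apply: mulIf; rewrite invr_eq0.
  by rewrite (gt_eqF S0).
(* So far only [normc (h j t) = 1]; applying [pholo_max] to the logarithm fixes the argument as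
   well. Equal norms and this inner product then give [W j t = W j t0]. *)
have stepj j : cnear t0 (fun t => W j t0 != 0 -> h j t = 1).
  have [W0|W0] := eqVneq (W j t0) 0; first by exists 1.
  have lg0 : cnear t0 (fun t => Re (clog (h j t)) = 0).
    apply: cnear_sub step => t [_ _ _ /(_ j W0)] /eqP.
    by rewrite /x mulf_eq0 gt_eqF//= => /eqP.
  have := pholo_max (h_log j); rewrite h_t0 clog1 /= => H.
  have {}H : cnear t0 (fun t => clog (h j t) = 0).
    by apply: H; apply: cnear_sub lg0 => t; rewrite Re_clog => ->.
  apply: cnear_sub (cnearI step H) => t [[_ hpos _ _] E] _.
  by rewrite -[h j t]cexp_clog// E cexp0.
apply: cnear_sub (cnearI step (cnear_forall stepj)) => t [[-> _ hW1 _] hj1]; split=> // j.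
have [W0|W0] := eqVneq (W j t0) 0.
  by rewrite W0; apply/eqP; rewrite -vnorm_eq0 hW1 W0 vnorm0.
apply/eqP; rewrite -subr_eq0 -vnorm_eq0 -sqrf_eq0; apply/eqP.
have : Re (dotmx (W j t) (W j t0)) = vnorm (W j t0) ^+ 2.
  have := hj1 j W0; rewrite /h (negPf W0) => E.
  have h20 : vnorm (W j t0) ^+ 2 != 0 by rewrite expf_eq0 vnorm_eq0.
  have -> : dotmx (W j t) (W j t0) = (vnorm (W j t0) ^+ 2)%:C.
    by rewrite -[LHS]mulr1 -[X in _ * X = _](_ : (vnorm (W j t0) ^+ 2)^-1%:C * (vnorm (W j t0) ^+ 2)%:C = 1) ?mulrA ?E ?mul1r// -rmorphM mulVf.
  by [].
have dN : dotmx (W j t) (- W j t0) = - dotmx (W j t) (W j t0).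
  rewrite !dotmx_sum -sumrN; apply: eq_bigr => i _.
  by rewrite mxE rmorphN mulrN.
have := vnorm_sqrD (W j t) (- W j t0); rewrite dN vnormN (hW1 j).
have -> : Re (- dotmx (W j t) (W j t0)) = - Re (dotmx (W j t) (W j t0)) by case: (dotmx _ _).
by move: (vnorm (W j t0) ^+ 2) (Re _) => A B -> ->; ring.
Qed.

End LocalMaximum.

Section GlobalMaximum.
Context {R : realType}.
Implicit Types (t z : R[i]).

(** Without a maximum every point is beaten by another one, which by semicontinuity beats a whole
    neighborhood. Bisection merges these into one point that beats the entire box, itself included.
    Semicontinuity is the right generality because one of the functions maximized later is
    discontinuous. *)
Lemma usc_box_max (F : R -> R -> R) (a b c d : R) : a <= b -> c <= d ->
  (forall x y, a <= x <= b -> c <= y <= d -> forall m, F x y < m ->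
    exists2 e : R, 0 < e & forall x' y', a <= x' <= b -> c <= y' <= d ->
      `|x' - x| < e -> `|y' - y| < e -> F x' y' < m) ->
  exists x y, [/\ a <= x <= b, c <= y <= d &
    forall x' y', a <= x' <= b -> c <= y' <= d -> F x' y' <= F x y].
Proof.
move=> ab cd usc; apply: contrapT => nmax.
have bigger x y : a <= x <= b -> c <= y <= d ->
    exists x' y', [/\ a <= x' <= b, c <= y' <= d & F x y < F x' y'].
  move=> xI yI; apply: contrapT => H; apply: nmax; exists x, y; split=> // x' y' xI' yI'.
  by rewrite leNgt; apply/negP => lt; apply: H; exists x', y'.
have [x [y [xI yI H]]] : exists x y, [/\ a <= x <= b, c <= y <= d &
    forall x' y', a <= x' <= b -> c <= y' <= d -> a <= x' <= b -> c <= y' <= d ->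
      F x' y' < F x y].
  apply: (@box_bisection R (fun a' b' c' d' => exists x y, [/\ a <= x <= b, c <= y <= d &
    forall x' y', a' <= x' <= b' -> c' <= y' <= d' -> a <= x' <= b -> c <= y' <= d ->
      F x' y' < F x y])) => //.
    move=> a' b' c' d' _ _.
    have join (P Q : R -> R -> Prop) :
        (exists x y, [/\ a <= x <= b, c <= y <= d & forall x' y', P x' y' -> F x' y' < F x y]) ->
        (exists x y, [/\ a <= x <= b, c <= y <= d & forall x' y', Q x' y' -> F x' y' < F x y]) ->
        exists x y, [/\ a <= x <= b, c <= y <= d &
           forall x' y', P x' y' \/ Q x' y' -> F x' y' < F x y].
      move=> [x1 [y1 [x1I y1I H1]]] [x2 [y2 [x2I y2I H2]]].
      have [le|lt] := leP (F x1 y1) (F x2 y2).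
        by exists x2, y2; split=> // x' y' [/H1 h|/H2 //]; apply: lt_le_trans le.
      by exists x1, y1; split=> // x' y' [/H1 //|/H2 h]; apply: lt_trans lt.
    pose Q' (a' b' c' d' : R) x' y' :=
      [/\ a' <= x' <= b', c' <= y' <= d', a <= x' <= b & c <= y' <= d].
    have E a1 b1 c1 d1 : (exists x y, [/\ a <= x <= b, c <= y <= d &
       forall x' y', a1 <= x' <= b1 -> c1 <= y' <= d1 -> a <= x' <= b -> c <= y' <= d ->
       F x' y' < F x y]) -> (exists x y, [/\ a <= x <= b, c <= y <= d &
       forall x' y', Q' a1 b1 c1 d1 x' y' -> F x' y' < F x y]).
      by move=> [x [y [xI yI H]]]; exists x, y; split=> // x' y' [*]; exact: H.
    set m := (a' + b') / 2; set k := (c' + d') / 2.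
    move=> /E H1 /E H2 /E H3 /E H4.
    have [x [y [xI yI H]]] := join _ _ (join _ _ H1 H2) (join _ _ H3 H4).
    exists x, y; split=> // x' y' /andP[h1 h2] /andP[h3 h4] h5 h6; apply: H.
    have [xm|xm] := leP x' m; have [yk|yk] := leP y' k.
    - by left; left; rewrite /Q' h1 h3 xm yk.
    - by right; left; rewrite /Q' h1 h4 xm (ltW yk).
    - by left; right; rewrite /Q' h2 h3 (ltW xm) yk.
    - by right; right; rewrite /Q' h2 h4 (ltW xm) (ltW yk).
  move=> x y xI yI; have [x1 [y1 [x1I y1I lt]]] := bigger x y xI yI.
  have [e e0 H] := usc x y xI yI _ lt; exists e => // a' b' c' d' xab ycd abe cde.
  exists x1, y1; split=> // x' y' /andP[h1 h2] /andP[h3 h4] h5 h6; apply: H => //.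
    case/andP: xab => ? ?; apply: le_lt_trans abe; exact: seg_dist.
  case/andP: ycd => ? ?; apply: le_lt_trans cde; exact: seg_dist.
by have := H x y xI yI xI yI; rewrite ltxx.
Qed.

Lemma usc_disc_max (F : R[i] -> R) (r : R) : 0 < r ->
  (forall t, normc t <= r -> 0 <= F t) ->
  (forall t, normc t <= r -> forall m, F t < m ->
     cnear t (fun z => normc z <= r -> F z < m)) ->
  exists2 t0, normc t0 <= r & forall t, normc t <= r -> F t <= F t0.
Proof.
move=> r0 F0 usc.
(* The value -1 lies below all values of [F] on the disc, so the extension to the square stays upper
   semicontinuous and its maximum is attained in the disc. *)
pose G (x y : R) := if normc (x +i* y) <= r then F (x +i* y) else -1.
have rr : - r <= r by lra.
have [|x [y [xI yI H]]] := @usc_box_max G (-r) r (-r) r rr rr.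
  move=> x y _ _ m Gm.
  suff [e e0 H] : cnear (x +i* y) (fun z => G (Re z) (Im z) < m).
    exists (e / 2) => [|x' y' _ _ hx hy]; first by rewrite divr_gt0.
    apply: (H (x' +i* y')); apply: le_lt_trans (normc_le_ReIm _) _.
    by rewrite ReB ImB /=; lra.
  move: Gm; rewrite /G; case: ifP => [tr Fm|/negbT].
    have m0 : -1 < m by have := F0 _ tr; move=> ?; lra.
    apply: cnear_sub (usc _ tr m Fm) => -[x' y'] /= H'.
    by case: ifP => [/H'|].
  rewrite -ltNge => tr m1.
  have d0 : 0 < normc (x +i* y) - r by rewrite subr_gt0.
  apply: cnear_sub (rcont_normc (x +i* y) d0) => -[x' y'].
  rewrite ltr_norml => /andP[h _]; rewrite /= -/(normc (x' +i* y')).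
  by rewrite ifF//; apply/negbTE; rewrite -ltNge; lra.
pose t0 := x +i* y.
have in_box t : normc t <= r -> (- r <= Re t <= r) /\ (- r <= Im t <= r).
  by move=> tr; rewrite -!ler_norml; split; apply: le_trans tr; [exact: normc_Re|exact: normc_Im].
have GE t : normc t <= r -> G (Re t) (Im t) = F t.
  by case: t => a b tr; rewrite /G /= -/(normc (a +i* b)) tr.
have t0r : normc t0 <= r.
  have z0 : normc (0 : R[i]) <= r by rewrite Normc.normc0 ltW.
  have [b1 b2] := in_box _ z0; have := H _ _ b1 b2; rewrite (GE _ z0).
  rewrite /G -/t0; case: ifP => // _ h; have := F0 _ z0 => h'.
  by have := le_trans h' h; rewrite ler0N1.
exists t0 => // t tr; have [b1 b2] := in_box _ tr.
by rewrite -(GE _ tr) -(GE _ t0r); exact: H.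
Qed.

Context {l m : nat} {n : 'I_l -> nat} {p : 'I_l -> R}.
Hypothesis hp : forall j, 0 < p j.
Variables (W : forall j, R[i] -> 'rV[R[i]]_(n j)) (Z : R[i] -> 'rV[R[i]]_m).
Variables (k rho : R).
Hypothesis k0 : 0 < k.
Hypothesis hW : forall t, normc t < rho -> forall j i, pholo (fun t => W j t 0 i) t.
Hypothesis hZ : forall t, normc t < rho -> forall i, pholo (fun t => Z t 0 i) t.

Let S t := \sum_j vnorm (W j t) `^ (2 * p j).
Let v t := S t * expR (k * vnorm (Z t) ^+ 2).

Let S_ge0 t : 0 <= S t.
Proof. by apply: sumr_ge0 => j _; exact: powR_ge0. Qed.

Let v_ge0 t : 0 <= v t.
Proof. by rewrite mulr_ge0// expR_ge0. Qed.

Lemma powR_rcont (f : R[i] -> R) (q : R) t :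
  0 < q -> (forall z, 0 <= f z) -> rcont f t -> rcont (fun z => f z `^ q) t.
Proof.
move=> q0 f0 cf; have [ft|ft] := eqVneq (f t) 0; last first.
  apply: (rcont_comp (h := fun x => x `^ q) cf).
  have ft0 : 0 < f t by rewrite lt_def ft f0.
  have [dq _] := is_derive1_powR q ft0.
  exact/differentiable_continuous/derivable1_diffP.
move=> e e0; have d0 : 0 < e `^ q^-1 by rewrite powR_gt0.
apply: cnear_sub (cf _ d0) => z; rewrite ft subr0 powR0 ?gt_eqF// subr0.
rewrite !ger0_norm ?powR_ge0// => H.
have -> : e = (e `^ q^-1) `^ q by rewrite -powRrM mulVf ?gt_eqF// powRr1// ltW.
by apply: gt0_ltr_powR; rewrite ?nnegrE ?powR_ge0.
Qed.

Let v_rcont t : normc t < rho -> rcont v t.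
Proof.
move=> tr; apply: rcontM.
  apply: rcont_sum => j; apply: powR_rcont.
  - by rewrite mulr_gt0.
  - by move=> z; exact: vnorm_ge0.
  - by apply: vnorm_rcont => i; have [] := hW tr i.
apply: (rcont_comp (h := expR)); last exact: continuous_expR.
have cZ : rcont (fun z => vnorm (Z z)) t by apply: vnorm_rcont => i; have [] := hZ tr i.
apply: rcontM; [exact: rcont_cst|exact: (rcontM cZ cZ)].
Qed.

(** By [psh_local_max] a positive interior maximum is attained on a whole neighborhood, so a maximum
    point farthest from 0 cannot be interior. *)
Lemma maximum_principle (r M : R) : 0 < r -> r < rho ->
  (forall t, normc t = r -> v t <= M) -> forall t, normc t <= r -> v t <= M.
Proof.
move=> r0 rrho bd.
have rho_t t : normc t <= r -> normc t < rho by move=> tr; exact: le_lt_trans rrho.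
have [||t0 t0r max0] := @usc_disc_max v r r0.
- by move=> t _; exact: v_ge0.
- move=> t tr c vc; have d0 : 0 < c - v t by rewrite subr_gt0.
  apply: cnear_sub (v_rcont (rho_t _ tr) d0) => z.
  by rewrite ltr_norml => /andP[_ h] _; lra.
suff m_le : v t0 <= M by move=> t tr; exact: le_trans (max0 _ tr) m_le.
rewrite leNgt; apply/negP => Mlt.
have M0 : 0 <= M.
  by apply: le_trans (v_ge0 r%:C) (bd _ _); rewrite normc_real gtr0_norm.
(* A maximum point of [F] is a maximum point of [v] farthest from 0. The set where [v t = v t0] is
   closed, so [F] is upper semicontinuous; the summand 1 separates the origin from the value 0 taken
   elsewhere. *)
pose F t := if v t == v t0 then normc t + 1 else 0.
have [||t1 t1r max1] := @usc_disc_max F r r0.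
- by move=> t _; rewrite /F; case: ifP => // _; rewrite addr_ge0 ?normc_ge0.
- move=> t tr c; rewrite /F; case: (eqVneq (v t) (v t0)) => [vt tc|vt c0].
    have d0 : 0 < c - (normc t + 1) by rewrite subr_gt0.
    apply: cnear_sub (rcont_normc t d0) => z; rewrite ltr_norml => /andP[_ h] _.
    by case: ifP => _; last have := normc_ge0 t; lra.
  have d0 : 0 < `|v t0 - v t| by rewrite normr_gt0 subr_eq0 eq_sym.
  apply: cnear_sub (v_rcont (rho_t _ tr) d0) => z h _.
  case: eqP => // vz; by rewrite vz ltxx in h.
have vt1 : v t1 = v t0.
  have := max1 _ t0r; rewrite /F eqxx; case: eqP => // _.
  by rewrite leNgt ltr_wpDl// normc_ge0.
have t1lt : normc t1 < r.
  rewrite lt_neqAle t1r andbT; apply/eqP => /bd; rewrite vt1.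
  by rewrite leNgt Mlt.
have S0 : 0 < S t1.
  rewrite lt_def S_ge0 andbT; apply/eqP => S0.
  by move: Mlt; rewrite -vt1 /v S0 mul0r ltNge M0.
have near_disc : cnear t1 (fun t => normc t <= r).
  have d0 : 0 < r - normc t1 by rewrite subr_gt0.
  apply: cnear_sub (rcont_normc t1 d0) => z; rewrite ltr_norml => /andP[_ h]; lra.
have t1rho := rho_t _ t1r.
have loc : cnear t1 (fun t => (forall j, W j t = W j t1) /\ Z t = Z t1).
  apply: (psh_local_max hp k0 (hW t1rho) (hZ t1rho) S0).
  by apply: cnear_sub near_disc => t /max0; rewrite -vt1.
have {loc} vloc : cnear t1 (fun t => normc t <= r /\ v t = v t0).
  apply: cnear_sub (cnearI near_disc loc) => t [tr [Wt Zt]]; split=> //.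
  by rewrite -vt1 /v Zt; congr (_ * _); apply: eq_bigr => j _; rewrite Wt.
have [z [zr vz zgt]] : exists z, [/\ normc z <= r, v z = v t0 & normc t1 < normc z].
  have [e e0 He] := vloc.
  have [t10|t10] := eqVneq t1 0.
    exists (e / 2)%:C; have ne : normc (e / 2)%:C = e / 2.
      by rewrite normc_real gtr0_norm// divr_gt0.
    have [|? ?] := He (e / 2)%:C; first by rewrite t10 subr0 ne; lra.
    by split=> //; rewrite t10 Normc.normc0 ne divr_gt0.
  have n0 : 0 < normc t1 by rewrite normc_gt0.
  pose d := e / (2 * normc t1).
  have d0 : 0 < d by rewrite divr_gt0// mulr_gt0.
  exists ((1 + d)%:C * t1).
  have [|? ?] := He ((1 + d)%:C * t1).
    have -> : (1 + d)%:C * t1 - t1 = d%:C * t1 by rewrite rmorphD /=; ring.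
    rewrite Normc.normcM normc_real gtr0_norm//.
    have -> : d * normc t1 = e / 2 by rewrite /d; field; rewrite gt_eqF.
    by lra.
  split=> //; rewrite Normc.normcM normc_real gtr0_norm ?addr_gt0//.
  by rewrite ltr_pMl// ltrDl.
have := max1 _ zr; rewrite /F vz vt1 eqxx => ?; lra.
Qed.

(** On the segment from 0 to [t], the set where [W] and [Z] keep their values at 0 is open by
    [psh_local_max] and closed by continuity. *)
Lemma maximum_at_center : 0 < S 0 ->
  (forall t, normc t < rho -> v t <= v 0) ->
  forall t, normc t < rho -> (forall j, W j t = W j 0) /\ Z t = Z 0.
Proof.
move=> S0 vmax t tr.
pose X (s : R) := (forall j, W j (s%:C * t) = W j 0) /\ Z (s%:C * t) = Z 0.
have nst (s : R) : 0 <= s <= 1 -> normc (s%:C * t) < rho.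
  move=> /andP[s0 s1]; rewrite Normc.normcM normc_real ger0_norm//.
  by apply: le_lt_trans tr; rewrite ler_piMl// normc_ge0.
suff [+ _] : X 0 <-> X 1.
  by rewrite /X mul0r mul1r; apply.
(* Connectedness of the segment: the equivalence is transitive, and it holds on short segments
   because [X] is locally constant. *)
apply: (@segment_bisection R (fun a b => X a <-> X b)) => //.
  by move=> a b _ h1 h2; split=> [/h1/h2|/h2/h1].
move=> s sI.
have scale (a : R) (e : R) : 0 < e -> `|a - s| < e / (normc t + 1) ->
    normc (a%:C * t - s%:C * t) < e.
  move=> e0; rewrite -mulrBl -rmorphB Normc.normcM normc_real.
  have n1 : 0 < normc t + 1 by rewrite ltr_wpDl// normc_ge0.
  rewrite ltr_pdivlMr//; apply: le_lt_trans; rewrite ler_wpM2l// lerDl //.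
have tostep (A : R[i] -> Prop) : cnear (s%:C * t) A -> exists2 e : R, 0 < e &
    forall a b, a <= s <= b -> b - a < e -> A (a%:C * t) /\ A (b%:C * t).
  move=> [e e0 H]; exists (e / (normc t + 1)).
    by rewrite divr_gt0// ltr_wpDl// normc_ge0.
  move=> a b /andP[as_ sb] ab.
  split; apply: H; apply: scale => //; apply: le_lt_trans ab; rewrite ler_norml; apply/andP; split; lra.
case: (pselect (X s)) => [[WX ZX]|nX].
  have vs : v (s%:C * t) = v 0.
    by rewrite /v ZX; congr (_ * _); apply: eq_bigr => j _; rewrite WX.
  have Ss : 0 < S (s%:C * t).
    by apply: lt_le_trans S0 _; rewrite le_eqVlt; apply/orP; left; apply/eqP; apply: eq_bigr => j _; rewrite WX.
  have str := nst s sI.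
  have loc : cnear (s%:C * t) (fun z => (forall j, W j z = W j (s%:C * t)) /\ Z z = Z (s%:C * t)).
    apply: (psh_local_max hp k0 (hW str) (hZ str) Ss).
    rewrite -/(S _) -/(v _) vs.
    have d0 : 0 < rho - normc (s%:C * t) by rewrite subr_gt0.
    apply: cnear_sub (rcont_normc (s%:C * t) d0) => z; rewrite ltr_norml => /andP[_ h].
    by apply: vmax; lra.
  have [e e0 H] := tostep _ loc; exists e => // a b asb ab.
  have [[Wa Za] [Wb Zb]] := H a b asb ab.
  by split=> _; split=> [j|]; rewrite ?Wb ?Wa ?Zb ?Za ?WX.
have loc : cnear (s%:C * t) (fun z => ~ ((forall j, W j z = W j 0) /\ Z z = Z 0)).
  have str := nst s sI.
  have cneq (u : R[i] -> R[i]) : ccont u (s%:C * t) -> u (s%:C * t) <> u 0 ->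
      cnear (s%:C * t) (fun z => u z <> u 0).
    move=> cu ne; have d0 : 0 < normc (u (s%:C * t) - u 0).
      by rewrite normc_gt0 subr_eq0; apply/eqP.
    by apply: cnear_sub (cu _ d0) => z + E; rewrite E normcB_sym ltxx.
  case: (pselect (Z (s%:C * t) = Z 0)) => ZX.
    have [j Wj] : exists j, W j (s%:C * t) <> W j 0.
      by apply: contrapT => H; apply: nX; split=> // j; apply: contrapT => Wj; apply: H; exists j.
    have [i Wi] : exists i, W j (s%:C * t) 0 i <> W j 0 0 i.
      by apply: contrapT => H; apply: Wj; apply/rowP => i; apply: contrapT => Wi; apply: H; exists i.
    have [cW _] := hW str i.
    by apply: cnear_sub (cneq _ cW Wi) => z ne [E _]; apply: ne; rewrite E.
  have [i Zi] : exists i, Z (s%:C * t) 0 i <> Z 0 0 i.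
    by apply: contrapT => H; apply: ZX; apply/rowP => i; apply: contrapT => Zi; apply: H; exists i.
  have [cZ _] := hZ str i.
  by apply: cnear_sub (cneq _ cZ Zi) => z ne [_ E]; apply: ne; rewrite E.
have [e e0 H] := tostep _ loc; exists e => // a b asb ab.
by have [na nb] := H a b asb ab; split=> h; exfalso; [exact: (na h)|exact: (nb h)].
Qed.

End GlobalMaximum.

(** * Fibers of an automorphism *)

Section Interface.
Context {R : realType}.

Lemma mx_norm_coord k (y : 'rV[R[i]]_k) i : (normc (y 0 i))%:C <= `|y|.
Proof.
rewrite -normrc -[leRHS]/(mx_norm y) mx_normE -[leLHS]nngE num_le.
exact: (le_bigmax _ (fun i : 'I_1 * 'I_k => `|y i.1 i.2|%:nng) (0, i)).
Qed.

Context {V W : normedModType R[i]}.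

Lemma diff_expand (f : V -> W) (x d : V) : differentiable f x ->
  forall e : R, 0 < e -> exists2 r : R, 0 < r &
    forall h : R[i], normc h < r ->
      `|f (x + h *: d) - f x - h *: ('d f x d)| <= (e * normc h)%:C.
Proof.
move=> df e e0.
have /cvg_ex[l hl] := @diff_derivable _ _ _ f x d df.
have lE : 'd f x d = l.
  by rewrite -(@deriveE _ _ _ f x d df); apply: (@cvg_lim W).
rewrite lE; have e0' : 0 < e%:C by rewrite (ltcR 0).
move: hl => /cvgrPdist_lt/(_ _ e0')/dnbhs_complexP[r r0 Hr].
exists r => // h hr; have [->|h0] := eqVneq h 0.
  by rewrite !scale0r addr0 !subrr normr0 Normc.normc0 mulr0.
have := Hr h; rewrite subr0 hr normc_gt0 h0 => /(_ isT) /ltW H.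
have -> : f (x + h *: d) - f x - h *: l = - (h *: (l - h^-1 *: (f (h *: d + x) - f x))).
  by rewrite scalerBr scalerA mulfV// scale1r opprB [x + _]addrC.
rewrite normrN normrZ rmorphM mulrC normrc.
by apply: ler_wpM2r H; rewrite lecR normc_ge0.
Qed.

End Interface.

Section Coordinates.
Context {R : realType} {m N : nat}.
Local Notation E := ('rV[R[i]]_m * 'rV[R[i]]_N)%type.
Implicit Types (x d : E) (f : E -> E).

Definition coordinate (c : E -> R[i]) :=
  (exists i, c = fun y => y.1 0 i) \/ (exists i, c = fun y => y.2 0 i).

Lemma coordinate_norm c (y : E) : coordinate c -> (normc (c y))%:C <= `|y|.
Proof.
rewrite prod_normE; have cmp : `|y.1| >=< `|y.2| by apply: real_comparable; exact: normr_real.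
by case=> -[i ->]; rewrite comparable_le_max// mx_norm_coord ?orbT.
Qed.

Lemma coordinateB c (y z : E) : coordinate c -> c (y - z) = c y - c z.
Proof. by case=> -[i ->]; rewrite !mxE. Qed.

Lemma coordinateZ c (h : R[i]) (y : E) : coordinate c -> c (h *: y) = h * c y.
Proof. by case=> -[i ->]; rewrite !mxE. Qed.

Lemma coordinate_expand f x d c : coordinate c -> differentiable f x ->
  forall e : R, 0 < e -> exists2 r : R, 0 < r & forall h : R[i], normc h < r ->
    normc (c (f (x + h *: d)) - c (f x) - c ('d f x d) * h) <= e * normc h.
Proof.
move=> cc df e e0; have [r r0 Hr] := diff_expand d df e0.
exists r => // h /Hr H; rewrite -lecR; apply: le_trans H.
by rewrite -!coordinateB// mulrC -coordinateZ// -coordinateB// coordinate_norm.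
Qed.

Lemma coordinate_cdiff f x d c t : coordinate c -> differentiable f (x + t *: d) ->
  cdiff (fun t => c (f (x + t *: d))) t.
Proof.
move=> cc df; exists (c ('d f (x + t *: d) d)) => e /(coordinate_expand d cc df)[r r0 Hr].
by exists r => // h /Hr; rewrite -[x + _ + _]addrA -scalerDl.
Qed.

End Coordinates.

(** * Divided differences and Liouville's theorem *)

Section DividedDifference.
Context {R : realType}.
Implicit Types (u : R[i] -> R[i]) (d t : R[i]).

(** Meant for [u 0 = 0] with [d] the derivative of [u] at 0, which removes the singularity. *)
Definition quotient u d t : R[i] := if t == 0 then d else u t / t.

Lemma quotient_cdiff u d t : t != 0 -> cdiff u t -> cdiff (quotient u d) t.
Proof.
move=> t0 du; have tn : 0 < normc t by rewrite normc_gt0.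
have [d' H] := cdiffM du (cdiffV (cdiff_id t) t0).
exists d' => e e0; have [r r0 Hr] := H e e0.
exists (Num.min r (normc t)); first by rewrite lt_min r0.
move=> h; rewrite lt_min => /andP[/Hr + ht].
have th : t + h != 0.
  rewrite -normc_gt0; have := le_normcD (t + h) (- h); rewrite addrK normcN => ?; lra.
by rewrite /quotient (negPf th) (negPf t0).
Qed.

Lemma quotient_pholo0 u d : u 0 = 0 -> cnear 0 (cdiff u) ->
  (forall e : R, 0 < e -> exists2 r : R, 0 < r &
    forall h, normc h < r -> normc (u (0 + h) - u 0 - d * h) <= e * normc h) ->
  pholo (quotient u d) 0.
Proof.
move=> u0 du H; split.
  move=> e e0; have e20 : 0 < e / 2 by rewrite divr_gt0.
  have [r r0 Hr] := H _ e20.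
  exists r => // h; rewrite /quotient subr0 eqxx => /Hr; case: eqP => [_ _|/eqP h0].
    by rewrite subrr Normc.normc0.
  rewrite u0 subr0 add0r; have nh : 0 < normc h by rewrite normc_gt0.
  have -> : u h - d * h = (u h / h - d) * h by rewrite mulrBl divfK.
  rewrite Normc.normcM ler_pM2r// => K; apply: le_lt_trans K _; lra.
case: du => r r0 Hr; exists r => // t; rewrite subr0 normc_gt0 => /andP[t0 tr].
by apply: quotient_cdiff => //; apply: Hr; rewrite subr0.
Qed.

Lemma quotient_pholo u d (rho : R) t : 0 < rho -> u 0 = 0 ->
  (forall s, normc s < rho -> cdiff u s) ->
  (forall e : R, 0 < e -> exists2 r : R, 0 < r &
    forall h, normc h < r -> normc (u (0 + h) - u 0 - d * h) <= e * normc h) ->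
  normc t < rho -> pholo (quotient u d) t.
Proof.
move=> rho0 u0 du H tr; have [->|t0] := eqVneq t 0.
  by apply: quotient_pholo0 => //; exists rho => // z; rewrite subr0; exact: du.
apply: cdiff_pholo; have tn : 0 < normc t by rewrite normc_gt0.
have d0 : 0 < Num.min (normc t) (rho - normc t) by rewrite lt_min tn subr_gt0.
apply: cnear_sub (rcont_normc t d0) => z; rewrite lt_min !ltr_norml.
move=> /andP[/andP[h1 _] /andP[_ h2]].
by apply: quotient_cdiff; [rewrite -normc_gt0; lra|apply: du; lra].
Qed.

(* The maximum principle bounds the difference quotient of a bounded function by
   its values on a large circle. *)
Lemma liouville u (M : R) :
  (forall t, cdiff u t) -> (forall t, normc (u t) <= M) -> forall t, u t = u 0.
Proof.
move=> du bd t.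
pose u1 s := u s + - u 0.
have du1 s : cdiff u1 s by apply: cdiffD => //; exact: cdiff_cst.
have u10 : u1 0 = 0 by rewrite /u1 subrr.
have [d hd] := du1 0.
pose Q := quotient u1 d.
have vQ s : vnorm (const_mx (Q s) : 'rV[R[i]]_1) = normc (Q s).
  have := vnorm_sqr (const_mx (Q s) : 'rV[R[i]]_1); rewrite big_ord1 mxE => E.
  by apply/eqP; rewrite -(@eqrXn2 _ 2)// ?vnorm_ge0 ?normc_ge0// E.
have Qle (r : R) : 0 < r -> normc t <= r -> normc (Q t) <= 2 * M / r.
  move=> r0 tr.
  have p0 (j : 'I_1) : 0 < (fun=> 1 / 2 : R) j by rewrite divr_gt0.
  have one (x : R) : 0 <= x -> x `^ (2 * (1 / 2)) = x.
    by move=> x0; rewrite mulrC divfK ?powRr1// pnatr_eq0.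
  (* One block of dimension 1 with [2 * p = 1] and an empty [Z]: the function in the maximum
     principle reduces to [normc (Q s)]. *)
  have := @maximum_principle R 1 0 (fun=> 1%N) (fun=> 1 / 2) p0
    (fun _ s => const_mx (Q s)) (fun=> 0) 1 (r + 1) ltr01.
  move=> /(_ _ _ r (2 * M / r)).
  have hQ s : normc s < r + 1 -> forall (j : 'I_1) (i : 'I_1),
      pholo (fun t0 => (const_mx (Q t0) : 'rV[R[i]]_1) 0 i) s.
    move=> sr _ i; have -> : (fun t0 => (const_mx (Q t0) : 'rV[R[i]]_1) 0 i) = Q.
      by apply/funext => z; rewrite mxE.
    by apply: (@quotient_pholo u1 d (r + 1)) => //; rewrite addr_gt0.
  move=> /(_ hQ); have h0 s : normc s < r + 1 -> forall i : 'I_0,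
      pholo (fun t0 : R[i] => (0 : 'rV[R[i]]_0) 0 i) s by move=> _ [].
  move=> /(_ h0 r0); rewrite ltrDl => /(_ ltr01).
  have vE s : (\sum_(j < 1) vnorm (const_mx (Q s) : 'rV[R[i]]_1) `^ (2 * (1 / 2))) *
      expR (1 * vnorm (0 : 'rV[R[i]]_0) ^+ 2) = normc (Q s).
    by rewrite big_ord1 vQ one ?normc_ge0// vnorm0 expr0n mulr0 expR0 mulr1.
  move=> H; have := H _ t tr; rewrite vE; apply => s sr; rewrite vE.
  have s0 : s != 0 by rewrite -normc_gt0 sr.
  rewrite /Q /quotient (negPf s0) Normc.normcM Normc.normcV sr.
  rewrite ler_pM2r ?invr_gt0//; apply: le_trans (le_normcD _ _) _.
  by rewrite normcN mulr_natl mulr2n lerD.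
have M0 : 0 <= M by apply: le_trans (normc_ge0 _) (bd 0).
have Q0 : normc (Q t) <= 0.
  rewrite leNgt; apply/negP => Q0.
  (* Chosen so that [t] lies in the disc and [normc (Q t) * r > 2 * M], against [Qle]. *)
  pose r := normc t + 1 + 2 * (2 * M) / normc (Q t).
  have b0 : 0 <= 2 * (2 * M) / normc (Q t) by rewrite divr_ge0 ?mulr_ge0 ?(ltW Q0).
  have nt := normc_ge0 t.
  have r0 : 0 < r by rewrite /r; lra.
  have tr : normc t <= r by rewrite /r; lra.
  have := Qle r r0 tr; rewrite ler_pdivlMr//.
  rewrite /r 2!mulrDr mulrCA divff ?gt_eqF// !mulr1.
  have : 0 <= normc (Q t) * normc t by rewrite mulr_ge0// ltW.
  by move=> h1 h2; clear - M0 Q0 h1 h2; lra.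
have [->//|t0] := eqVneq t 0.
have : normc (Q t) == 0 by rewrite eq_le Q0 normc_ge0.
rewrite /Q /quotient (negPf t0) => /eqP /Normc.eq0_normc /eqP.
by rewrite mulf_eq0 invr_eq0 (negPf t0) orbF subr_eq0 => /eqP.
Qed.

End DividedDifference.

Lemma submxrow_inj (R : realType) (l : nat) (n : 'I_l -> nat)
    (w w' : 'rV[R[i]]_(\sum_(j < l) n j)) :
  (forall j, submxrow w j = submxrow w' j) -> w = w'.
Proof. by move=> H; rewrite -[LHS]submxrowK -[RHS]submxrowK; apply: eq_mxrow. Qed.

Section Gauge.
Context {R : realType} {l : nat} (n : 'I_l -> nat) (p : 'I_l -> R).
Hypothesis hp : forall j, 0 < p j.
Local Notation N := (\sum_(j < l) n j)%N.
Implicit Types (w : 'rV[R[i]]_N) (t : R[i]).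

Definition gauge w : R := \sum_j vnorm (submxrow w j) `^ (2 * p j).

Let p20 j : 0 < 2 * p j.
Proof. by rewrite mulr_gt0. Qed.

Lemma one_powR (q : R) : 1 `^ q = 1.
Proof. by rewrite powR1. Qed.

Lemma submxrow_coord w j i : submxrow w j 0 i = w 0 (tagnat.Rank j i).
Proof. by rewrite mxE. Qed.

Lemma submxrowZ t w j : submxrow (t *: w) j = t *: submxrow w j.
Proof. by apply/rowP => i; rewrite !mxE. Qed.

Lemma submxrow_eq0 w : (forall j, submxrow w j = 0) -> w = 0.
Proof.
move=> H; rewrite -[w]submxrowK; apply/rowP => i; rewrite !mxE.
by have := congr1 (fun v : 'rV__ => v 0 (tagnat.sig2 i)) (H (tagnat.sig1 i)); rewrite !mxE.
Qed.

Lemma gauge_ge0 w : 0 <= gauge w.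
Proof. by apply: sumr_ge0 => j _; exact: powR_ge0. Qed.

Lemma gauge0 : gauge 0 = 0.
Proof.
rewrite /gauge big1// => j _; have -> : submxrow (0 : 'rV[R[i]]_N) j = 0.
  by apply/rowP => i; rewrite !mxE.
by rewrite vnorm0 powR0// (gt_eqF (p20 j)).
Qed.

Lemma block_gt0 w : w != 0 -> exists j, submxrow w j != 0.
Proof.
move=> w0; apply: contrapT => H; move/eqP: w0; apply; apply: submxrow_eq0 => j.
by apply/eqP; apply: contraT => wj; exfalso; apply: H; exists j.
Qed.

Lemma gauge_block w j : vnorm (submxrow w j) `^ (2 * p j) <= gauge w.
Proof. by rewrite /gauge (bigD1 j)//= lerDl sumr_ge0// => i _; exact: powR_ge0. Qed.

Lemma gauge_gt0 w : (0 < gauge w) = (w != 0).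
Proof.
apply/idP/idP => [|/block_gt0[j wj]].
  by apply: contraTneq => ->; rewrite gauge0 ltxx.
by apply: lt_le_trans (gauge_block w j); rewrite powR_gt0// vnorm_gt0.
Qed.

Lemma gaugeZ t w :
  gauge (t *: w) = \sum_j normc t `^ (2 * p j) * vnorm (submxrow w j) `^ (2 * p j).
Proof.
apply: eq_bigr => j _; rewrite submxrowZ vnormZ powRM ?vnorm_ge0//.
exact: normc_ge0.
Qed.

Lemma gauge_normc t t' w : normc t = normc t' -> gauge (t *: w) = gauge (t' *: w).
Proof. by move=> E; rewrite !gaugeZ E. Qed.

Lemma gauge_leZ t w : normc t <= 1 -> gauge (t *: w) <= gauge w.
Proof.
move=> t1; rewrite gaugeZ; apply: ler_sum => j _.
rewrite ler_piMl ?powR_ge0// -[leRHS](one_powR (2 * p j)).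
by apply: ge0_ler_powR; rewrite ?nnegrE ?normc_ge0// ltW.
Qed.

Lemma gauge_ltZ t w : normc t < 1 -> w != 0 -> gauge (t *: w) < gauge w.
Proof.
move=> t1 /block_gt0[j wj]; rewrite gaugeZ /gauge (bigD1 j)//= [ltRHS](bigD1 j)//=.
have tp i : normc t `^ (2 * p i) < 1.
  rewrite -[ltRHS](one_powR (2 * p i)); apply: gt0_ltr_powR; by rewrite ?nnegrE ?normc_ge0.
apply: ltr_leD.
  by rewrite gtr_pMl ?tp// powR_gt0// vnorm_gt0.
by apply: ler_sum => i _; rewrite ler_piMl ?powR_ge0// ltW.
Qed.

Lemma gauge_rcont (w : R[i] -> 'rV[R[i]]_N) t :
  (forall i, ccont (fun z => w z 0 i) t) -> rcont (fun z => gauge (w z)) t.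
Proof.
move=> cw; apply: rcont_sum => j; apply: powR_rcont => [//|z|]; first exact: vnorm_ge0.
apply: vnorm_rcont => i.
have -> : (fun z => submxrow (w z) j 0 i) = fun z => w z 0 (tagnat.Rank j i).
  by apply/funext => z; rewrite submxrow_coord.
exact: cw.
Qed.

Lemma gauge_ray_rcont w t : rcont (fun z => gauge (z *: w)) t.
Proof.
apply: gauge_rcont => i.
have -> : (fun z : R[i] => (z *: w) 0 i) = fun z => z * w 0 i.
  by apply/funext => z; rewrite mxE.
apply: ccontM; apply: cdiff_cont; [exact: cdiff_id|exact: cdiff_cst].
Qed.

(** This moves [w] along its ray to the boundary of the domain. The gauge is not homogeneous when
    the exponents differ, so the factor comes from the intermediate value theorem. *)
Lemma gauge_level w (c : R) : w != 0 -> 0 < c -> exists2 s : R, 0 < s & gauge (s%:C *: w) = c.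
Proof.
move=> w0 c0; have [j wj] := block_gt0 w0.
have vj : 0 < vnorm (submxrow w j) `^ (2 * p j) by rewrite powR_gt0// vnorm_gt0.
set a := vnorm (submxrow w j) `^ (2 * p j) in vj.
pose b := (c / a) `^ (2 * p j)^-1.
have b0 : 0 < b by rewrite powR_gt0// divr_gt0.
have fb : c <= gauge (b%:C *: w).
  apply: le_trans (gauge_block _ j); rewrite submxrowZ vnormZ normc_real gtr0_norm//.
  rewrite powRM ?vnorm_ge0 ?(ltW b0)// -/a /b -powRrM mulVf ?gt_eqF// powRr1 ?divfK ?gt_eqF//.
  by rewrite ltW// divr_gt0.
have cf : continuous (fun s : R => gauge (s%:C *: w)).
  apply: continuous_realP => x e e0; have [r r0 Hr] := gauge_ray_rcont w x%:C e0.
  exists r => // h hr; apply: Hr.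
  by rewrite -rmorphB addrAC subrr add0r normc_real.
have f0 : gauge ((0 : R)%:C *: w) = 0 by rewrite scale0r gauge0.
have [||s] := @IVT R (fun s : R => gauge (s%:C *: w)) 0 b c (ltW b0).
- exact: continuous_subspaceT.
- by rewrite f0 min_l ?gauge_ge0// max_r ?gauge_ge0// fb ltW.
rewrite in_itv /= => /andP[s0 _] E; exists s => //.
by rewrite lt_def s0 andbT; apply: contraTneq c0 => s_; rewrite -E s_ f0 ltxx.
Qed.

End Gauge.

(** * Invariance of the section w = 0 and a Schwarz lemma on its fibers *)

Section Automorphism.
Context {R : realType} {l n0 : nat} {n : 'I_l -> nat} {p : 'I_l -> R} {mu : R}.
Hypotheses (hn0 : (0 < n0)%N) (hp : forall j, 0 < p j) (hmu : 0 < mu).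
Local Notation N := (\sum_(j < l) n j)%N.
Local Notation E := ('rV[R[i]]_n0 * 'rV[R[i]]_N)%type.
Implicit Types (x : E) (z : 'rV[R[i]]_n0) (w : 'rV[R[i]]_N).

(** With the exponential moved to the left, the domain becomes a sublevel set of a function to which
    the maximum principle applies with [k = mu]. *)
Definition level z w : R := gauge p w * expR (mu * vnorm z ^+ 2).

Definition inD x := level x.1 x.2 < 1.

Lemma domainE x : (fbh_domain p mu : set (fbh_space R n0 n)) x <-> inD x.
Proof.
rewrite /fbh_domain /inD /level /= mulNr expRN hnormE.
have -> : \sum_(j < l) hnorm (submxrow x.2 j) `^ (2 * p j) = gauge p x.2.
  by apply: eq_bigr => j _; rewrite hnormE.
by rewrite -[X in _ < X]mul1r ltr_pdivlMr ?expR_gt0.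
Qed.

Lemma inD0 z : inD (z, 0).
Proof. by rewrite /inD /level gauge0// mul0r. Qed.

Lemma level_leZ z w (t : R[i]) : normc t < 1 -> level z w <= 1 -> inD (z, t *: w).
Proof.
move=> t1; have [->|w0] := eqVneq w 0; first by rewrite scaler0 inD0.
by apply: lt_le_trans; rewrite ltr_pM2r ?expR_gt0// gauge_ltZ.
Qed.

Lemma coord_submxrow w i :
  w 0 i = submxrow w (tagnat.sig1 i) 0 (tagnat.sig2 i).
Proof. by rewrite -{1}[w]submxrowK mxE. Qed.

Lemma inD_coord x i : inD x -> normc (x.2 0 i) <= 1.
Proof.
rewrite /inD /level => xD.
have g1 : gauge p x.2 < 1.
  apply: le_lt_trans xD; rewrite ler_peMr ?gauge_ge0// -expR0 ler_expR.
  by rewrite mulr_ge0 ?sqr_ge0// ltW.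
rewrite leNgt; apply/negP => gt1.
have : 1 < vnorm (submxrow x.2 (tagnat.sig1 i)) `^ (2 * p (tagnat.sig1 i)).
  rewrite -[ltLHS](one_powR (2 * p (tagnat.sig1 i))).
  apply: gt0_ltr_powR; rewrite ?nnegrE ?vnorm_ge0 ?mulr_gt0//.
  apply: (lt_le_trans gt1); have := vnorm_coord (submxrow x.2 (tagnat.sig1 i)) (tagnat.sig2 i).
  by rewrite -coord_submxrow.
by apply/negP; rewrite -leNgt; apply: le_trans (ltW g1); exact: gauge_block.
Qed.

Lemma gauge_lt_scale w (s : R) : w != 0 -> 0 < s -> gauge p w < gauge p (s%:C *: w) -> 1 < s.
Proof.
move=> w0 s0 lt; rewrite ltNge; apply/negP => s1.
have : gauge p (s%:C *: w) <= gauge p w.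
  by apply: gauge_leZ => //; rewrite normc_real gtr0_norm.
by rewrite leNgt lt.
Qed.

Lemma gauge_scale_lt w (s : R) : w != 0 -> 1 < s -> gauge p w < gauge p (s%:C *: w).
Proof.
move=> w0 s1; have s0 : 0 < s by apply: lt_trans s1.
have sn : s%:C != 0 :> R[i] by rewrite -normc_gt0 normc_real gtr0_norm.
have {1}-> : w = s^-1%:C *: (s%:C *: w).
  by rewrite scalerA -rmorphM mulVf ?gt_eqF// scale1r.
apply: gauge_ltZ => //; last by rewrite scaler_eq0 negb_or sn w0.
by rewrite normc_real gtr0_norm ?invr_gt0// invf_lt1.
Qed.

Section SelfMap.
Variable f : E -> E.
Hypothesis fD : forall x, inD x -> inD (f x).
Hypothesis hf : forall x, inD x -> differentiable f x.

Lemma line0 z (t : R[i]) : (0, 0) + t *: (z, 0) = (t *: z, 0) :> E.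
Proof. by rewrite -[LHS]/(0 + t *: z, 0 + t *: 0) scaler0 !add0r. Qed.

Lemma lineD z w (t : R[i]) : (z, 0) + t *: (0, w) = (z, t *: w) :> E.
Proof. by rewrite -[LHS]/(z + t *: 0, 0 + t *: w) scaler0 addr0 add0r. Qed.

Lemma cdiff_line0 c z t : coordinate c -> cdiff (fun t => c (f (t *: z, 0))) t.
Proof.
move=> cc; have -> : (fun t => c (f (t *: z, 0))) = fun t => c (f ((0, 0) + t *: (z, 0))).
  by apply/funext => s; rewrite line0.
apply: (coordinate_cdiff (f := f) cc); apply: hf; rewrite line0; exact: inD0.
Qed.

Lemma zero_section_const z : (f (z, 0)).2 = (f (0, 0)).2.
Proof.
apply/rowP => i; have cc : coordinate (fun y : E => y.2 0 i) by right; exists i.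
have := @liouville R (fun t => (f (t *: z, 0)).2 0 i) 1 (fun t => cdiff_line0 z t cc).
move=> /(_ _ 1); rewrite scale1r scale0r; apply => t.
by apply: inD_coord; apply: fD; exact: inD0.
Qed.

(** If the constant w-component were nonzero, the defining inequality would bound the z-component
    too. Liouville's theorem would then make [f] constant on w = 0, against injectivity. *)
Lemma zero_section : (forall x y, inD x -> inD y -> f x = f y -> x = y) ->
  forall z, (f (z, 0)).2 = 0.
Proof.
move=> finj z; rewrite zero_section_const; set c := (f (0, 0)).2.
apply/eqP; apply: contraT => c0; exfalso.
have g0 : 0 < gauge p c by rewrite gauge_gt0.
(* From [mu * b <= expR (mu * b) < (gauge p c)^-1] for the squared norm [b]. Below,
   [x <= x ^+ 2 + 1] turns this into a bound on each coordinate. *)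
pose M := (gauge p c)^-1 / mu + 1.
have bd y : vnorm (f (y, 0)).1 ^+ 2 <= M.
  have := fD (inD0 y); rewrite /inD /level zero_section_const -/c.
  set b := vnorm _ ^+ 2; rewrite mulrC -ltr_pdivlMr// mul1r => H.
  have := expR_ge1Dx (mu * b) => H'.
  have : b <= (gauge p c)^-1 / mu by rewrite ler_pdivlMr// [_ * mu]mulrC; lra.
  by rewrite /M => h; lra.
pose z1 : 'rV[R[i]]_n0 := const_mx 1.
have eq1 : f (z1, 0) = f (0, 0).
  apply/eqP; rewrite -pair_eqE /= zero_section_const eqxx andbT; apply/eqP/rowP => i.
  have cc : coordinate (fun y : E => y.1 0 i) by left; exists i.
  have M0 : 0 <= M by apply: le_trans (bd 0); rewrite sqr_ge0.
  have := @liouville R (fun t => (f (t *: z1, 0)).1 0 i) (M + 1) (fun t => cdiff_line0 z1 t cc).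
  move=> /(_ _ 1); rewrite scale1r scale0r; apply => t.
  apply: (le_trans (vnorm_coord _ i)); have := bd (t *: z1).
  set b := vnorm _; have := sqr_ge0 (b - 1); rewrite sqrrB expr1n => h1 h2.
  have := sqr_ge0 (b + 1); nra.
have := finj _ _ (inD0 z1) (inD0 0) eq1 => -[] /rowP /(_ (Ordinal hn0)).
by rewrite !mxE => /eqP; rewrite oner_eq0.
Qed.

Hypothesis f0 : forall z, (f (z, 0)).2 = 0.

Definition fiber_diff z w : 'rV[R[i]]_N := ('d f (z, 0) (0, w)).2.

Lemma fiber_diffZ z w t : fiber_diff z (t *: w) = t *: fiber_diff z w.
Proof.
rewrite /fiber_diff; have -> : (0, t *: w) = t *: (0, w) :> E.
  by rewrite -[RHS]/(t *: 0, t *: w) scaler0.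
by rewrite linearZ.
Qed.

Lemma fiber_diff0 z : fiber_diff z 0 = 0.
Proof. by have := fiber_diffZ z 0 0; rewrite !scale0r. Qed.

Lemma fiber_diffD z w w' : fiber_diff z (w + w') = fiber_diff z w + fiber_diff z w'.
Proof.
rewrite /fiber_diff; have -> : (0, w + w') = (0, w) + (0, w') :> E.
  by rewrite -[RHS]/(0 + 0, w + w') addr0.
by rewrite linearD.
Qed.

Definition fiber_quotient z w (t : R[i]) : 'rV[R[i]]_N :=
  if t == 0 then fiber_diff z w else t^-1 *: (f (z, t *: w)).2.

Lemma fiber_quotient_coord z w t i : fiber_quotient z w t 0 i =
  quotient (fun t => (f ((z, 0) + t *: (0, w))).2 0 i) (fiber_diff z w 0 i) t.
Proof.
rewrite /fiber_quotient /quotient; case: eqP => // _.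
by rewrite lineD mxE mulrC.
Qed.

Lemma fiber_quotient_pholo z w t i : level z w <= 1 -> normc t < 1 ->
  pholo (fun t => fiber_quotient z w t 0 i) t.
Proof.
move=> zw t1; have cc : coordinate (fun y : E => y.2 0 i) by right; exists i.
have -> : (fun t => fiber_quotient z w t 0 i) =
    quotient (fun t => (f ((z, 0) + t *: (0, w))).2 0 i) (fiber_diff z w 0 i).
  by apply/funext => s; rewrite fiber_quotient_coord.
apply: (@quotient_pholo R _ _ 1) => //.
- by rewrite scale0r addr0 f0 mxE.
- move=> s s1; apply: (coordinate_cdiff (f := f) cc); apply: hf.
  by rewrite lineD; exact: level_leZ.
- move=> e e0; have [r r0 Hr] := coordinate_expand (0, w) cc (hf (inD0 z)) e0.
  by exists r => // h /Hr; rewrite scale0r addr0 add0r.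
Qed.

Lemma fiber_base_pholo z w t i : level z w <= 1 -> normc t < 1 ->
  pholo (fun t => (f (z, t *: w)).1 0 i) t.
Proof.
move=> zw t1; have cc : coordinate (fun y : E => y.1 0 i) by left; exists i.
have -> : (fun t => (f (z, t *: w)).1 0 i) = fun t => (f ((z, 0) + t *: (0, w))).1 0 i.
  by apply/funext => s; rewrite lineD.
apply: cdiff_pholo.
have d0 : 0 < 1 - normc t by rewrite subr_gt0.
apply: cnear_sub (rcont_normc t d0) => s; rewrite ltr_norml => /andP[_ s1].
apply: (coordinate_cdiff (f := f) cc); apply: hf; rewrite lineD.
by apply: level_leZ => //; lra.
Qed.

(** A Schwarz lemma. On the circle of radius [r], [r] times the quotient differs from the
    w-component of [f (z, s w)] by a unimodular factor, so its level is below 1 there, and inside by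
    the maximum principle. The factor [r] cannot be pulled out of the gauge and is removed by
    letting [r] tend to 1. *)
Lemma fiber_quotient_level z w t : level z w <= 1 -> normc t < 1 ->
  level (f (z, t *: w)).1 (fiber_quotient z w t) <= 1.
Proof.
move=> zw t1.
have step (r : R) : normc t <= r -> 0 < r -> r < 1 ->
    level (f (z, t *: w)).1 (r%:C *: fiber_quotient z w t) <= 1.
  move=> tr r0 r1.
  apply: (@maximum_principle R l n0 n p hp
    (fun j s => submxrow (r%:C *: fiber_quotient z w s) j) (fun s => (f (z, s *: w)).1)
    mu 1 hmu _ _ r 1 r0 r1 _ t tr).
  - move=> s s1 j i.
    have -> : (fun s => submxrow (r%:C *: fiber_quotient z w s) j 0 i) =
        fun s => r%:C * fiber_quotient z w s 0 (tagnat.Rank j i).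
      by apply/funext => s'; rewrite submxrow_coord mxE.
    by apply: pholoM; [exact: pholo_cst|exact: fiber_quotient_pholo].
  - by move=> s s1 i; exact: fiber_base_pholo.
  move=> s sr; have s0 : s != 0 by rewrite -normc_gt0 sr.
  have s1 : normc s < 1 by rewrite sr.
  have := fD (level_leZ s1 zw); rewrite /inD => /ltW; apply: le_trans.
  rewrite ler_pM2r ?expR_gt0// /fiber_quotient (negPf s0) scalerA.
  apply: le_trans (_ : gauge p (1 *: (f (z, s *: w)).2) <= _); last by rewrite scale1r.
  rewrite le_eqVlt; apply/orP; left; apply/eqP; apply: gauge_normc => //.
  rewrite Normc.normcM Normc.normcV normc_real gtr0_norm// sr mulfV ?gt_eqF//.
  by rewrite Normc.normc1.
rewrite leNgt; apply/negP => gt1.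
(* [L] is continuous at 1 and at most 1 at real points [r < 1] close to 1. *)
pose L (s : R[i]) := gauge p (s *: fiber_quotient z w t) * expR (mu * vnorm (f (z, t *: w)).1 ^+ 2).
have cL : rcont L 1.
  by apply: rcontM; [exact: gauge_ray_rcont|exact: rcont_cst].
have d0 : 0 < L 1 - 1 by rewrite /L scale1r subr_gt0.
have [e e0 He] := cL _ d0.
pose r := Num.max ((normc t + 1) / 2) (1 - e / 2).
have r1 : r < 1 by rewrite /r gt_max; apply/andP; split; lra.
have rt : normc t <= r by rewrite /r le_max; apply/orP; left; lra.
have r0 : 0 < r by rewrite /r lt_max; apply/orP; left; have := normc_ge0 t; lra.
have re : 1 - e / 2 <= r by rewrite /r le_max lexx orbT.
have := He r%:C; rewrite -rmorphB normc_real ler0_norm; last by lra.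
rewrite opprB => H; have : 1 - r < e by lra.
move/H; rewrite ltr_norml => /andP[h _].
have K : L r%:C <= 1 by exact: step.
by move: h K; clear; move: (L _) (L _) => a b h K; lra.
Qed.

Lemma fiber_diff_level z w : level z w <= 1 -> level (f (z, 0)).1 (fiber_diff z w) <= 1.
Proof.
move=> zw; have t0 : normc (0 : R[i]) < 1 by rewrite Normc.normc0.
by have := fiber_quotient_level zw t0; rewrite scale0r /fiber_quotient eqxx.
Qed.

End SelfMap.

End Automorphism.

Arguments level {R l n0 n} p mu z w.
Arguments inD {R l n0 n} p mu x.

Section OpenDomain.
Context {R : realType}.

Lemma lipschitz_continuous (V : normedModType R[i]) (F : V -> R) (c : R) : 0 < c ->
  (forall x y, F x - F y <= c * Re `|x - y|) -> continuous F.
Proof.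
move=> c0 H x; apply/cvgrPdist_lt => e e0; apply/nbhs_ballP.
have ec0 : 0 < e / c by rewrite divr_gt0.
exists (e / c)%:C; first by rewrite /= (ltcR 0).
move=> y; rewrite -ball_normE /= => xy.
have {}xy : Re `|x - y| < e / c by move: xy; rewrite ltcE => /andP[_].
have {}xy : c * Re `|x - y| < e by rewrite mulrC -ltr_pdivlMr.
rewrite ltr_norml; apply/andP; split; last exact: le_lt_trans (H x y) xy.
have := H y x; rewrite distrC => h; lra.
Qed.

Lemma continuous_fun_powR (T : topologicalType) (F : T -> R) (q : R) :
  0 < q -> (forall x, 0 <= F x) -> continuous F -> continuous (fun x => F x `^ q).
Proof.
move=> q0 F0 cF x; have [Fx|Fx] := eqVneq (F x) 0; last first.
  apply: (@continuous_comp _ _ _ F (fun y => y `^ q) x (cF x)); have Fx0 : 0 < F x by rewrite lt_def Fx F0.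
  have [dq _] := is_derive1_powR q Fx0.
  exact/differentiable_continuous/derivable1_diffP.
apply/cvgrPdist_lt => e e0; have d0 : 0 < e `^ q^-1 by rewrite powR_gt0.
have /cvgrPdist_lt/(_ _ d0) := cF x; apply: filterS => y.
rewrite Fx powR0 ?gt_eqF// !sub0r !normrN !ger0_norm ?powR_ge0// => H.
have -> : e = (e `^ q^-1) `^ q by rewrite -powRrM mulVf ?gt_eqF// powRr1// ltW.
by apply: gt0_ltr_powR; rewrite ?nnegrE ?powR_ge0.
Qed.

Lemma continuous_fun_sum (T : topologicalType) (I : Type) (r : seq I) (F : I -> T -> R) :
  (forall i, continuous (F i)) -> continuous (fun x => \sum_(i <- r) F i x).
Proof.
move=> cF; elim: r => [|i r IH].
  have -> : (fun x => \sum_(i <- [::]) F i x) = fun=> 0.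
    by apply/funext => x; rewrite big_nil.
  by move=> x; exact: cst_continuous.
have -> : (fun x => \sum_(j <- i :: r) F j x) = fun x => F i x + \sum_(j <- r) F j x.
  by apply/funext => x; rewrite big_cons.
by move=> x; apply: continuousD; [exact: cF|exact: IH].
Qed.

Lemma vnorm_le_sum k (y : 'rV[R[i]]_k) : vnorm y <= \sum_i normc (y 0 i).
Proof.
have S0 : 0 <= \sum_i normc (y 0 i) by apply: sumr_ge0 => i _; exact: normc_ge0.
rewrite -(@ler_pXn2r _ 2)// ?nnegrE ?vnorm_ge0// vnorm_sqr expr2 mulr_suml.
apply: ler_sum => i _; rewrite expr2 ler_wpM2l ?normc_ge0//.
by rewrite (bigD1 i)//= lerDl sumr_ge0// => j _; exact: normc_ge0.
Qed.

Lemma vnorm_sub_le k (y z : 'rV[R[i]]_k) : vnorm y - vnorm z <= vnorm (y - z).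
Proof. by rewrite lerBlDr -{1}(subrK z y) vnorm_triangle. Qed.

Context {l n0 : nat} {n : 'I_l -> nat} {p : 'I_l -> R} {mu : R}.
Hypothesis hp : forall j, 0 < p j.
Local Notation N := (\sum_(j < l) n j)%N.
Local Notation E := ('rV[R[i]]_n0 * 'rV[R[i]]_N)%type.

Lemma Re_coordinate_norm (c : E -> R[i]) (y : E) : coordinate c -> normc (c y) <= Re `|y|.
Proof. by move=> cc; have := coordinate_norm y cc; rewrite lecE => /andP[_]. Qed.

(** Identities between maps hold only on the domain; openness lets them pass to differentials. *)
Lemma inD_open : open (inD p mu : set E).
Proof.
have -> : (inD p mu : set E) = (fun x : E => level p mu x.1 x.2) @^-1` [set r | r < 1] by [].
apply: open_comp; last exact: open_lt.
move=> x _.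
rewrite /level /gauge; apply: (@continuousM R E (fun x => \sum_j vnorm (submxrow x.2 j) `^ (2 * p j))
  (fun x => expR (mu * vnorm x.1 ^+ 2))).
  apply: continuous_fun_sum => j; apply: continuous_fun_powR.
  - by rewrite mulr_gt0.
  - by move=> y; exact: vnorm_ge0.
  have c0 : 0 < (n j)%:R + 1 :> R by rewrite ltr_wpDl.
  apply: (lipschitz_continuous c0) => y z; apply: (le_trans (vnorm_sub_le _ _)).
  apply: (le_trans (vnorm_le_sum _)).
  have Re0 : 0 <= Re `|y - z|.
    by have := normr_ge0 (y - z); rewrite lecE => /andP[_].
  rewrite mulrDl mul1r; apply: ler_wpDr => //; rewrite mulr_natl.
  rewrite -[X in _ *+ X]card_ord -sumr_const; apply: ler_sum => i _.
  rewrite !mxE; have cc : coordinate (fun y : E => y.2 0 (tagnat.Rank j i)) by right; exists (tagnat.Rank j i).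
  by have := Re_coordinate_norm (y - z) cc; rewrite !mxE.
have cZ : continuous (fun x : E => vnorm x.1).
  have c0 : 0 < n0%:R + 1 :> R by rewrite ltr_wpDl.
  apply: (lipschitz_continuous c0) => y z; apply: (le_trans (vnorm_sub_le _ _)).
  apply: (le_trans (vnorm_le_sum _)).
  have Re0 : 0 <= Re `|y - z|.
    by have := normr_ge0 (y - z); rewrite lecE => /andP[_].
  rewrite mulrDl mul1r; apply: ler_wpDr => //; rewrite mulr_natl.
  rewrite -[X in _ *+ X]card_ord -sumr_const; apply: ler_sum => i _.
  have cc : coordinate (fun y : E => y.1 0 i) by left; exists i.
  by have := Re_coordinate_norm (y - z) cc.
apply: (@continuous_comp _ _ _ (fun x : E => mu * vnorm x.1 ^+ 2) expR); last exact: continuous_expR.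
apply: (@continuousM R E (fun=> mu) (fun x => vnorm x.1 ^+ 2)); first exact: cst_continuous.
exact: (@continuousM R E (fun x => vnorm x.1) (fun x => vnorm x.1) x (cZ x) (cZ x)).
Qed.

End OpenDomain.

Section AutomorphismPair.
Context {R : realType} {l n0 : nat} {n : 'I_l -> nat} {p : 'I_l -> R} {mu : R}.
Hypotheses (hn0 : (0 < n0)%N) (hp : forall j, 0 < p j) (hmu : 0 < mu).
Local Notation N := (\sum_(j < l) n j)%N.
Local Notation E := ('rV[R[i]]_n0 * 'rV[R[i]]_N)%type.
Local Notation D := (inD p mu : set E).
Implicit Types (x : E) (z : 'rV[R[i]]_n0) (w : 'rV[R[i]]_N) (f g : E -> E).

Definition holo_map f := (forall x, D x -> D (f x)) /\ (forall x, D x -> differentiable f x).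

Definition holo_pair f g := [/\ holo_map f, holo_map g,
  forall x, D x -> g (f x) = x & forall x, D x -> f (g x) = x].

Lemma holo_pair_sym f g : holo_pair f g -> holo_pair g f.
Proof. by case. Qed.

Lemma aut_zero_section f g z : holo_pair f g -> (f (z, 0)).2 = 0.
Proof.
move=> [[fD df] _ gfK _]; apply: (zero_section hn0 hp hmu fD df) => x y xD yD E.
by rewrite -(gfK x xD) -(gfK y yD) E.
Qed.

Lemma aut_base_section f g z : holo_pair f g -> f (z, 0) = ((f (z, 0)).1, 0).
Proof. by move=> fg; rewrite [LHS]surjective_pairing (aut_zero_section z fg). Qed.

Lemma aut_baseK f g z : holo_pair f g -> (g ((f (z, 0)).1, 0)).1 = z.
Proof.
move=> fg; rewrite -(aut_base_section z fg); case: fg => _ _ gfK _.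
by rewrite gfK//; exact: inD0.
Qed.

Lemma diff_cancel f g x d : holo_pair f g -> D x -> 'd g (f x) ('d f x d) = d.
Proof.
move=> [[fD df] [gD dg] gfK fgK] xD.
have dfx := df x xD; have dgx := dg _ (fD x xD).
have dgf := @differentiable_comp _ E E E f g x dfx dgx.
have <- : 'd (g \o f) x d = 'd g (f x) ('d f x d).
  exact: (congr1 (fun k : E -> E => k d) (@diff_comp _ E E E f g x dfx dgx)).
rewrite -(@deriveE _ _ _ _ _ d dgf); have -> : 'D_d (g \o f) x = 'D_d id x.
  apply: near_eq_derive; have := open_nbhs_nbhs (conj (inD_open hp) xD).
  by apply: filterS => y yD; exact: gfK.
by rewrite derive_id.
Qed.

Lemma diff_zero_section f g z z' : holo_pair f g -> ('d f (z, 0) (z', 0)).2 = 0.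
Proof.
move=> fg; have [[fD df] _ _ _] := fg.
apply/rowP => i; rewrite [RHS]mxE.
have cc : coordinate (fun y : E => y.2 0 i) by right; exists i.
apply/eqP; rewrite -[_ == 0]negbK -normc_gt0; apply/negP => d0.
set d := _ 0 i in d0; have d20 : 0 < normc d / 2 by rewrite divr_gt0.
have [r r0 Hr] := coordinate_expand (z', 0) cc (df _ (inD0 hp z)) d20.
have := Hr (r / 2)%:C; rewrite normc_real gtr0_norm ?divr_gt0//.
have -> : (z, 0) + (r / 2)%:C *: (z', 0) = (z + (r / 2)%:C *: z', 0) :> E.
  by rewrite -[LHS]/(z + (r / 2)%:C *: z', 0 + (r / 2)%:C *: 0) scaler0 addr0.
rewrite !(aut_zero_section _ fg) !mxE subrr sub0r normcN Normc.normcM -/d.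
rewrite normc_real gtr0_norm ?divr_gt0// ler_pM2r ?divr_gt0// => H.
have : r / 2 < r by lra.
by move/H; rewrite leNgt ltr_pdivrMr// ltr_pMr// ltr1n.
Qed.

(** The differentials of [f] and [g] preserve the tangent directions of w = 0, so they are block
    triangular, and their w-blocks are inverse to each other. *)
Lemma fiber_diffK f g z w : holo_pair f g ->
  fiber_diff g (f (z, 0)).1 (fiber_diff f z w) = w.
Proof.
move=> fg; have gf := holo_pair_sym fg.
pose y : E := 'd f (z, 0) (0, w); pose x : E := ((f (z, 0)).1, 0).
have xE : x = f (z, 0) := esym (aut_base_section z fg).
have H : 'd g x y = (0, w).
  by rewrite xE; exact: (diff_cancel (0, w) fg (inD0 hp z)).
have E1 : y = (y.1, 0) + (0, y.2).
  by rewrite -[RHS]/(y.1 + 0, 0 + y.2) addr0 add0r -surjective_pairing.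
have E2 : 'd g x y = 'd g x (y.1, 0) + 'd g x (0, y.2).
  by rewrite -linearD -E1.
have E3 : ('d g x y).2 = ('d g x (y.1, 0)).2 + ('d g x (0, y.2)).2 by rewrite E2.
by rewrite H (diff_zero_section _ _ gf) add0r /= in E3; rewrite /fiber_diff -E3.
Qed.

Lemma fiber_diff_neq0 f g z w : holo_pair f g -> w != 0 -> fiber_diff f z w != 0.
Proof.
move=> fg; apply: contraNneq => E; rewrite -(fiber_diffK z w fg) E.
by rewrite fiber_diff0.
Qed.

(** If the level of the image were below 1, the image could be stretched by some [s > 1] to level 1.
    The Schwarz lemma for [g] would then give [s w] a level at most 1, although [w] already has
    level 1. *)
Lemma fiber_diff_level1 f g z w : holo_pair f g -> level p mu z w = 1 ->
  level p mu (f (z, 0)).1 (fiber_diff f z w) = 1.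
Proof.
move=> fg zw; have [[fD df] [gD dg] _ _] := fg; have gf := holo_pair_sym fg.
have zw1 : level p mu z w <= 1 by rewrite zw.
have w0 : w != 0.
  by apply: contra_eq_neq zw => ->; rewrite /level gauge0// mul0r eq_sym oner_eq0.
set w' := fiber_diff f z w; set z' := (f (z, 0)).1.
have w'0 : w' != 0 by apply: fiber_diff_neq0 fg w0.
have le1 : level p mu z' w' <= 1.
  exact: (fiber_diff_level hp hmu fD df (fun z => aut_zero_section z fg) zw1).
apply/eqP; rewrite eq_le le1 leNgt; apply/negP => lt1.
have [s s0 sE] := @gauge_level R l n p hp w' _ w'0 (expR_gt0 (- (mu * vnorm z' ^+ 2))).
have sl : level p mu z' (s%:C *: w') = 1 by rewrite /level sE -expRD addNr expR0.
have s1 : 1 < s.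
  apply: (gauge_lt_scale hp w'0 s0); rewrite sE.
  by move: lt1; rewrite /level -ltr_pdivlMr ?expR_gt0// mul1r -expRN.
have sl1 : level p mu z' (s%:C *: w') <= 1 by rewrite sl.
have := fiber_diff_level hp hmu gD dg (fun z => aut_zero_section z gf) sl1.
rewrite fiber_diffZ (fiber_diffK z w fg) (aut_baseK z fg).
have := gauge_scale_lt hp w0 s1; rewrite -(ltr_pM2r (expR_gt0 (mu * vnorm z ^+ 2))).
by rewrite -/(level p mu z w) zw ltNge => /negP.
Qed.

(** On the disc through [w1], the boundary point of the ray of [w], the level of the quotient is at
    most 1 and equals 1 at the center. Hence the quotient and the z-component are constant along the
    disc, which contains [w = s^-1 w1]. *)
Lemma aut_fiber_form f g z w : holo_pair f g -> D (z, w) ->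
  f (z, w) = ((f (z, 0)).1, fiber_diff f z w).
Proof.
move=> fg zwD; have [[fD df] _ _ _] := fg.
have f0 z' := aut_zero_section z' fg.
have [->|w0] := eqVneq w 0.
  rewrite {1}(aut_base_section z fg); congr pair.
  by rewrite fiber_diff0.
have [s s0 sE] := @gauge_level R l n p hp w _ w0 (expR_gt0 (- (mu * vnorm z ^+ 2))).
have s1 : 1 < s.
  apply: (gauge_lt_scale hp w0 s0); rewrite sE.
  by move: zwD; rewrite /inD /level /= -ltr_pdivlMr ?expR_gt0// mul1r -expRN.
set w1 := s%:C *: w.
have l1 : level p mu z w1 = 1 by rewrite /level sE -expRD addNr expR0.
have l1' : level p mu z w1 <= 1 by rewrite l1.
have [] := @maximum_at_center R l n0 n p hp
    (fun j t => submxrow (fiber_quotient f z w1 t) j) (fun t => (f (z, t *: w1)).1)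
    mu 1 hmu _ _ _ _ (s^-1)%:C.
- move=> t t1 j i.
  have -> : (fun t => submxrow (fiber_quotient f z w1 t) j 0 i) =
      fun t => fiber_quotient f z w1 t 0 (tagnat.Rank j i).
    by apply/funext => t'; rewrite submxrow_coord.
  exact: (fiber_quotient_pholo hp df f0).
- by move=> t t1 i; exact: (fiber_base_pholo hp df).
- rewrite -/(gauge p (fiber_quotient f z w1 0)) /fiber_quotient eqxx gauge_gt0//.
  apply: fiber_diff_neq0 fg _; rewrite scaler_eq0 negb_or w0 andbT.
  by rewrite -normc_gt0 normc_real gtr0_norm.
- move=> t t1; apply: le_trans (fiber_quotient_level hp hmu fD df f0 l1' t1) _.
  rewrite le_eqVlt; apply/orP; left; apply/eqP; rewrite scale0r.
  by rewrite /fiber_quotient eqxx; exact: (esym (fiber_diff_level1 fg l1)).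
- by rewrite normc_real gtr0_norm ?invr_gt0// invf_lt1.
move=> HW HZ.
have sn : (s^-1)%:C != 0 :> R[i] by rewrite -normc_gt0 normc_real gtr0_norm ?invr_gt0.
have wE : (s^-1)%:C *: w1 = w by rewrite scalerA -rmorphM mulVf ?gt_eqF// scale1r.
have {HW} HQ : fiber_quotient f z w1 (s^-1)%:C = fiber_diff f z w1.
  rewrite -[LHS]submxrowK -[RHS]submxrowK; apply: eq_mxrow => j.
  by rewrite HW /fiber_quotient eqxx.
move: HZ; rewrite wE scale0r => HZ; rewrite -HZ.
move: HQ; rewrite /fiber_quotient (negPf sn) wE => /(congr1 (fun v => (s^-1)%:C *: v)).
rewrite scalerA mulfV// scale1r -fiber_diffZ wE => <-.
by rewrite -surjective_pairing.
Qed.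

End AutomorphismPair.

(** * Automorphisms fixing the origin *)

Section NormalizedAutomorphism.
Context {R : realType} {l n0 : nat} {n : 'I_l -> nat} {p : 'I_l -> R} {mu : R}.
Hypotheses (hl : (0 < l)%N) (hn0 : (0 < n0)%N) (hn : forall j, (0 < n j)%N).
Hypotheses (hp : forall j, 0 < p j) (hmu : 0 < mu).
Local Notation N := (\sum_(j < l) n j)%N.
Local Notation E := ('rV[R[i]]_n0 * 'rV[R[i]]_N)%type.
Local Notation D := (inD p mu : set E).
Implicit Types (x : E) (z : 'rV[R[i]]_n0) (w : 'rV[R[i]]_N) (f g : E -> E).

(** Once [w] is shrunk by a factor [s] that serves for all parameters near [t], [fiber_diff] is the
    w-component of [f] itself divided by [s], and so is holomorphic in the parameter. *)
Lemma fiber_diff_cdiff f g z w t i : holo_pair (p := p) (mu := mu) f g ->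
  cdiff (fun t => fiber_diff f (t *: z) w 0 i) t.
Proof.
move=> fg; have [[fD df] _ _ _] := fg.
have [->|w0] := eqVneq w 0.
  have -> : (fun t => fiber_diff f (t *: z) 0 0 i) = fun=> 0.
    by apply/funext => s; rewrite fiber_diff0 mxE.
  exact: cdiff_cst.
pose b := (normc t + 1) * vnorm z.
have b0 : 0 <= b by rewrite mulr_ge0 ?vnorm_ge0// addr_ge0// normc_ge0.
(* The summand -1 leaves the level at most [expR (-1)] as long as the z-part has norm at most
   [b]. *)
have [s s0 sE] := @gauge_level R l n p hp w _ w0 (expR_gt0 (- (mu * b ^+ 2) - 1)).
have sn : s%:C != 0 :> R[i] by rewrite -normc_gt0 normc_real gtr0_norm.
have inDs t' : normc t' < normc t + 1 -> D (t' *: z, s%:C *: w).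
  move=> t't; rewrite /inD /level /= sE -expRD -[X in _ < X]expR0 ltr_expR.
  have : mu * vnorm (t' *: z) ^+ 2 <= mu * b ^+ 2.
    rewrite ler_pM2l// ler_pXn2r ?nnegrE ?vnorm_ge0// vnormZ ler_wpM2r ?vnorm_ge0//.
    exact: ltW.
  by move: (mu * _) (mu * _) => u v uv; lra.
have cc : coordinate (fun y : E => y.2 0 i) by right; exists i.
have lineE t' : (0, s%:C *: w) + t' *: (z, 0) = (t' *: z, s%:C *: w) :> E.
  by rewrite -[LHS]/(0 + t' *: z, s%:C *: w + t' *: 0) scaler0 addr0 add0r.
have FE t' : normc t' < normc t + 1 -> fiber_diff f (t' *: z) w 0 i =
    (f ((0, s%:C *: w) + t' *: (z, 0))).2 0 i * s%:C^-1.
  move=> t't; rewrite lineE (aut_fiber_form hn0 hp hmu fg (inDs _ t't)) /= fiber_diffZ.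
  by rewrite mxE mulrAC mulfV// mul1r.
apply: (@cdiff_eq_near R _ (fun t' => (f ((0, s%:C *: w) + t' *: (z, 0))).2 0 i * s%:C^-1) t 1 ltr01).
  move=> t' tt'; apply: FE; rewrite -[t'](subrK t) addrC.
  by apply: le_lt_trans (le_normcD _ _) _; rewrite ltrD2l.
apply: cdiffM; last exact: cdiff_cst.
apply: (coordinate_cdiff (f := f) cc); apply: df; rewrite lineE; apply: inDs.
by rewrite ltrDl.
Qed.

Definition base_diff f z : 'rV[R[i]]_n0 := ('d f (0, 0) (z, 0)).1.

Lemma base_diffZ f z t : base_diff f (t *: z) = t *: base_diff f z.
Proof.
rewrite /base_diff; have -> : (t *: z, 0) = t *: (z, 0) :> E.
  by rewrite -[RHS]/(t *: z, t *: 0) scaler0.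
by rewrite linearZ.
Qed.

Lemma base_diffD f z z' : base_diff f (z + z') = base_diff f z + base_diff f z'.
Proof.
rewrite /base_diff; have -> : (z + z', 0) = (z, 0) + (z', 0) :> E.
  by rewrite -[RHS]/(z + z', 0 + 0) addr0.
by rewrite linearD.
Qed.

Definition base_quotient f z (t : R[i]) : 'rV[R[i]]_n0 :=
  if t == 0 then base_diff f z else t^-1 *: (f (t *: z, 0)).1.

Lemma base_quotient_pholo f g z t i : holo_pair (p := p) (mu := mu) f g ->
  f (0, 0) = (0, 0) -> pholo (fun t => base_quotient f z t 0 i) t.
Proof.
move=> fg f00; have [[fD df] _ _ _] := fg.
have cc : coordinate (fun y : E => y.1 0 i) by left; exists i.
have -> : (fun t => base_quotient f z t 0 i) =
    quotient (fun t => (f (t *: z, 0)).1 0 i) (base_diff f z 0 i).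
  apply/funext => s; rewrite /base_quotient /quotient; case: eqP => // _.
  by rewrite mxE mulrC.
apply: (@quotient_pholo R _ _ (normc t + 1)).
- by rewrite ltr_wpDl// normc_ge0.
- by rewrite scale0r f00 mxE.
- by move=> s _; exact: (cdiff_line0 hp df z s cc).
- move=> e e0; have [r r0 Hr] := coordinate_expand (z, 0) cc (df _ (inD0 hp 0)) e0.
  by exists r => // h /Hr; rewrite line0 add0r scale0r.
- by rewrite ltrDl.
Qed.

Lemma base_quotient_scale f z t : f (0, 0) = (0, 0) ->
  (f (t *: z, 0)).1 = t *: base_quotient f z t.
Proof.
move=> f00; rewrite /base_quotient; case: eqP => [->|/eqP t0].
  by rewrite !scale0r f00.
by rewrite scalerA mulfV// scale1r.
Qed.

(* The functions of [t] below are holomorphic; on [normc t = r] the left-hand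
   side is the level of [f] at a boundary point. *)
Lemma growth f g z w (r : R) t : holo_pair (p := p) (mu := mu) f g ->
  f (0, 0) = (0, 0) -> vnorm z = 1 -> 0 < r ->
  gauge p w = expR (- (mu * r ^+ 2)) -> normc t <= r ->
  gauge p (fiber_diff f (t *: z) w) *
    expR (mu * r ^+ 2 * vnorm (base_quotient f z t) ^+ 2) <= 1.
Proof.
move=> fg f00 z1 r0 wE tr.
have k0 : 0 < mu * r ^+ 2 by rewrite mulr_gt0// exprn_gt0.
apply: (@maximum_principle R l n0 n p hp
    (fun j t => submxrow (fiber_diff f (t *: z) w) j) (base_quotient f z)
    (mu * r ^+ 2) (r + 1) k0 _ _ r 1 r0 _ _ t tr).
- move=> s _ j i; have -> : (fun t => submxrow (fiber_diff f (t *: z) w) j 0 i) =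
      fun t => fiber_diff f (t *: z) w 0 (tagnat.Rank j i).
    by apply/funext => s'; rewrite submxrow_coord.
  by apply: cdiff_pholo; exists 1 => // s' _; exact: (fiber_diff_cdiff _ _ _ _ fg).
- by move=> s _ i; exact: base_quotient_pholo fg f00.
- by rewrite ltrDl.
move=> s sr; have l1 : level p mu (s *: z) w = 1.
  by rewrite /level vnormZ sr z1 mulr1 wE -expRD addNr expR0.
have := fiber_diff_level1 hn0 hp hmu fg l1.
rewrite /level (base_quotient_scale _ _ f00) vnormZ sr exprMn mulrA => ->.
exact: lexx.
Qed.

(* If the quotient had norm [q > 1], then [growth] would bound
   [expR (mu * r ^+ 2 * (q ^+ 2 - 1))] uniformly in [r]. *)
Lemma base_norm_le f g z : holo_pair (p := p) (mu := mu) f g ->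
  f (0, 0) = (0, 0) -> vnorm (f (z, 0)).1 <= vnorm z.
Proof.
move=> fg f00; have [->|z0] := eqVneq z 0; first by rewrite f00 vnorm0.
have nz : 0 < vnorm z by rewrite vnorm_gt0.
pose z1 := (vnorm z)^-1%:C *: z; pose t : R[i] := (vnorm z)%:C.
have t0 : t != 0 by rewrite -normc_gt0 normc_real gtr0_norm.
have z11 : vnorm z1 = 1 by rewrite vnormZ normc_real gtr0_norm ?invr_gt0// mulVf ?gt_eqF.
have zE : z = t *: z1 by rewrite scalerA -rmorphM mulfV ?gt_eqF// scale1r.
have nt : normc t = vnorm z by rewrite normc_real gtr0_norm.
rewrite {1}zE (base_quotient_scale _ _ f00) vnormZ nt ler_piMr ?vnorm_ge0//.
set q := vnorm _; rewrite leNgt; apply/negP => q1.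
(* For [s <= 1] the power [s ^ (2 p_i)] with the largest exponent is the smallest. Taking [w0] in
   block [i] makes its gauge scale exactly by this power, while that of the image [W] shrinks at
   most by it, so the power cancels. *)
pose i := [arg max_(i > Ordinal hl) p i]%O.
have pmax j : p j <= p i by rewrite /i; case: arg_maxP => // k _; apply.
pose w0 : 'rV[R[i]]_N := \mxrow_j (if j == i then const_mx 1 else 0).
have w0E j : submxrow w0 j = if j == i then const_mx 1 else 0 by rewrite mxrowK.
have w00 : w0 != 0.
  apply/eqP => E; have := w0E i; rewrite E eqxx => /rowP/(_ (Ordinal (hn i))).
  by rewrite !mxE => /eqP; rewrite eq_sym oner_eq0.
pose a := gauge p w0; have a0 : 0 < a by rewrite gauge_gt0.
have gauge_w0 (s : R) : 0 < s -> gauge p (s%:C *: w0) = s `^ (2 * p i) * a.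
  move=> s0; rewrite gaugeZ /a /gauge mulr_sumr; apply: eq_bigr => j _.
  rewrite normc_real gtr0_norm// w0E; case: eqP => [->//|_].
  by rewrite vnorm0 powR0 ?mulr0// (gt_eqF (mulr_gt0 _ (hp j))).
pose W := fiber_diff f (t *: z1) w0.
have W0 : 0 < gauge p W by rewrite gauge_gt0//; exact: fiber_diff_neq0 fg w00.
have gauge_W (s : R) : 0 < s -> s <= 1 -> s `^ (2 * p i) * gauge p W <= gauge p (s%:C *: W).
  move=> s0 s1; rewrite gaugeZ /gauge mulr_sumr; apply: ler_sum => j _.
  rewrite ler_wpM2r ?powR_ge0// normc_real gtr0_norm//.
  by apply: ger_powR; rewrite ?s0 ?ler_pM2l.
have q2 : 0 < q ^+ 2 - 1 by rewrite subr_gt0 exprn_egt1.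
pose c := a / gauge p W.
have c0 : 0 < c by rewrite divr_gt0.
(* Since [r <= r ^+ 2], the summands ensure in turn [1 <= r], [normc t <= r], [a^-1 <= mu * r ^+ 2]
   (whence [s <= 1]), and [c <= mu * r ^+ 2 * (q ^+ 2 - 1)], against the bound of the exponential of
   the right-hand side by [c]. *)
pose r : R := 1 + vnorm z + a^-1 / mu + c / (mu * (q ^+ 2 - 1)).
have [b1 b2] : 0 <= a^-1 / mu /\ 0 <= c / (mu * (q ^+ 2 - 1)).
  by split; rewrite divr_ge0 ?mulr_ge0 ?invr_ge0 ?ltW.
have r1 : 1 <= r by rewrite /r; lra.
have r0 : 0 < r by lra.
have rr : r <= r ^+ 2 by rewrite expr2 ler_peMl// ltW.
have tr : normc t <= r by rewrite nt /r; lra.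
have [s s0 sE] := @gauge_level R l n p hp w0 _ w00 (expR_gt0 (- (mu * r ^+ 2))).
have s1 : s <= 1.
  rewrite leNgt; apply/negP => /(gauge_scale_lt hp w00); rewrite sE -/a expRN.
  rewrite -[X in X < _]invrK ltf_pV2 ?posrE ?invr_gt0 ?expR_gt0//.
  apply/negP; rewrite -leNgt; apply: le_trans (expR_ge1Dx _).
  have : a^-1 <= mu * r ^+ 2.
    rewrite -ler_pdivrMl// [_^-1 * _]mulrC; apply: le_trans rr; rewrite /r.
    by lra.
  by lra.
have := growth fg f00 z11 r0 sE tr; rewrite fiber_diffZ -/W -/q => H.
have sa : s `^ (2 * p i) = expR (- (mu * r ^+ 2)) / a.
  by rewrite -sE gauge_w0// mulfK ?gt_eqF.
have {}H : s `^ (2 * p i) * gauge p W * expR (mu * r ^+ 2 * q ^+ 2) <= 1.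
  by apply: le_trans H; rewrite ler_pM2r ?expR_gt0// gauge_W.
move: H; rewrite sa.
have -> : expR (- (mu * r ^+ 2)) / a * gauge p W * expR (mu * r ^+ 2 * q ^+ 2) =
    expR (mu * r ^+ 2 * (q ^+ 2 - 1)) / c.
  have -> : mu * r ^+ 2 * (q ^+ 2 - 1) = - (mu * r ^+ 2) + mu * r ^+ 2 * q ^+ 2 by ring.
  by rewrite expRD /c; field; rewrite !gt_eqF.
rewrite ler_pdivrMr// mul1r => H.
have := le_trans (expR_ge1Dx _) H.
have : c <= mu * r ^+ 2 * (q ^+ 2 - 1).
  rewrite mulrAC -ler_pdivrMl ?mulr_gt0// [_^-1 * _]mulrC; apply: le_trans rr.
  have nz0 := ltW nz; rewrite /r; lra.
by lra.
Qed.

Lemma base_isometry f g z : holo_pair (p := p) (mu := mu) f g ->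
  f (0, 0) = (0, 0) -> vnorm (f (z, 0)).1 = vnorm z.
Proof.
move=> fg f00; have gf := holo_pair_sym fg.
have g00 : g (0, 0) = (0, 0).
  by have [_ _ gfK _] := fg; rewrite -{1}f00 gfK//; exact: inD0.
apply/eqP; rewrite eq_le (base_norm_le _ fg f00) /=.
have := base_norm_le (f (z, 0)).1 gf g00; by rewrite (aut_baseK hn0 hp hmu z fg).
Qed.

Lemma base_quotient_norm f g z t : holo_pair (p := p) (mu := mu) f g ->
  f (0, 0) = (0, 0) -> vnorm z = 1 -> vnorm (base_quotient f z t) = 1.
Proof.
move=> fg f00 z1.
have ne0 s : s != 0 -> vnorm (base_quotient f z s) = 1.
  move=> s0; have := base_isometry (s *: z) fg f00.
  rewrite (base_quotient_scale _ _ f00) !vnormZ z1 mulr1 -[RHS]mulr1.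
  by apply: mulfI; rewrite gt_eqF// normc_gt0.
have [->|t0] := eqVneq t 0; last exact: ne0.
have cq : rcont (fun s => vnorm (base_quotient f z s)) 0.
  by apply: vnorm_rcont => i; have [] := base_quotient_pholo z 0 i fg f00.
apply/eqP; rewrite -subr_eq0 -normr_le0 leNgt; apply/negP => d0.
have [r r0 Hr] := cq _ d0.
have := Hr (r / 2)%:C; rewrite subr0 normc_real gtr0_norm ?divr_gt0//.
rewrite ne0; last by rewrite -normc_gt0 normc_real gtr0_norm divr_gt0.
have r2 : r / 2 < r by rewrite ltr_pdivrMr// ltr_pMr// ltr1n.
by rewrite distrC ltxx => /(_ r2).
Qed.

(** This is [growth] at [t = 0] along any unit vector: the quotient now has norm 1, and
    [gauge p w < 1] allows writing the gauge as [expR (- (mu * r ^+ 2))]. *)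
Lemma fiber_gauge_le f g w : holo_pair (p := p) (mu := mu) f g ->
  f (0, 0) = (0, 0) -> gauge p w < 1 -> gauge p (fiber_diff f 0 w) <= gauge p w.
Proof.
move=> fg f00 w1; have [->|w0] := eqVneq w 0; first by rewrite fiber_diff0.
have g0 : 0 < gauge p w by rewrite gauge_gt0.
pose r := Num.sqrt (- ln (gauge p w) / mu).
have ln0 : 0 < - ln (gauge p w) / mu.
  by rewrite divr_gt0// oppr_gt0 ln_lt0// g0.
have r0 : 0 < r by rewrite sqrtr_gt0.
have wE : gauge p w = expR (- (mu * r ^+ 2)).
  by rewrite sqr_sqrtr ?(ltW ln0)// mulrC divfK ?gt_eqF// opprK lnK ?posrE.
pose c : R := vnorm (const_mx 1 : 'rV[R[i]]_n0).
have c0 : 0 < c.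
  rewrite vnorm_gt0; apply/eqP => /rowP/(_ (Ordinal hn0)).
  by rewrite !mxE => /eqP; rewrite oner_eq0.
pose z : 'rV[R[i]]_n0 := c^-1%:C *: const_mx 1.
have z1 : vnorm z = 1 by rewrite vnormZ normc_real gtr0_norm ?invr_gt0// mulVf ?gt_eqF.
have n0r : normc (0 : R[i]) <= r by rewrite Normc.normc0 ltW.
have := growth fg f00 z1 r0 wE n0r.
rewrite (base_quotient_norm _ fg f00 z1) expr1n mulr1 scale0r.
by move=> H; rewrite wE expRN -[X in _ <= X]mul1r ler_pdivlMr ?expR_gt0.
Qed.

Lemma fiber_gauge_eq f g w : holo_pair (p := p) (mu := mu) f g ->
  f (0, 0) = (0, 0) -> gauge p w < 1 -> gauge p (fiber_diff f 0 w) = gauge p w.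
Proof.
move=> fg f00 w1; have gf := holo_pair_sym fg.
have g00 : g (0, 0) = (0, 0).
  by have [_ _ gfK _] := fg; rewrite -{1}f00 gfK//; exact: inD0.
have le1 := fiber_gauge_le fg f00 w1.
apply/eqP; rewrite eq_le le1 /=.
have := fiber_gauge_le gf g00 (le_lt_trans le1 w1).
by have := fiber_diffK hn0 hp hmu 0 w fg; rewrite f00 /= => ->.
Qed.

(** Along a line through 0 the function bounded by 1 in [growth] equals 1 at the center, by
    [fiber_gauge_eq] and [base_quotient_norm]. So [maximum_at_center] makes both the fiber map and
    the base quotient constant. *)
Lemma normalized_form f g z w : holo_pair (p := p) (mu := mu) f g ->
  f (0, 0) = (0, 0) ->
  (f (z, 0)).1 = base_diff f z /\ fiber_diff f z w = fiber_diff f 0 w.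
Proof.
move=> fg f00; have [->|z0] := eqVneq z 0.
  split=> //; rewrite f00 /=.
  by have := base_diffZ f 0 0; rewrite !scale0r.
have nz : 0 < vnorm z by rewrite vnorm_gt0.
pose z1 := (vnorm z)^-1%:C *: z; pose t : R[i] := (vnorm z)%:C.
have t0 : t != 0 by rewrite -normc_gt0 normc_real gtr0_norm.
have z11 : vnorm z1 = 1 by rewrite vnormZ normc_real gtr0_norm ?invr_gt0// mulVf ?gt_eqF.
have zE : z = t *: z1 by rewrite scalerA -rmorphM mulfV ?gt_eqF// scale1r.
have nt : normc t = vnorm z by rewrite normc_real gtr0_norm.
(* Any radius larger than [normc t = vnorm z] would do. *)
pose r := vnorm z + 1; have r0 : 0 < r by rewrite addr_gt0.
have k0 : 0 < mu * r ^+ 2 by rewrite mulr_gt0// exprn_gt0.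
have main v : v != 0 -> fiber_diff f (t *: z1) v = fiber_diff f 0 v /\
    base_quotient f z1 t = base_diff f z1.
  move=> v0; have [s s0 sE] := @gauge_level R l n p hp v _ v0 (expR_gt0 (- (mu * r ^+ 2))).
  have sn : s%:C != 0 :> R[i] by rewrite -normc_gt0 normc_real gtr0_norm.
  have sv0 : s%:C *: v != 0 by rewrite scaler_eq0 negb_or sn.
  have sv1 : gauge p (s%:C *: v) < 1 by rewrite sE -expR0 ltr_expR oppr_lt0.
  have [] := @maximum_at_center R l n0 n p hp
      (fun j t => submxrow (fiber_diff f (t *: z1) (s%:C *: v)) j) (base_quotient f z1)
      (mu * r ^+ 2) r k0 _ _ _ _ t.
  - move=> s' _ j i; have -> : (fun t => submxrow (fiber_diff f (t *: z1) (s%:C *: v)) j 0 i) =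
        fun t => fiber_diff f (t *: z1) (s%:C *: v) 0 (tagnat.Rank j i).
      by apply/funext => s''; rewrite submxrow_coord.
    by apply: cdiff_pholo; exists 1 => // s'' _; exact: (fiber_diff_cdiff _ _ _ _ fg).
  - by move=> s' _ i; exact: base_quotient_pholo fg f00.
  - by rewrite scale0r gauge_gt0//; exact: fiber_diff_neq0 fg sv0.
  - move=> s' s'r; apply: le_trans (growth fg f00 z11 r0 sE (ltW s'r)) _.
    rewrite scale0r (base_quotient_norm _ fg f00 z11) expr1n mulr1.
    rewrite -[X in _ <= X * _]/(gauge p _) (fiber_gauge_eq fg f00 sv1) sE.
    by rewrite -expRD addNr expR0.
  - by rewrite nt /r ltrDl.
  move=> HW HZ; split; last by rewrite HZ /base_quotient eqxx.
  have : fiber_diff f (t *: z1) (s%:C *: v) = fiber_diff f 0 (s%:C *: v).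
    by move: HW; rewrite scale0r; exact: submxrow_inj.
  by rewrite !fiber_diffZ => /(scalerI sn).
split.
  have [j hj] : exists j : 'I_l, true by exists (Ordinal hl).
  pose v0 : 'rV[R[i]]_N := const_mx 1.
  have v00 : v0 != 0.
    apply/eqP => /rowP/(_ (tagnat.Rank j (Ordinal (hn j)))); rewrite !mxE => /eqP.
    by rewrite oner_eq0.
  have [_ E1] := main _ v00.
  by rewrite {1}zE (base_quotient_scale _ _ f00) E1 -base_diffZ -zE.
have [->|w0] := eqVneq w 0; first by rewrite !fiber_diff0.
by have [] := main _ w0; rewrite -zE.
Qed.

End NormalizedAutomorphism.

(** * Linear maps preserving the gauge *)

Section Clarkson.
Context {R : realType}.
Implicit Types (x y q : R).

Lemma powR_midpoint x y q : 1 <= q -> 0 <= x -> 0 <= y ->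
  2 * ((x + y) / 2) `^ q <= x `^ q + y `^ q.
Proof.
move=> q1 x0 y0.
suff : (2^-1 * x + (1 - 2^-1) * y) `^ q <= 2^-1 * x `^ q + (1 - 2^-1) * y `^ q.
  have -> : (x + y) / 2 = 2^-1 * x + (1 - 2^-1) * y by field.
  by move: (_ `^ _) (x `^ q) (y `^ q) => a b c; lra.
by apply: (convex_powR q1 (Itv01 _ _)) => //=;
  rewrite ?inE/= ?in_itv/= ?x0 ?y0// ?invr_ge0// invf_le1 ?ler1n.
Qed.

Lemma powR_superadd x y q : 1 < q -> 0 < x -> 0 < y -> x `^ q + y `^ q < (x + y) `^ q.
Proof.
move=> q1 x0 y0; have q0 : 0 < q by lra.
have qm : 0 < q - 1 by rewrite subr_gt0.
rewrite -!(mulr_powRB1 _ q0) ?addr_ge0 ?ltW// mulrDl.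
by apply: ltrD; rewrite ltr_pM2l//; apply: gt0_ltr_powR; rewrite ?nnegrE ?addr_ge0 ?ltW// ?ltrDl ?ltrDr.
Qed.

Context {k : nat}.
Implicit Types (a b : 'rV[R[i]]_k).

(** For [q = 1] this vanishes identically, by the parallelogram law; otherwise it has the sign of
    [q - 1], strictly unless [a] or [b] is 0. *)
Definition clarkson_defect q a b : R :=
  vnorm (a + b) `^ (2 * q) + vnorm (a - b) `^ (2 * q) -
  2 * (vnorm a `^ (2 * q) + vnorm b `^ (2 * q)).

Lemma clarkson_defect0 q : 0 < q -> clarkson_defect q 0 0 = 0.
Proof.
move=> q0; rewrite /clarkson_defect addr0 subr0 vnorm0 powR0 ?gt_eqF ?mulr_gt0//.
by rewrite !addr0 mulr0 subr0.
Qed.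

Lemma parallelogram a b :
  vnorm (a + b) ^+ 2 + vnorm (a - b) ^+ 2 = 2 * (vnorm a ^+ 2 + vnorm b ^+ 2).
Proof.
rewrite !vnorm_sqrD vnormN.
have -> : dotmx a (- b) = - dotmx a b.
  rewrite !dotmx_sum -sumrN; apply: eq_bigr => i _.
  by rewrite mxE rmorphN mulrN.
by case: (dotmx a b) => u v /=; ring.
Qed.

Lemma powR_double x q : 0 <= x -> x `^ (2 * q) = (x ^+ 2) `^ q.
Proof. by move=> x0; rewrite powRrM powR_mulrn. Qed.

(** Convexity and the parallelogram law bound the first two terms below by [2 (|a|^2 + |b|^2)^q];
    superadditivity of the power is strict when both vectors are nonzero. *)
Lemma clarkson_gt1 q a b : 1 < q -> 0 <= clarkson_defect q a b /\
  (clarkson_defect q a b = 0 -> a = 0 \/ b = 0).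
Proof.
move=> q1; have q0 : 0 < q by lra.
rewrite /clarkson_defect !powR_double ?vnorm_ge0//.
have := @powR_midpoint (vnorm (a + b) ^+ 2) (vnorm (a - b) ^+ 2) q (ltW q1)
  (sqr_ge0 _) (sqr_ge0 _).
rewrite parallelogram mulrAC mulfV// mul1r.
have [->|a0] := eqVneq a 0.
  rewrite vnorm0 expr0n add0r powR0 ?gt_eqF//.
  by move: (_ `^ _) (_ `^ _) (_ `^ _) => u v w H; split; [lra|left].
have [->|b0] := eqVneq b 0.
  rewrite vnorm0 expr0n addr0 powR0 ?gt_eqF//.
  by move: (_ `^ _) (_ `^ _) (_ `^ _) => u v w H; split; [lra|right].
have a2 : 0 < vnorm a ^+ 2 by rewrite exprn_gt0// vnorm_gt0.
have b2 : 0 < vnorm b ^+ 2 by rewrite exprn_gt0// vnorm_gt0.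
have := powR_superadd q1 a2 b2.
move: ((_ + _) `^ _) ((vnorm a ^+ 2) `^ q) ((vnorm b ^+ 2) `^ q) => s u v.
move: (_ `^ _) (_ `^ _) => X Y H1 H2.
by split=> [|E]; [lra|exfalso; lra].
Qed.

(** The two inequalities for exponents above 1 are used with [q^-1], applied to [q]-th powers, which
    reverses them. *)
Lemma clarkson_lt1 q a b : 0 < q -> q < 1 -> clarkson_defect q a b <= 0 /\
  (clarkson_defect q a b = 0 -> a = 0 \/ b = 0).
Proof.
move=> q0 q1; have r1 : 1 < q^-1 by rewrite invf_gt1.
rewrite /clarkson_defect !powR_double ?vnorm_ge0//.
have powK x : 0 <= x -> (x `^ q) `^ q^-1 = x.
  by move=> x0; rewrite -powRrM mulfV ?gt_eqF// powRr1.
have powK' x : 0 <= x -> (x `^ q^-1) `^ q = x.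
  by move=> x0; rewrite -powRrM mulVf ?gt_eqF// powRr1.
have := @powR_midpoint ((vnorm (a + b) ^+ 2) `^ q) ((vnorm (a - b) ^+ 2) `^ q) q^-1
  (ltW r1) (powR_ge0 _ _) (powR_ge0 _ _).
rewrite !powK ?sqr_ge0// parallelogram ler_pM2l//.
set X := (_ + _) / 2 => HX.
have X0 : 0 <= X by rewrite divr_ge0// addr_ge0// powR_ge0.
have {}HX : X <= (vnorm a ^+ 2 + vnorm b ^+ 2) `^ q.
  rewrite -[leLHS]powK'//; apply: ge0_ler_powR; rewrite ?nnegrE ?powR_ge0 ?(ltW q0)//.
  by rewrite addr_ge0 ?sqr_ge0.
have XE : (vnorm (a + b) ^+ 2) `^ q + (vnorm (a - b) ^+ 2) `^ q = 2 * X.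
  by rewrite /X mulrC divfK.
rewrite XE; move: HX; clear -q0 q1 r1 powK; move: X => X.
have [->|a0] := eqVneq a 0.
  rewrite vnorm0 expr0n add0r powR0 ?gt_eqF//.
  by move: (_ `^ _) => u H; split; [lra|left].
have [->|b0] := eqVneq b 0.
  rewrite vnorm0 expr0n addr0 powR0 ?gt_eqF//.
  by move: (_ `^ _) => u H; split; [lra|right].
have a2 : 0 < vnorm a ^+ 2 by rewrite exprn_gt0// vnorm_gt0.
have b2 : 0 < vnorm b ^+ 2 by rewrite exprn_gt0// vnorm_gt0.
have := powR_superadd r1 (powR_gt0 q a2) (powR_gt0 q b2).
rewrite (powK _ (ltW a2)) (powK _ (ltW b2)) => H HX.
have {}H : (vnorm a ^+ 2 + vnorm b ^+ 2) `^ q < (vnorm a ^+ 2) `^ q + (vnorm b ^+ 2) `^ q.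
  have u0 : 0 <= (vnorm a ^+ 2) `^ q + (vnorm b ^+ 2) `^ q by rewrite addr_ge0// powR_ge0.
  have -> : (vnorm a ^+ 2) `^ q + (vnorm b ^+ 2) `^ q =
      (((vnorm a ^+ 2) `^ q + (vnorm b ^+ 2) `^ q) `^ q^-1) `^ q.
    by rewrite -powRrM mulVf ?gt_eqF// powRr1.
  by apply: gt0_ltr_powR; rewrite ?nnegrE ?powR_ge0 ?addr_ge0 ?sqr_ge0.
move: H HX; move: ((vnorm a ^+ 2 + vnorm b ^+ 2) `^ q) ((vnorm a ^+ 2) `^ q) ((vnorm b ^+ 2) `^ q).
move=> s u v H1 H2.
by split=> [|E]; [lra|exfalso; lra].
Qed.

End Clarkson.

(* The values at [1], [1/2] and [1/4] combine into
   [\sum_j c j * (2 `^ - q j - 2 `^ - q0) ^+ 2 = 0]. *)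
Lemma power_sum_exponent (R : realType) (I : finType) (c q : I -> R) (c0 q0 : R) :
  (forall j, 0 <= c j) ->
  (forall s, 0 < s -> s <= 1 -> \sum_j s `^ q j * c j = s `^ q0 * c0) ->
  forall j, q j != q0 -> c j = 0.
Proof.
move=> c_ge0 H.
pose y x := 2^-1 `^ x : R.
have y2 x : 4^-1 `^ x = y x ^+ 2 :> R.
  have -> : 4^-1 = 2^-1 * 2^-1 :> R by field.
  by rewrite powRM ?invr_ge0// expr2.
have S0 : \sum_j c j * (y (q j) - y q0) ^+ 2 = 0.
  have -> : \sum_j c j * (y (q j) - y q0) ^+ 2 =
      \sum_j 4^-1 `^ q j * c j + (- (2 * y q0)) * (\sum_j 2^-1 `^ q j * c j) +
      y q0 ^+ 2 * (\sum_j 1 `^ q j * c j).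
    rewrite !mulr_sumr -!big_split/=; apply: eq_bigr => j _.
    by rewrite y2 powR1 -/(y _); ring.
  rewrite !H ?invr_gt0 ?invf_le1 ?ler1n//; try lra.
  by rewrite y2 powR1 -/(y _); ring.
move=> j qj; have /eqP := @psumr_eq0P _ _ _ _ (fun i _ => mulr_ge0 (c_ge0 i) (sqr_ge0 _)) S0 j isT.
rewrite mulf_eq0 sqrf_eq0 subr_eq0 => /orP[/eqP//|/eqP].
have h : 2^-1 != 0 :> R by rewrite invr_eq0.
rewrite /y /powR (negPf h) => /expR_inj/mulIf E.
move: qj; rewrite E ?eqxx// lnV ?posrE// oppr_eq0 gt_eqF// ln_gt0// ltr1n.
by [].
Qed.

Section Isometry.
Context {R : realType} {m k : nat}.
Variable M : 'M[R[i]]_(m, k).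
Hypothesis isoM : forall v, vnorm (v *m M) = vnorm v.

(** Polarization: norms determine the real part, and replacing [u] by ['i *: u] gives the imaginary
    part. *)
Lemma isometry_dotmx u v : dotmx (u *m M) (v *m M) = dotmx u v.
Proof.
have ReE x y : Re (dotmx (x *m M) (y *m M)) = Re (dotmx x y).
  have := vnorm_sqrD (x *m M) (y *m M); have := vnorm_sqrD x y.
  rewrite -mulmxDl !isoM => -> /addIr/addrI.
  by have n2 : 2 != 0 :> R by []; move/(mulfI n2).
have ImE m' (x y : 'rV[R[i]]_m') : Re (dotmx ('i *: x) y) = - Im (dotmx x y).
  have -> : dotmx ('i *: x) y = 'i * dotmx x y.
    by rewrite !dotmx_sum mulr_sumr; apply: eq_bigr => a _; rewrite mxE mulrA.
  by case: (dotmx x y) => a b /=; ring.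
have := ReE ('i *: u) v; rewrite -scalemxAl !ImE => /oppr_inj.
by have := ReE u v; case: (dotmx _ _) (dotmx u v) => a b [c d] /= -> ->.
Qed.

Lemma isometry_unitary : M \is unitarymx.
Proof.
apply/row_unitarymxP => i j; rewrite !rowE.
rewrite isometry_dotmx dotmx_sum (bigD1 i)//= big1 ?addr0.
  by rewrite !mxE !eqxx /= mul1r rmorph_nat eq_sym.
by move=> a ai; rewrite !mxE (negPf ai) mul0r.
Qed.

End Isometry.

Section GaugeIsometry.
Context {R : realType} {l : nat} {n : 'I_l -> nat} {p : 'I_l -> R}.
Hypotheses (hn : forall j, (0 < n j)%N) (hp : forall j, 0 < p j).
Hypothesis hp1 : forall j : 'I_l, (0 < j)%N -> p j != 1.
Local Notation N := (\sum_(j < l) n j)%N.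
Implicit Types (w : 'rV[R[i]]_N) (q : R).

Definition isotypic q w := forall j, p j != q -> submxrow w j = 0.

Lemma isotypicD q w w' : isotypic q w -> isotypic q w' -> isotypic q (w + w').
Proof. by move=> H H' j pj; rewrite submxrowD H ?H'// addr0. Qed.

Lemma gauge_isotypicZ q w t : isotypic q w -> gauge p (t *: w) = normc t `^ (2 * q) * gauge p w.
Proof.
move=> H; rewrite gaugeZ mulr_sumr; apply: eq_bigr => j _.
have [->//|pj] := eqVneq (p j) q.
by rewrite H// vnorm0 powR0 ?mulr0// gt_eqF// mulr_gt0.
Qed.

(** Right multiplication by it places a vector in block [i] and 0 elsewhere. *)
Definition block_mx_of i : 'M[R[i]]_(n i, N) := submxcol 1%:M i.

Lemma submxrow_block i j (v : 'rV_(n i)) : i != j -> submxrow (v *m block_mx_of i) j = 0.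
Proof.
move=> ij; rewrite -mul_submxrow; have -> : submxrow (block_mx_of i) j = 0.
  apply/matrixP => a b; rewrite !mxE -val_eqE /= tagnat.eq_Rank.
  by rewrite (negPf ij).
exact: mulmx0.
Qed.

Lemma submxrow_block_id i (v : 'rV_(n i)) : submxrow (v *m block_mx_of i) i = v.
Proof.
rewrite -mul_submxrow; have -> : submxrow (block_mx_of i) i = 1%:M.
  by apply/matrixP => a b; rewrite !mxE -val_eqE /= tagnat.eq_Rank eqxx.
exact: mulmx1.
Qed.

Lemma block_sum w : w = \sum_i submxrow w i *m block_mx_of i.
Proof.
by rewrite -mul_mxrow_mxcol submxrowK submxcolK mulmx1.
Qed.

Lemma isotypic_block i (v : 'rV_(n i)) : isotypic (p i) (v *m block_mx_of i).
Proof.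
by move=> j pj; apply: submxrow_block; apply: contraNneq pj => ->.
Qed.

Lemma gauge_block_mx i (v : 'rV_(n i)) : gauge p (v *m block_mx_of i) = vnorm v `^ (2 * p i).
Proof.
rewrite /gauge (bigD1 i)//= submxrow_block_id big1 ?addr0// => j ji.
by rewrite submxrow_block 1?eq_sym// vnorm0 powR0// gt_eqF// mulr_gt0.
Qed.

Variable T : 'M[R[i]]_N.
Hypothesis isoT : forall w, gauge p w < 1 -> gauge p (w *m T) = gauge p w.

(** Along the ray of [w] the gauge is a multiple of [t ^ (2 q)], so blocks of the image with another
    exponent vanish by [power_sum_exponent]. The same homogeneity then removes the restriction to
    gauge below 1. *)
Lemma isometry_isotypic q w : isotypic q w ->
  isotypic q (w *m T) /\ gauge p (w *m T) = gauge p w.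
Proof.
move=> H; have [->|w0] := eqVneq w 0.
  by rewrite mul0mx; split=> // j _; exact: submxrow0.
have h2 : 0 < 2^-1 :> R by rewrite invr_gt0.
have [s s0 sE] := gauge_level hp w0 h2.
have sn : s%:C != 0 :> R[i] by rewrite -normc_gt0 normc_real gtr0_norm.
have ns : 0 < normc (s%:C : R[i]) `^ (2 * q) by rewrite powR_gt0// normc_gt0.
set w1 := s%:C *: w in sE.
have H1 : isotypic q w1 by move=> j /H Hj; rewrite submxrowZ Hj scaler0.
have small t : normc t <= 1 -> gauge p (t *: w1) < 1.
  by move=> t1; apply: le_lt_trans (gauge_leZ hp _ t1) _; rewrite sE invf_lt1// ltr1n.
have HT : isotypic q (w *m T).
  move=> j pj.
  have e : vnorm (submxrow (w1 *m T) j) `^ (2 * p j) = 0.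
    apply: (@power_sum_exponent R _ (fun j => vnorm (submxrow (w1 *m T) j) `^ (2 * p j))
      (fun j => 2 * p j) (gauge p w1) (2 * q)).
    - by move=> i; exact: powR_ge0.
    - move=> t t0 t1; have nt : normc (t%:C : R[i]) = t by rewrite normc_real gtr0_norm.
      have := gauge_isotypicZ t%:C H1; rewrite nt => <-.
      rewrite -isoT; last by rewrite small ?nt.
      by rewrite -scalemxAl gaugeZ nt.
    - by apply: contraNneq pj => /mulfI -> //.
  apply/eqP; rewrite -vnorm_eq0.
  have : vnorm (submxrow (w1 *m T) j) == 0.
    move/eqP: e; rewrite powR_eq0 => /andP[]//.
  by rewrite /w1 -scalemxAl submxrowZ !vnorm_eq0 scaler_eq0 (negPf sn).
split=> //; have /isoT : gauge p w1 < 1 by have := small 1; rewrite scale1r Normc.normc1; apply.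
rewrite -scalemxAl (gauge_isotypicZ _ HT) (gauge_isotypicZ _ H).
by apply: mulfI; rewrite gt_eqF.
Qed.

Lemma gauge_disjoint w w' :
  (forall j, submxrow w j = 0 \/ submxrow w' j = 0) ->
  gauge p (w + w') = gauge p w + gauge p w'.
Proof.
move=> H; rewrite /gauge -big_split/=; apply: eq_bigr => j _; rewrite submxrowD.
have z : (0 : R) `^ (2 * p j) = 0 by rewrite powR0// gt_eqF// mulr_gt0.
by case: (H j) => ->; rewrite vnorm0 z ?addr0 ?add0r.
Qed.

(* The gauges of [w + w'] and [w - w'] agree with the sum of the gauges, so that
   Clarkson's inequality is an equality in each block of the images. *)
Lemma isometry_disjoint q w w' : q != 1 -> isotypic q w -> isotypic q w' ->
  (forall j, submxrow w j = 0 \/ submxrow w' j = 0) ->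
  forall j, submxrow (w *m T) j = 0 \/ submxrow (w' *m T) j = 0.
Proof.
move=> q1 Hw Hw' disj j.
have Hm : isotypic q (- w') by move=> i /Hw' E; rewrite -scaleN1r submxrowZ E scaler0.
have [IwT gw] := isometry_isotypic Hw; have [IwT' gw'] := isometry_isotypic Hw'.
have [_ gm] := isometry_isotypic Hm.
have [_ gP] := isometry_isotypic (isotypicD Hw Hw').
have [_ gM] := isometry_isotypic (isotypicD Hw Hm).
have gNw' : gauge p (- w') = gauge p w'.
  by apply: eq_bigr => i _; rewrite -scaleN1r submxrowZ scaleN1r vnormN.
have sum0 : \sum_i clarkson_defect (p i) (submxrow (w *m T) i) (submxrow (w' *m T) i) = 0.
  have -> : \sum_i clarkson_defect (p i) (submxrow (w *m T) i) (submxrow (w' *m T) i) =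
      gauge p ((w + w') *m T) + gauge p ((w - w') *m T) -
      2 * (gauge p (w *m T) + gauge p (w' *m T)).
    have S (a b c d : 'I_l -> R) : \sum_i (a i + b i - 2 * (c i + d i)) =
        \sum_i a i + \sum_i b i - 2 * (\sum_i c i + \sum_i d i).
      by rewrite sumrB big_split -mulr_sumr big_split.
    apply: etrans (S _ _ _ _); apply: eq_bigr => i _.
    rewrite /clarkson_defect !mulmxDl !submxrowD mulNmx.
    by rewrite -[- (w' *m T)]scaleN1r submxrowZ scaleN1r.
  rewrite gP gM gw gw' gauge_disjoint// gauge_disjoint; last first.
    move=> i; case: (disj i) => E; [by left|right].
    by rewrite -scaleN1r submxrowZ E scaler0.
  by rewrite gNw'; ring.
have [pj|pj] := eqVneq (p j) q; last by left; exact: IwT.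
(* Where the exponent is [q] the defects have the sign of [q - 1]; elsewhere both images vanish. So
   each term of the vanishing sum is 0. *)
have [ql|qg|qe] := ltgtP q 1; last by rewrite qe eqxx in q1.
  have H i : clarkson_defect (p i) (submxrow (w *m T) i) (submxrow (w' *m T) i) <= 0.
    have [pi|pi] := eqVneq (p i) q.
      by have := (@clarkson_lt1 R _ q _ _ _ ql); rewrite pi => H; apply H; rewrite -pi.
    by rewrite IwT// IwT'// clarkson_defect0.
  have q0 : 0 < q by rewrite -pj.
  have [_] := @clarkson_lt1 R _ q (submxrow (w *m T) j) (submxrow (w' *m T) j) q0 ql.
  apply; have N0 : \sum_i - clarkson_defect (p i) (submxrow (w *m T) i) (submxrow (w' *m T) i) = 0.
    by rewrite sumrN sum0 oppr0.
  have Nge i : true -> 0 <= - clarkson_defect (p i) (submxrow (w *m T) i) (submxrow (w' *m T) i).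
    by rewrite oppr_ge0.
  by apply: oppr_inj; rewrite oppr0 -pj; exact: (psumr_eq0P Nge N0).
have H i : 0 <= clarkson_defect (p i) (submxrow (w *m T) i) (submxrow (w' *m T) i).
  have [pi|pi] := eqVneq (p i) q.
    by have := (@clarkson_gt1 R _ q (submxrow (w *m T) i) (submxrow (w' *m T) i) qg); rewrite pi => -[].
  by rewrite IwT// IwT'// clarkson_defect0.
have [_] := @clarkson_gt1 R _ q (submxrow (w *m T) j) (submxrow (w' *m T) j) qg.
by apply; rewrite -pj; apply: (psumr_eq0P (fun i _ => H i) sum0).
Qed.

Lemma image_block_unique i i' j (v : 'rV_(n i)) (v' : 'rV_(n i')) :
  submxrow (v *m block_mx_of i *m T) j != 0 ->
  submxrow (v' *m block_mx_of i' *m T) j != 0 -> i = i'.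
Proof.
move=> vj v'j; have [Ti _] := isometry_isotypic (isotypic_block v).
have [Ti' _] := isometry_isotypic (isotypic_block v').
have pj : p j = p i by apply: contraNeq vj => /Ti ->.
have pj' : p j = p i' by apply: contraNeq v'j => /Ti' ->.
apply: contraTeq v'j => ii'; rewrite negbK.
(* Both blocks share the exponent of block [j], and only block 0 may have exponent 1, so two
   different blocks cannot share the exponent 1. *)
have p1 : p i != 1.
  have [i0|/hp1//] := posnP i.
  rewrite -pj pj'; apply: hp1; rewrite lt0n; apply: contra ii' => /eqP i'0.
  by apply/eqP/val_inj; rewrite /= i0 i'0.
have Iv' : isotypic (p i) (v' *m block_mx_of i') by rewrite -pj pj'; exact: isotypic_block.
have [a|/eqP|->] := isometry_disjoint p1 (isotypic_block v) Iv' _ j; rewrite ?eqxx//.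
  have [<-|ia] := eqVneq i a; last by left; exact: submxrow_block.
  by right; apply: submxrow_block; rewrite eq_sym.
by rewrite (negPf vj).
Qed.

Lemma castmx_mulmx (a b c : nat) (ab : a = b) (u : 'rV[R[i]]_a) (M : 'M[R[i]]_(a, c)) :
  castmx (erefl 1%N, ab) u *m castmx (ab, erefl c) M = u *m M.
Proof. by case: _ / ab; rewrite !castmx_id. Qed.

Lemma castmx_unitary (a b c : nat) (ab : a = b) (M : 'M[R[i]]_(a, c)) :
  M \is unitarymx -> castmx (ab, erefl c) M \is unitarymx.
Proof. by case: _ / ab; rewrite castmx_id. Qed.

Lemma gauge_isometry_form : exists s : 'S_l, exists ns : forall j, n (s j) = n j,
  exists Gam : forall j, 'M[R[i]]_(n j),
  [/\ forall j, p (s j) = p j, forall j, Gam j \is unitarymx &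
    forall w, w *m T = \mxrow_j (castmx (erefl 1%N, ns j) (submxrow w (s j)) *m Gam j)].
Proof.
have ex i : exists j, exists v : 'rV_(n i), submxrow (v *m block_mx_of i *m T) j != 0.
  pose v := const_mx 1 : 'rV[R[i]]_(n i).
  have v0 : v != 0.
    by apply/eqP => /rowP/(_ (Ordinal (hn i))); rewrite !mxE => /eqP; rewrite oner_eq0.
  have [_ E] := isometry_isotypic (isotypic_block v).
  have : 0 < gauge p (v *m block_mx_of i *m T).
    by rewrite E gauge_block_mx powR_gt0// vnorm_gt0.
  by rewrite gauge_gt0// => /block_gt0[j vj]; exists j, v.
have [tau tauP] := choice ex.
have tau_inj : injective tau.
  move=> i i' E; have [v vj] := tauP i; have [v' v'j] := tauP i'.
  by apply: image_block_unique vj _; rewrite E; exact: v'j.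
(* [tau i] is a block met by the image of block [i]; the inverse is taken because [phiD] fills block
   [j] from block [s j]. *)
pose s := (perm tau_inj)^-1%g.
have tauK j : tau (s j) = j by rewrite -[LHS](permE tau_inj) permKV.
have off i j (v : 'rV_(n i)) : i != s j -> submxrow (v *m block_mx_of i *m T) j = 0.
  move=> ij; apply/eqP; apply: contraNT ij => vj; apply/eqP.
  by have [v'] := tauP (s j); rewrite tauK => v'j; exact: image_block_unique vj v'j.
have ps j : p (s j) = p j.
  have [v vj] := tauP (s j); apply/esym; apply: contraNeq vj => pj.
  have [Ti _] := isometry_isotypic (isotypic_block v).
  by rewrite tauK Ti.
pose M j : 'M[R[i]]_(n (s j), n j) := submxrow (block_mx_of (s j) *m T) j.
have ME j (v : 'rV_(n (s j))) : submxrow (v *m block_mx_of (s j) *m T) j = v *m M j.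
  by rewrite -mulmxA mul_submxrow.
have MU j : M j \is unitarymx.
  apply: isometry_unitary => v.
  have [_ E] := isometry_isotypic (isotypic_block v).
  have E2 : gauge p (v *m block_mx_of (s j) *m T) = vnorm (v *m M j) `^ (2 * p j).
    rewrite /gauge (bigD1 j)//= ME big1 => [|i ij]; first exact: addr0.
    have ne : s j != s i by rewrite (inj_eq perm_inj) eq_sym.
    by rewrite (off _ _ _ ne) vnorm0 powR0// gt_eqF// mulr_gt0.
  move: E; rewrite E2 gauge_block_mx ps.
  by apply: powR_inj; rewrite ?vnorm_ge0 ?mulr_gt0.
(* [M j] is not yet known to be square: its orthonormal rows only give an inequality of dimensions.
   Both sides have the same sum over [j], so equality follows. *)
have le_n j : (n (s j) <= n j)%N.
  by rewrite -{1}(mxrank_unitary (MU j)) rank_leq_col.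
have ns j : n (s j) = n j.
  have H := @eq_of_sum_le R _ (fun j => (n j)%:R) (fun j => (n (s j))%:R).
  apply/esym/eqP; rewrite -(eqr_nat R); apply/eqP; apply: H => [i|].
    by rewrite ler_nat.
  by rewrite (reindex_inj (@perm_inj _ s)).
exists s, ns, (fun j => castmx (ns j, erefl (n j)) (M j)); split=> // [j|w].
  exact: castmx_unitary.
apply: submxrow_inj => j; rewrite mxrowK castmx_mulmx.
rewrite {1}(block_sum w) mulmx_suml submxrow_sum (bigD1 (s j))//= ME big1 => [|i ij].
  exact: addr0.
exact: off.
Qed.

End GaugeIsometry.

(** * The automorphism group *)

Lemma near_eq_differentiable (K : numFieldType) (V W : normedModType K) (f g : V -> W) (x : V) :
  (\forall y \near x, f y = g y) -> differentiable f x -> differentiable g x.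
Proof.
move=> fg /diff_locallyP[cd fE].
have gE : g \o shift x = cst (g x) + 'd f x +o_ 0 id.
  apply/eqaddoP => e e0; have /eqaddoP/(_ e e0) := fE.
  have : \forall h \near 0, f (h + x) = g (h + x).
    by move: fg; rewrite (near_shift 0) subr0.
  have fgx := nbhs_singleton fg.
  by apply: filterS2 => h; rewrite !fctE /= fgx => ->.
by apply/diff_locallyP; rewrite (diff_unique cd gE).
Qed.

(** * Holomorphy of the generators *)

Section Holomorphy.
Context {R : realType} {V : normedModType R[i]}.

Lemma differentiable_fun_sum k (F : 'I_k -> V -> R[i]) (x : V) :
  (forall i, differentiable (F i) x) -> differentiable (fun y => \sum_i F i y) x.
Proof.
move=> dF; have -> : (fun y => \sum_i F i y) = \sum_i F i.
  by apply/funext => y; rewrite fct_sumE.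
exact: differentiable_sum.
Qed.

Lemma differentiable_row k (F : V -> 'rV[R[i]]_k) (x : V) :
  (forall i, differentiable (fun y => F y 0 i) x) -> differentiable F x.
Proof.
move=> dF; have -> : F = \sum_i (fun y => F y 0 i *: delta_mx 0 i).
  by apply/funext => y; rewrite fct_sumE {1}[F y]row_sum_delta.
by apply: differentiable_sum => i; apply: differentiableZl; exact: dF.
Qed.

Lemma differentiable_cdiff (u : V -> R[i]) (v : R[i] -> R[i]) (x : V) :
  differentiable u x -> cdiff v (u x) -> differentiable (fun y => v (u y)) x.
Proof.
move=> du /cdiffP dv.
exact: (@differentiable_comp _ V R[i] R[i] u v x du dv).
Qed.

Lemma differentiable_fun_add (u v : V -> R[i]) (x : V) :
  differentiable u x -> differentiable v x -> differentiable (fun y => u y + v y) x.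
Proof. by move=> du dv; exact: (@differentiableD R[i] V R[i] u v x du dv). Qed.

Lemma differentiable_fun_mul (u v : V -> R[i]) (x : V) :
  differentiable u x -> differentiable v x -> differentiable (fun y => u y * v y) x.
Proof. by move=> du dv; exact: (@differentiableM R[i] V u v x du dv). Qed.

End Holomorphy.

Section PairHolomorphy.
Context {R : realType} {m N : nat}.
Local Notation E := ('rV[R[i]]_m * 'rV[R[i]]_N)%type.
Implicit Types x : E.

Lemma differentiable_coordinate (c : E -> R[i]) x : coordinate c -> differentiable c x.
Proof.
case=> -[i ->].
  apply: (@differentiable_comp _ E 'rV[R[i]]_m R[i] fst (fun u => u 0 i)).
    by apply: linear_differentiable => y; exact: cvg_fst.
  exact: differentiable_coord.
apply: (@differentiable_comp _ E 'rV[R[i]]_N R[i] snd (fun u => u 0 i)).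
  by apply: linear_differentiable => y; exact: cvg_snd.
exact: differentiable_coord.
Qed.

Lemma differentiable_mulmx k (A : 'M[R[i]]_(m, k)) x :
  differentiable (fun y : E => y.1 *m A) x.
Proof.
apply: differentiable_row => i.
have -> : (fun y : E => (y.1 *m A) 0 i) = fun y => \sum_j y.1 0 j * A j i.
  by apply/funext => y; rewrite mxE.
apply: differentiable_fun_sum => j; apply: differentiable_fun_mul.
  by apply: differentiable_coordinate; left; exists j.
exact: differentiable_cst.
Qed.

Lemma differentiable_mulmx2 k (A : 'M[R[i]]_(N, k)) x :
  differentiable (fun y : E => y.2 *m A) x.
Proof.
apply: differentiable_row => i.
have -> : (fun y : E => (y.2 *m A) 0 i) = fun y => \sum_j y.2 0 j * A j i.
  by apply/funext => y; rewrite mxE.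
apply: differentiable_fun_sum => j; apply: differentiable_fun_mul.
  by apply: differentiable_coordinate; right; exists j.
exact: differentiable_cst.
Qed.

End PairHolomorphy.

Section Generators.
Context {R : realType} {l n0 : nat} {n : 'I_l -> nat} {p : 'I_l -> R} {mu : R}.
Hypothesis hp : forall j, 0 < p j.
Local Notation N := (\sum_(j < l) n j)%N.
Local Notation E := ('rV[R[i]]_n0 * 'rV[R[i]]_N)%type.
Local Notation D := (inD p mu : set E).
Implicit Types (x : E) (f g : E -> E).

Lemma isometry_unitmx k (A : 'M[R[i]]_k) (h : 'rV[R[i]]_k -> R) :
  (forall v, h (v *m A) = h v) -> (forall v, h v = 0 -> v = 0) -> h 0 = 0 -> A \in unitmx.
Proof.
move=> hA h_eq0 h0; rewrite -row_free_unit; apply: inj_row_free => v vA.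
by apply: h_eq0; rewrite -hA vA.
Qed.

Lemma linear_holo_pair (A : 'M[R[i]]_n0) (P : 'M[R[i]]_N) :
  (forall z, vnorm (z *m A) = vnorm z) -> (forall w, gauge p (w *m P) = gauge p w) ->
  holo_pair (p := p) (mu := mu) (fun x => (x.1 *m A, x.2 *m P))
    (fun x => (x.1 *m invmx A, x.2 *m invmx P)).
Proof.
move=> hA hP.
have uA : A \in unitmx.
  by apply: (isometry_unitmx hA) => [v|]; [move/eqP; rewrite vnorm_eq0 => /eqP|exact: vnorm0].
have uP : P \in unitmx.
  apply: (isometry_unitmx hP) => [v v0|]; last exact: gauge0.
  by apply/eqP; rewrite -[_ == 0]negbK -(gauge_gt0 hp) v0 ltxx.
have hA' z : vnorm (z *m invmx A) = vnorm z by rewrite -hA mulmxKV.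
have hP' w : gauge p (w *m invmx P) = gauge p w by rewrite -hP mulmxKV.
have dlin (A' : 'M[R[i]]_n0) (P' : 'M[R[i]]_N) x :
    differentiable (fun x : E => (x.1 *m A', x.2 *m P') : E) x.
  by apply: differentiable_pair; [exact: differentiable_mulmx|exact: differentiable_mulmx2].
split.
- split=> [x|x _]; last exact: dlin.
  by rewrite /inD /level /= hA hP.
- split=> [x|x _]; last exact: dlin.
  by rewrite /inD /level /= hA' hP'.
- by move=> x _ /=; rewrite !mulmxK// -surjective_pairing.
- by move=> x _ /=; rewrite !mulmxKV// -surjective_pairing.
Qed.

Lemma unitary_vnorm a b (A : 'M[R[i]]_(a, b)) z : A \is unitarymx -> vnorm (z *m A) = vnorm z.
Proof.
move=> AU; have : dotmx (z *m A) (z *m A) = dotmx z z.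
  by rewrite !dotmxE trmx_mul map_mxM mulmxA mulmxtVK.
rewrite !dotmx_vnorm => /complexI/eqP; rewrite eqrXn2 ?vnorm_ge0//.
by move/eqP.
Qed.

Lemma vnorm_castmx a b (ab : a = b) (u : 'rV[R[i]]_a) :
  vnorm (castmx (erefl 1%N, ab) u) = vnorm u.
Proof. by case: _ / ab; rewrite castmx_id. Qed.

Lemma castmx_mulmxl a b c (ab : a = b) (u : 'rV[R[i]]_c) (M : 'M[R[i]]_(c, a)) :
  castmx (erefl 1%N, ab) (u *m M) = u *m castmx (erefl c, ab) M.
Proof. by case: _ / ab; rewrite !castmx_id. Qed.

Lemma holo_phiA (A : 'M[R[i]]_n0) : A \is unitarymx ->
  exists g, holo_pair (p := p) (mu := mu) (phiA (n := n) A) g.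
Proof.
move=> AU; have vA z := unitary_vnorm z AU.
have v1 w : gauge p (w *m (1%:M : 'M[R[i]]_N)) = gauge p w by rewrite mulmx1.
have := linear_holo_pair vA v1.
have -> : (fun x : E => (x.1 *m A, x.2 *m 1%:M)) = phiA (n := n) A.
  by apply/funext => x; rewrite mulmx1.
by move=> H; eexists; exact: H.
Qed.

Lemma holo_phiD (s : 'S_l) (ns : forall j, n (s j) = n j)
    (Gam : forall j, 'M[R[i]]_(n j)) :
  (forall j, p (s j) = p j) -> (forall j, Gam j \is unitarymx) ->
  exists g, holo_pair (p := p) (mu := mu) (phiD (n0 := n0) ns Gam) g.
Proof.
move=> ps GU.
(* The block formula of [phiD] applied to the identity matrix gives its matrix. *)
pose P : 'M[R[i]]_N :=
  \mxrow_j (castmx (erefl N, ns j) (submxrow 1%:M (s j)) *m Gam j).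
have PE w : w *m P = \mxrow_j (castmx (erefl 1%N, ns j) (submxrow w (s j)) *m Gam j).
  rewrite mul_mxrow; apply: eq_mxrow => j.
  by rewrite mulmxA -castmx_mulmxl mul_submxrow mulmx1.
have gP w : gauge p (w *m P) = gauge p w.
  rewrite PE /gauge [RHS](reindex_inj (@perm_inj _ s)); apply: eq_bigr => j _ /=.
  by rewrite mxrowK (unitary_vnorm _ (GU j)) vnorm_castmx ps.
have v1 z : vnorm (z *m (1%:M : 'M[R[i]]_n0)) = vnorm z by rewrite mulmx1.
have := linear_holo_pair v1 gP.
have -> : (fun x : E => (x.1 *m 1%:M, x.2 *m P)) = phiD (n0 := n0) ns Gam.
  by apply/funext => x; rewrite mulmx1 PE.
by move=> H; eexists; exact: H.
Qed.

Definition translation_exponent (a z : 'rV[R[i]]_n0) : R[i] :=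
  - 2 * mu%:C * dotmx z a - (mu * vnorm a ^+ 2)%:C.

Lemma phiaE (a : 'rV[R[i]]_n0) x : phia p mu a x =
  (x.1 + a, \mxrow_j (cexp (translation_exponent a x.1 / (2 * p j)%:C) *: submxrow x.2 j)).
Proof. by rewrite /phia hnormE. Qed.

(** The division by [2 p_j] in the exponent makes every block contribute the same factor [c] to the
    gauge, and [c] cancels the change of [expR (mu |z|^2)] under translation by [a]. *)
Lemma phia_level a x : level p mu (phia p mu a x).1 (phia p mu a x).2 = level p mu x.1 x.2.
Proof.
rewrite phiaE /level /= vnorm_sqrD.
pose c := expR (- (2 * mu * Re (dotmx x.1 a)) - mu * vnorm a ^+ 2).
have -> : gauge p (\mxrow_j (cexp (translation_exponent a x.1 / (2 * p j)%:C) *: submxrow x.2 j)) =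
    c * gauge p x.2.
  rewrite /gauge mulr_sumr; apply: eq_bigr => j _; rewrite mxrowK vnormZ normc_cexp.
  have pj : 2 * p j != 0 by rewrite gt_eqF// mulr_gt0.
  rewrite powRM ?vnorm_ge0 ?expR_ge0//; congr (_ * _).
  rewrite /powR (gt_eqF (expR_gt0 _)) expRK; congr expR.
  have -> : Re (translation_exponent a x.1 / (2 * p j)%:C) =
      (2 * p j)^-1 * Re (translation_exponent a x.1).
    by rewrite -fmorphV [X in Re X]mulrC ReZ.
  rewrite mulrA mulfV// mul1r /translation_exponent.
  by case: (dotmx x.1 a) => u v /=; ring.
rewrite [c * _]mulrC -mulrA -expRD; congr (_ * expR _); ring.
Qed.

Lemma phiaK a x : phia p mu (- a) (phia p mu a x) = x.
Proof.
rewrite !phiaE /= addrK [RHS]surjective_pairing; congr pair.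
rewrite -[RHS]submxrowK; apply: eq_mxrow => j; rewrite mxrowK scalerA -cexpD -mulrDl.
have -> : translation_exponent (- a) (x.1 + a) + translation_exponent a x.1 = 0.
  rewrite /translation_exponent vnormN.
  have -> : dotmx (x.1 + a) (- a) = - dotmx x.1 a - (vnorm a ^+ 2)%:C.
    rewrite -dotmx_vnorm !dotmx_sum -!sumrN -big_split; apply: eq_bigr => i _ /=.
    by rewrite !mxE rmorphN mulrN mulrDl opprD.
  rewrite rmorphM; ring.
by rewrite mul0r cexp0 scale1r.
Qed.

Lemma phia_differentiable a x : differentiable (phia p mu a : E -> E) x.
Proof.
have -> : phia p mu a = (fun x => (x.1 + a,
    \mxrow_j (cexp (translation_exponent a x.1 / (2 * p j)%:C) *: submxrow x.2 j))) :> (E -> E).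
  by apply/funext => y; rewrite phiaE.
apply: differentiable_pair; apply: differentiable_row => i.
  have -> : (fun y : E => (y.1 + a) 0 i) = fun y => y.1 0 i + a 0 i.
    by apply/funext => y; rewrite mxE.
  apply: differentiable_fun_add; last exact: differentiable_cst.
  by apply: differentiable_coordinate; left; exists i.
pose j := tagnat.sig1 i.
have -> : (fun y : E => (\mxrow_j (cexp (translation_exponent a y.1 / (2 * p j)%:C) *:
    submxrow y.2 j)) 0 i) =
    fun y => cexp (translation_exponent a y.1 / (2 * p j)%:C) * y.2 0 i.
  by apply/funext => y; rewrite mxE mxE -coord_submxrow.
apply: differentiable_fun_mul; last by apply: differentiable_coordinate; right; exists i.
apply: (@differentiable_cdiff R E (fun y => translation_exponent a y.1 / (2 * p j)%:C) (@cexp R) x);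
  last exact: cdiff_cexp.
have -> : (fun y : E => translation_exponent a y.1 / (2 * p j)%:C) =
    fun y => (- 2 * mu%:C * (\sum_k y.1 0 k * conjc (a 0 k)) + - (mu * vnorm a ^+ 2)%:C) *
      (2 * p j)%:C^-1.
  by apply/funext => y; rewrite /translation_exponent dotmx_sum.
apply: differentiable_fun_mul; last exact: differentiable_cst.
apply: differentiable_fun_add; last exact: differentiable_cst.
apply: differentiable_fun_mul; first exact: differentiable_cst.
apply: differentiable_fun_sum => k; apply: differentiable_fun_mul; last exact: differentiable_cst.
by apply: differentiable_coordinate; left; exists k.
Qed.

Lemma holo_phia (a : 'rV[R[i]]_n0) : holo_pair (n := n) (p := p) (mu := mu) (phia p mu a) (phia p mu (- a)).
Proof.
split.
- split=> [x|x _]; last exact: phia_differentiable.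
  by rewrite /inD phia_level.
- split=> [x|x _]; last exact: phia_differentiable.
  by rewrite /inD phia_level.
- by move=> x _; exact: phiaK.
- by move=> x _; rewrite -{1}(opprK a) phiaK.
Qed.

Lemma generator_holo_pair f : fbh_generator (n := n) p mu f ->
  exists g, holo_pair (p := p) (mu := mu) f g.
Proof.
by case=> [A /holo_phiA|s ns Gam ps GU|a]; [|exact: holo_phiD|eexists; exact: holo_phia].
Qed.

Lemma holo_pair_comp f f' g g' : holo_pair (p := p) (mu := mu) f f' ->
  holo_pair (p := p) (mu := mu) g g' ->
  holo_pair (p := p) (mu := mu) (f \o g) (g' \o f').
Proof.
move=> [[fD df] [f'D df'] fK f'K] [[gD dg] [g'D dg'] gK g'K]; split.
- split=> x xD; first by apply: fD; exact: gD.
  exact: (@differentiable_comp _ E E E g f x (dg x xD) (df _ (gD x xD))).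
- split=> x xD; first by apply: g'D; exact: f'D.
  exact: (@differentiable_comp _ E E E f' g' x (df' x xD) (dg' _ (f'D x xD))).
- by move=> x xD /=; rewrite fK ?gK//; exact: gD.
- by move=> x xD /=; rewrite g'K ?f'K//; exact: f'D.
Qed.

Lemma holo_pair_eq f f' g : holo_pair (p := p) (mu := mu) f g ->
  (forall x, D x -> f x = f' x) -> holo_pair (p := p) (mu := mu) f' g.
Proof.
move=> [[fD df] [gD dg] fK gK] E; split=> //.
- split=> x xD; first by rewrite -E//; exact: fD.
  apply: near_eq_differentiable (df x xD).
  by have := open_nbhs_nbhs (conj (inD_open hp) xD); apply: filterS.
- by move=> x xD; rewrite -E// fK.
- by move=> x xD; rewrite -E ?gK//; exact: gD.
Qed.

Lemma holo_pair_id : holo_pair (p := p) (mu := mu) (id : E -> E) id.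
Proof.
have di (x : E) : differentiable (id : E -> E) x 
  by apply: (@linear_differentiable _ _ _ idfun) => ? //.
by split=> //; split.
Qed.

Lemma generated_holo_pair f : generated_subgroup D (fbh_generator p mu) f ->
  exists g, holo_pair (p := p) (mu := mu) f g.
Proof.
elim=> {f} [f /generator_holo_pair//||f g _ [f' ff'] _ [g' gg']|f g _ [f' ff'] [fD gD gK fK]|f g _ [f' ff'] fg].
- by exists id; exact: holo_pair_id.
- by exists (g' \o f'); exact: holo_pair_comp.
(* The inverse [g] is given only as a map; on the domain it agrees with the holomorphic inverse [f']
   and so inherits its differentiability. *)
- exists f; apply: holo_pair_eq (holo_pair_sym ff') _ => x xD.
  by have [_ _ f'K _] := ff'; rewrite -{1}(fK x xD) f'K//; exact: gD.
- by exists f'; exact: holo_pair_eq ff' fg.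
Qed.

End Generators.

Lemma linear_mx (K : nzRingType) (a b : nat) (h : 'rV[K]_a -> 'rV[K]_b) :
  (forall u v, h (u + v) = h u + h v) -> (forall t u, h (t *: u) = t *: h u) ->
  exists A, forall u, h u = u *m A.
Proof.
move=> hD hZ; have lin : linear h by move=> t u v; rewrite hD hZ.
pose hL : {linear 'rV[K]_a -> 'rV[K]_b} := HB.pack h (GRing.isLinear.Build _ _ _ _ h lin).
by exists (lin1_mx hL) => u; rewrite mul_rV_lin1.
Qed.

Section Main.
Context {R : realType} {l n0 : nat} {n : 'I_l -> nat} {p : 'I_l -> R} {mu : R}.
Hypotheses (hl : (0 < l)%N) (hn0 : (0 < n0)%N) (hn : forall j, (0 < n j)%N).
Hypotheses (hp : forall j, 0 < p j) (hmu : 0 < mu).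
Hypothesis hp1 : forall j : 'I_l, (0 < j)%N -> p j != 1.
Local Notation N := (\sum_(j < l) n j)%N.
Local Notation E := ('rV[R[i]]_n0 * 'rV[R[i]]_N)%type.
Local Notation D := (inD p mu : set E).
Implicit Types (x : E) (f g : E -> E).

Lemma normalized_generated f g : holo_pair (p := p) (mu := mu) f g ->
  f (0, 0) = (0, 0) -> generated_subgroup D (fbh_generator p mu) f.
Proof.
move=> fg f00.
have nf x : D x -> f x = (base_diff f x.1, fiber_diff f 0 x.2).
  case: x => z w xD; rewrite (aut_fiber_form hn0 hp hmu fg xD).
  by have [-> ->] := normalized_form hl hn0 hn hp hmu z w fg f00.
have [A AE] := linear_mx (base_diffD f) (fun t u => base_diffZ f u t).
have [T TE] := linear_mx (fiber_diffD f 0) (fun t u => fiber_diffZ f 0 u t).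
have AU : A \is unitarymx.
  apply: isometry_unitary => z; rewrite -AE.
  have [<- _] := normalized_form hl hn0 hn hp hmu z 0 fg f00.
  exact: (base_isometry hl hn0 hn hp hmu z fg f00).
have isoT w : gauge p w < 1 -> gauge p (w *m T) = gauge p w.
  by rewrite -TE; exact: (fiber_gauge_eq hl hn0 hn hp hmu fg f00).
have [s [ns [Gam [ps GU TF]]]] := gauge_isometry_form hn hp hp1 isoT.
apply: (@generated_eq _ _ _ (phiA A \o phiD ns Gam)).
  apply: generated_comp; apply: generated_base; first exact: gen_phiA.
  exact: gen_phiD.
by move=> x xD; rewrite nf// AE TE TF.
Qed.

Lemma aut_generated f g : holo_pair (p := p) (mu := mu) f g ->
  generated_subgroup D (fbh_generator p mu) f.
Proof.
move=> fg; pose b := (f (0, 0)).1.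
have f1P := holo_pair_comp (holo_pair_sym (holo_phia (n := n) hp b)) fg.
have f100 : (phia p mu (- b) \o f) (0, 0) = (0, 0).
  rewrite [LHS]surjective_pairing (aut_zero_section hn0 hp hmu _ f1P).
  by rewrite -[X in (X, _)]/(b - b) subrr.
apply: (@generated_eq _ _ _ (phia p mu b \o (phia p mu (- b) \o f))).
  apply: generated_comp; first by apply: generated_base; exact: gen_phia.
  exact: normalized_generated f1P f100.
by move=> x _ /=; rewrite -{1}(opprK b) phiaK.
Qed.

End Main.

Theorem theorem1p6 (R : realType) (l n0 : nat) (n : 'I_l -> nat)
    (p : 'I_l -> R) (mu : R)
    (hl : (0 < l)%N) (hn0 : (0 < n0)%N) (hn : forall j, (0 < n j)%N)
    (hp : forall j, 0 < p j) (hmu : 0 < mu)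
    (hp1 : forall j : 'I_l, (0 < j)%N -> p j != 1) :
  holo_aut (fbh_domain p mu : set (fbh_space R n0 n))
  = generated_subgroup (fbh_domain p mu) (fbh_generator p mu).
Proof.
have DE : fbh_domain p mu = (inD p mu : set (fbh_space R n0 n)).
  by apply/seteqP; split=> x /domainE.
rewrite DE; apply/seteqP; split=> f.
  case=> g [[fD gD gK fK] df dg].
  have fg : holo_pair (p := p) (mu := mu) f g by split.
  exact: (aut_generated hl hn0 hn hp hmu hp1 fg).
move=> /(generated_holo_pair hp)[g [[fD df] [gD dg] gK fK]].
by exists g; split.
Qed.
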